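(* Let $X$ be a Banach space whose dual $X^*$ is separable. Then $X$ has the graphon representation property if and only if $X$ is reflexive.
   Context: All Banach spaces are real; $[0,1]^S$ ($S$ a finite set) carries Lebesgue measure; $\langle\phi,x\rangle:=\phi(x)$ for $\phi\in X^*$, $x\in X$. An $X$-decorated target graph is a pair $\mathbf G=(G,g)$ where $G$ is a finite graph that is complete and completely looped (every two vertices are adjacent and every vertex has a loop) and $g:E(G)\to X$. An $X^*$-decorated test graph is a pair $\mathbf F=(F,f)$ where $F$ is a finite simple graph (without loops) and $f:E(F)\to X^*$. The homomorphism density is $$t(\mathbf F,\mathbf G)=\frac{1}{|V(G)|^{|V(F)|}}\sum_{\varphi:V(F)\to V(G)}\ \prod_{ij\in E(F)}\langle f(ij),g(\varphi(i)\varphi(j))\rangle,$$ the sum being over all maps $\varphi$. For $1\le p<\infty$ put $\|\mathbf G\|_p=\big(|V(G)|^{-2}\sum_{u,v\in V(G)}\|g(uv)\|_X^p\big)^{1/p}$. An $X$-valued Bochner graphon is a Bochner (strongly) measurable function $W:[0,1]^2\to X$ which is symmetric ($W(x,y)=W(y,x)$ for a.e. $(x,y)$) and satisfies $\|W(\cdot,\cdot)\|_X\in L^p([0,1]^2)$ for every $1\le p<\infty$. Its densities are $$t(\mathbf F,W)=\int_{[0,1]^{V(F)}}\prod_{ij\in E(F)}\langle f(ij),W(x_i,x_j)\rangle\prod_{i\in V(F)}dx_i.$$ $X$ has the graphon representation property if: whenever a sequence $(\mathbf G_n)$ of $X$-decorated target graphs satisfies (1) $\sup_n\|\mathbf G_n\|_p<\infty$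 for every $1\le p<\infty$ and (2) $(t(\mathbf F,\mathbf G_n))_n$ converges for every $X^*$-decorated test graph $\mathbf F$, there is an $X$-valued Bochner graphon $W$ with $t(\mathbf F,\mathbf G_n)\to t(\mathbf F,W)$ for every $X^*$-decorated test graph $\mathbf F$. *)

(* Defs.v *)
From HB Require Import structures.
From mathcomp Require Import all_boot all_order all_algebra.
From mathcomp Require Import all_classical all_reals all_analysis.

Set Implicit Arguments.
Unset Strict Implicit.
Unset Printing Implicit Defensive.

Import Order.TTheory GRing.Theory Num.Theory.
Import numFieldNormedType.Exports.

Local Open Scope classical_set_scope.
Local Open Scope ring_scope.

Section dual.
Context {R : realType} {X : normedModType R}.

Definition continuous_linear : {pred X -> R} :=
  mem [set phi : X -> R | linear phi /\ continuous phi].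

Record dual := Dual {
  dual_fun :> X -> R;
  dualP : dual_fun \in continuous_linear
}.

HB.instance Definition _ := [isSub for dual_fun].
HB.instance Definition _ := [Choice of dual by <:].

Lemma continuous_linear_submod_closed : submod_closed continuous_linear.
Proof.
split.
  by rewrite inE; split => [a x y|x]; [rewrite /= scaler0 addr0|
    exact: cst_continuous].
move=> a f g; rewrite !inE => -[lf cf] [lg cg]; split => [b x y|x].
  by rewrite !fctE lf lg !scalerDr !scalerA addrACA (mulrC a b).
by apply: cvgD; [apply: cvgZl_tmp; exact: cf|exact: cg].
Qed.

HB.instance Definition _ := GRing.isSubmodClosed.Build R (X -> R)
  continuous_linear continuous_linear_submod_closed.
HB.instance Definition _ := [SubChoice_isSubLmodule of dual by <:].

Definition dual_norm (phi : dual) : R :=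
  sup [set `|phi x| | x in [set x : X | `|x| <= 1]].

Lemma dual_linear (phi : dual) : linear phi.
Proof. by have /set_mem[] := dualP phi. Qed.

Lemma dual_continuous (phi : dual) : continuous phi.
Proof. by have /set_mem[] := dualP phi. Qed.

Lemma dualE (phi psi : dual) : phi =1 psi -> phi = psi.
Proof. by move=> h; apply: val_inj; apply/funext. Qed.

Lemma dualDE (phi psi : dual) x : (phi + psi) x = phi x + psi x.
Proof. by []. Qed.

Lemma dualZE a (phi : dual) x : (a *: phi) x = a * phi x.
Proof. by []. Qed.

Lemma dual_scale (phi : dual) a x : phi (a *: x) = a * phi x.
Proof.
have l0 : phi 0 = 0.
  have := dual_linear phi 1 0 0; rewrite scaler0 addr0 scale1r.
  by move=> /eqP; rewrite -subr_eq0 opprD addNKr oppr_eq0 => /eqP.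
by have := dual_linear phi a x 0; rewrite l0 !addr0.
Qed.

Lemma dual_has_sup (phi : dual) :
  has_sup [set `|phi x| | x in [set x : X | `|x| <= 1]].
Proof.
split; first by exists `|phi 0|, 0 => //=; rewrite normr0.
pose h := GRing.isLinear.Build _ _ _ _ (dual_fun phi) (dual_linear phi).
pose f : {linear X -> R^o} := HB.pack (dual_fun phi) h.
have /linear_bounded_continuous/linear_boundedP : continuous f.
  exact: dual_continuous.
move=> /pinfty_ex_gt0[M M0 fM]; exists M => _ [x /= x1 <-].
by rewrite (le_trans (fM x))// ler_piMr// ltW.
Qed.

Lemma dual_norm_ge (phi : dual) x : `|x| <= 1 -> `|phi x| <= dual_norm phi.
Proof. by move=> x1; apply: sup_upper_bound; [exact: dual_has_sup|exists x]. Qed.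

Lemma dual_norm_le (phi : dual) M :
  (forall x, `|x| <= 1 -> `|phi x| <= M) -> dual_norm phi <= M.
Proof.
move=> h; apply: ge_sup; first by have [] := dual_has_sup phi.
by move=> _ [x x1 <-]; exact: h.
Qed.

Lemma dual_norm_bound (phi : dual) x : `|phi x| <= dual_norm phi * `|x|.
Proof.
have [->|x0] := eqVneq x 0.
  by rewrite normr0 mulr0 -(scale0r 0) dual_scale mul0r normr0.
have nx : 0 < `|x| by rewrite normr_gt0.
have := @dual_norm_ge phi (`|x|^-1 *: x).
rewrite normrZ normfV normr_id mulVf ?gt_eqF// => /(_ (lexx _)).
by rewrite dual_scale normrM normfV normr_id mulrC ler_pdivrMr.
Qed.

Lemma dual_normD (phi psi : dual) :
  dual_norm (phi + psi) <= dual_norm phi + dual_norm psi.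
Proof.
apply: dual_norm_le => x x1; rewrite dualDE (le_trans (ler_normD _ _))//.
by apply: lerD; exact: dual_norm_ge.
Qed.

Lemma dual_normZ a (phi : dual) : dual_norm (a *: phi) = `|a| * dual_norm phi.
Proof.
apply/eqP; rewrite eq_le; apply/andP; split.
  apply: dual_norm_le => x x1.
  by rewrite dualZE normrM ler_wpM2l// dual_norm_ge.
have [->|a0] := eqVneq a 0.
  rewrite normr0 mul0r (le_trans _ (@dual_norm_ge _ 0 _))// normr0//.
rewrite -ler_pdivlMl ?normr_gt0//; apply: dual_norm_le => x x1.
rewrite ler_pdivlMl ?normr_gt0// -normrM.
exact: (@dual_norm_ge (a *: phi)).
Qed.

Lemma dual_norm_eq0 (phi : dual) : dual_norm phi = 0 -> phi = 0.
Proof.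
move=> p0; apply: dualE => x; apply/eqP; rewrite -normr_le0.
by rewrite (le_trans (dual_norm_bound _ _))// p0 mul0r.
Qed.

HB.instance Definition _ :=
  Lmodule_isNormed.Build R dual dual_normD dual_normZ dual_norm_eq0.

End dual.
Arguments dual {R} X.

Section reflexive.
Context {R : realType} {X : normedModType R}.

Definition eval_at (x : X) (phi : dual X) : R := phi x.

Lemma eval_at_continuous_linear x : eval_at x \in continuous_linear.
Proof.
rewrite inE; split => [a phi psi //|phi].
apply/(@cvgrPdist_le _ _ _ (nbhs phi) _) => e e0.
have x1 : 0 < `|x| + 1 by rewrite ltr_wpDl.
have d0 : 0 < e / (`|x| + 1) by rewrite divr_gt0.
apply/(@nbhs_normP _ (dual X)); exists (e / (`|x| + 1)) => //= psi.
rewrite /ball_/= => /ltW phipsi; rewrite /eval_at.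
have -> : phi x - psi x = (phi - psi) x by [].
rewrite (le_trans (dual_norm_bound _ _))//.
rewrite (@le_trans _ _ (e / (`|x| + 1) * `|x|))//.
  exact: ler_wpM2r.
by rewrite mulrAC ler_pdivrMr// ler_wpM2l ?ltW// ltrDl.
Qed.

Definition bidual_embedding (x : X) : dual (dual X) :=
  Dual (eval_at_continuous_linear x).

End reflexive.

Definition reflexive_space {R : realType} (X : normedModType R) : Prop :=
  range (@bidual_embedding R X) = setT.

Definition separable (T : topologicalType) : Prop :=
  exists2 D : set T, countable D & dense D.

Section cube.
Context (R : realType).
Local Notation R1 := (measurableTypeR R).

(* Lebesgue measure of [0, 1], as a probability measure carried by all of R;
   product measures below are likewise carried by R * R and n.-tuple R, and
   values of integrands outside of the unit cube are irrelevant. *)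
Definition unit_lebesgue : set R1 -> \bar R :=
  mrestr (@lebesgue_measure R) (measurable_itv `[0, 1]).

HB.instance Definition _ := Measure.on unit_lebesgue.

Lemma unit_lebesgue_setT : unit_lebesgue setT = 1%:E.
Proof.
by rewrite /unit_lebesgue /mrestr setTI lebesgue_measure_itv/= lte01 -EFinB subr0.
Qed.

HB.instance Definition _ :=
  Measure_isProbability.Build _ _ _ unit_lebesgue unit_lebesgue_setT.

Definition square_lebesgue : probability (R1 * R1)%type R :=
  (unit_lebesgue \x unit_lebesgue)%E.

Definition tcons n (z : R1 * n.-tuple R1) : n.+1.-tuple R1 :=
  [the n.+1.-tuple R1 of z.1 :: z.2].

Lemma measurable_tcons n : measurable_fun setT (@tcons n).
Proof. exact: measurable_cons. Qed.

HB.instance Definition _ n :=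
  isMeasurableFun.Build _ _ _ _ (@tcons n) (@measurable_tcons n).

Fixpoint cube_lebesgue n : probability (n.-tuple R1) R :=
  match n with
  | 0 => \d_ ([tuple] : 0.-tuple R1)
  | n.+1 => distribution (unit_lebesgue \x cube_lebesgue n)%E (@tcons n)
  end.

End cube.

Section bochner.
Context d (T : measurableType d) (R : realType) (X : normedModType R).

Definition simple_function (s : T -> X) : Prop :=
  finite_set (range s) /\ forall y, measurable (s @^-1` [set y]).

Definition bochner_measurable (mu : {measure set T -> \bar R}) (f : T -> X) :=
  exists2 s : nat -> T -> X, forall n, simple_function (s n) &
    {ae mu, forall z, s n z @[n --> \oo] --> f z}.

End bochner.

Section decorated_graphs.
Context {R : realType} (X : normedModType R).

(* Every pair of vertices, equal or not, is an edge; a decoration of the edges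
   is a symmetric function of two vertices. *)
Record target_graph := TargetGraph {
  target_vertex : finType;
  target_decoration : target_vertex -> target_vertex -> X;
  target_nonempty : (0 < #|target_vertex|)%N;
  target_sym : forall u v, target_decoration u v = target_decoration v u
}.

(* The values of the decoration outside of the edges are irrelevant. *)
Record test_graph := TestGraph {
  test_vertex : finType;
  test_edge : rel test_vertex;
  test_decoration : test_vertex -> test_vertex -> dual X;
  test_edge_sym : symmetric test_edge;
  test_edge_irr : irreflexive test_edge;
  test_sym : forall i j, test_edge i j ->
    test_decoration i j = test_decoration j i
}.

(* Selects one of the two orientations of each edge. *)
Definition oriented_edge (F : test_graph) (e : test_vertex F * test_vertex F) :=
  test_edge e.1 e.2 && (enum_rank e.1 < enum_rank e.2)%N.

Definition hom_density (F : test_graph) (G : target_graph) : R :=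
  (#|target_vertex G|%:R ^+ #|test_vertex F|)^-1 *
  \sum_(phi : {ffun test_vertex F -> target_vertex G})
    \prod_(e | oriented_edge e)
      test_decoration e.1 e.2 (target_decoration (phi e.1) (phi e.2)).

Definition target_norm (p : R) (G : target_graph) : R :=
  ((#|target_vertex G|%:R ^+ 2)^-1 *
    \sum_u \sum_v `|@target_decoration G u v| `^ p) `^ p^-1.

(* A Bochner measurable function is measurable for the Lebesgue, not
   necessarily the Borel, sigma-algebra. Integrals against Borel measures still
   have their usual value on such functions, because \int is defined through
   the simple functions below the positive and negative parts. *)
Definition bochner_graphon (W : R * R -> X) : Prop :=
  [/\ bochner_measurable (square_lebesgue R) W,
      {ae square_lebesgue R, forall z, W (z.1, z.2) = W (z.2, z.1)} &
      forall p : R, 1 <= p ->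
        (\int[square_lebesgue R]_z (`|W z| `^ p)%:E < +oo)%E].

Definition graphon_density (F : test_graph) (W : R * R -> X) : R :=
  \int[cube_lebesgue R #|test_vertex F|]_x
    \prod_(e | oriented_edge e)
      test_decoration e.1 e.2
        (W (tnth x (enum_rank e.1), tnth x (enum_rank e.2))).

Definition graphon_representation_property : Prop :=
  forall G : nat -> target_graph,
    (forall p : R, 1 <= p -> has_ubound (range (fun n => target_norm p (G n)))) ->
    (forall F : test_graph, cvgn (fun n => hom_density F (G n))) ->
    exists2 W : R * R -> X, bochner_graphon W &
      forall F : test_graph,
        hom_density F (G n) @[n --> \oo] --> graphon_density F W.

End decorated_graphs.

(* Main.v *)
(* If X is reflexive, X is separable too. Fix functionals phi_0, phi_1, ... dense
   in X^*. A weak regularity lemma, treating each phi_k infinitely often,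
   produces for every target graph a refining sequence of vertex codes (4 ^ b
   codes at level b) such that averaging over codes changes all the densities by
   little, uniformly in the graph: the counting lemma is available because all
   moments are bounded. Along an ultrafilter the code masses converge, and the
   averaged decorations converge weakly by reflexivity. The limits define step
   kernels on the square which form a martingale; all their scalar images are
   L^2-bounded, hence L^1-Cauchy, and the kernels converge weakly almost
   everywhere to a function which is Bochner measurable as X is separable.

   Conversely, for L in the bidual, Helly's theorem and the separability of X^*
   give a bounded sequence x_n with psi(x_n) --> L psi for every psi. The
   one-vertex graphs with loop x_n have convergent densities; if W represents
   the limit, the one-edge test graph decorated with psi gives
   L psi = \int psi(W), so L is the evaluation at the Bochner mean of W. *)

From HB Require Import structures.
Require Import Defs.
From mathcomp Require Import all_boot all_order all_algebra.
From mathcomp Require Import all_classical all_reals all_analysis.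
From mathcomp Require Import measurable_realfun.
From mathcomp Require Import zify ring lra.

Set Implicit Arguments.
Unset Strict Implicit.
Unset Printing Implicit Defensive.

Import Order.TTheory GRing.Theory Num.Theory.
Import numFieldNormedType.Exports.

Local Open Scope classical_set_scope.
Local Open Scope ring_scope.

(** * Hahn-Banach and Helly theorems *)

(** Each functional calls for a regularity partition of its own, whereas the limit kernel needs one
    nested family for all of them; countably many functionals suffice because an error in the
    functional costs only its norm times a first moment. Codes are numbered by [4 ^ b] for every
    graph, empty classes included, so that class masses and averages can be compared across graphs
    entry by entry; the four comes from splitting a class by two vertex subsets, one for each
    argument of the kernel. Decorations are unbounded, so the estimates trade a level [K] against a
    higher moment divided by [K]. Averages converge only weakly: their norms pass to the limit by
    lower semicontinuity, and L^2 orthogonality is available only after a functional is applied.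
    Almost everywhere convergence comes from levels sparse enough for summable increments. The
    ultrafilter keeps all limits along one filter and does not change those of the densities, which
    converge already. *)

Section dual_linearity.
Context {R : realType} {X : normedModType R}.
Implicit Types (phi : dual X) (x y : X).

Lemma dualD phi x y : phi (x + y) = phi x + phi y.
Proof. by have := dual_linear phi 1 x y; rewrite !scale1r. Qed.

Lemma dual0 phi : phi 0 = 0.
Proof. by rewrite -(scale0r 0) dual_scale mul0r. Qed.

Lemma dualN phi x : phi (- x) = - phi x.
Proof. by rewrite -scaleN1r dual_scale mulN1r. Qed.

Lemma dualB phi x y : phi (x - y) = phi x - phi y.
Proof. by rewrite dualD dualN. Qed.

Lemma dual_sum phi I (r : seq I) (P : pred I) (F : I -> X) :
  phi (\sum_(i <- r | P i) F i) = \sum_(i <- r | P i) phi (F i).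
Proof. by elim/big_rec2: _ => [|i y x _ <-]; [exact: dual0|rewrite dualD]. Qed.

Lemma dual_le phi x : `|phi x| <= `|phi| * `|x|.
Proof. exact: dual_norm_bound. Qed.

Lemma dual_norm_le_bound phi M :
  0 <= M -> (forall x, `|phi x| <= M * `|x|) -> `|phi| <= M.
Proof.
move=> M0 h; apply: dual_norm_le => x x1; rewrite (le_trans (h _))//.
by rewrite ler_piMr.
Qed.

End dual_linearity.

Section hahn_banach.
Context {R : realType} {X : normedModType R}.

Definition sublinear (p : X -> R) :=
  (forall x y, p (x + y) <= p x + p y) /\
  (forall a x, 0 <= a -> p (a *: x) = a * p x).

Lemma sublinear0 p : sublinear p -> p 0 = 0.
Proof. by move=> [_ hp]; rewrite -(scale0r 0) hp// mul0r. Qed.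

Lemma sublinear_ge_opp p x : sublinear p -> - p (- x) <= p x.
Proof.
move=> sp; have := sp.1 x (- x); rewrite subrr sublinear0//; lra.
Qed.

(** The classical modification of [p] along the ray of [x0]: it stays below [p] and is at most
    [- p x0] at [- x0], so that any linear functional below it takes the value [p x0] at [x0]. *)
Definition tilt (p : X -> R) x0 y :=
  inf [set p (y + t *: x0) - t * p x0 | t in [set t : R | 0 <= t]].

Section tilt.
Variables (p : X -> R) (x0 : X).
Hypothesis sp : sublinear p.

Let A y := [set p (y + t *: x0) - t * p x0 | t in [set t : R | 0 <= t]].

Let A_inf y : has_inf (A y).
Proof.
split; first by exists (p (y + 0 *: x0) - 0 * p x0), 0 => /=.
exists (- p (- y)) => _ [t /= t0 <-].
have := sp.1 (y + t *: x0) (- y); rewrite addrAC subrr add0r sp.2//.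
lra.
Qed.

Let tilt_le_at y (t : R) : 0 <= t -> tilt p x0 y <= p (y + t *: x0) - t * p x0.
Proof. by move=> t0; apply: ge_inf; [exact: (A_inf y).2|exists t]. Qed.

Let le_tilt y (m : R) : (forall t : R, 0 <= t -> m <= p (y + t *: x0) - t * p x0) ->
  m <= tilt p x0 y.
Proof.
move=> h; apply: lb_le_inf; first exact: (A_inf y).1.
by move=> _ [t /= t0 <-]; exact: h.
Qed.

Lemma tilt_le y : tilt p x0 y <= p y.
Proof. by have := @tilt_le_at y 0 (lexx _); rewrite scale0r addr0 mul0r subr0. Qed.

Lemma tilt_opp : tilt p x0 (- x0) <= - p x0.
Proof.
have := @tilt_le_at (- x0) 1 ler01.
by rewrite scale1r addNr sublinear0// mul1r sub0r.
Qed.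

Lemma tilt_sublinear : sublinear (tilt p x0).
Proof.
(* One inequality for all positive factors is enough: for [a^-1] and [a *: x] it becomes the reverse
   one. *)
have pos (a : R) x : 0 < a -> a * tilt p x0 x <= tilt p x0 (a *: x).
  move=> a0; apply: le_tilt => t t0.
  have -> : a *: x + t *: x0 = a *: (x + (a^-1 * t) *: x0).
    by rewrite scalerDr scalerA mulrA divff ?mul1r// gt_eqF.
  have at0 : 0 <= a^-1 * t by rewrite mulr_ge0// invr_ge0 ltW.
  rewrite sp.2 ?(ltW a0)// -{2}(mul1r t) -(@divff _ a) ?gt_eqF// -!mulrA -mulrBr.
  by rewrite ler_wpM2l ?(ltW a0)// mulrA tilt_le_at.
split=> [x y|a x].
  rewrite -lerBlDl; apply: le_tilt => t t0.
  rewrite lerBlDl -lerBlDr; apply: le_tilt => s s0; rewrite lerBlDr.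
  have := @tilt_le_at (x + y) (s + t) (addr_ge0 s0 t0).
  have := sp.1 (x + s *: x0) (y + t *: x0).
  rewrite addrACA -scalerDl mulrDl; lra.
rewrite le_eqVlt => /predU1P[<-|a0].
  rewrite scale0r mul0r; apply/eqP; rewrite eq_le; apply/andP; split.
    by rewrite (le_trans (tilt_le _))// sublinear0.
  by apply: le_tilt => t t0; rewrite add0r sp.2// subrr.
apply/eqP; rewrite eq_le pos// andbT.
have := pos a^-1 (a *: x); rewrite invr_gt0 => /(_ a0).
by rewrite scalerA mulVf ?gt_eqF// scale1r ler_pdivrMl.
Qed.

End tilt.

(* A minimal sublinear functional [q] equals all its tilts, so that
   [q (- x) <= - q x] and [q] is linear. *)
Lemma minimal_sublinear p : sublinear p ->
  exists2 q : X -> R, sublinear q /\ (forall x, q x <= p x) &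
    forall x, q (- x) = - q x.
Proof.
move=> sp.
pose T := {q : X -> R | sublinear q /\ (forall x, q x <= p x)}.
pose le (q r : T) := `[< forall x, sval r x <= sval q x >].
have [|||A totA|[q [sq qp]] qmin] := @Zorn T le.
- by move=> q; apply/asboolP.
- move=> q r s /asboolP qr /asboolP rs; apply/asboolP => x.
  exact: le_trans (rs x) (qr x).
- move=> [q ?] [r ?] /asboolP qr /asboolP rq; apply: eq_exist => /=.
  by apply/funext => x; apply/eqP; rewrite eq_le qr rq.
- have [->|/set0P[r0 Ar0]] := eqVneq A set0.
    by exists (exist _ p (conj sp (fun x => lexx (p x)))).
  pose I x := [set sval r x | r in A].
  have lb x : lbound (I x) (- p (- x)).
    move=> _ [[r [sr rp]] Ar <-] /=.
    by apply: le_trans (sublinear_ge_opp x sr); rewrite lerN2.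
  have hI x : has_inf (I x).
    by split; [exists (sval r0 x), r0|exists (- p (- x)); exact: lb].
  pose m x := inf (I x).
  have mle x r : A r -> m x <= sval r x.
    by move=> Ar; apply: ge_inf; [exact: (hI x).2|exists r].
  have mge x (b : R) : (forall r, A r -> b <= sval r x) -> b <= m x.
    move=> h; apply: lb_le_inf; first exact: (hI x).1.
    by move=> _ [r Ar <-]; exact: h.
  have sm : sublinear m.
    split=> [x y|a x a0].
      rewrite -lerBlDr; apply: (mge) => r Ar.
      suff: m (x + y) - sval r x <= m y by lra.
      apply: (mge) => s As; rewrite lerBlDl.
      (* Subadditivity of the infimum rests on the chain: the smaller of [r] and [s] serves at both
         points. *)
      have [rs|sr] := totA _ _ Ar As.
        rewrite (le_trans (mle _ _ As))// (le_trans ((svalP s).1.1 x y))//.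
        by rewrite lerD2r; exact: (asboolP _ rs).
      rewrite (le_trans (mle _ _ Ar))// (le_trans ((svalP r).1.1 x y))//.
      by rewrite lerD2l; exact: (asboolP _ sr).
    have pos (b : R) y : 0 < b -> b * m y <= m (b *: y).
      move=> b0; apply: (mge) => r Ar; rewrite (svalP r).1.2 ?(ltW b0)//.
      by rewrite ler_wpM2l ?(ltW b0)// mle.
    move: a0; rewrite le_eqVlt => /predU1P[<-|a0].
      rewrite scale0r mul0r; apply/eqP; rewrite eq_le; apply/andP; split.
        by rewrite (le_trans (mle _ _ Ar0))// sublinear0//; exact: (svalP r0).1.
      by apply: (mge) => r Ar; rewrite sublinear0//; exact: (svalP r).1.
    apply/eqP; rewrite eq_le pos// andbT.
    have := pos a^-1 (a *: x); rewrite invr_gt0 => /(_ a0).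
    by rewrite scalerA mulVf ?gt_eqF// scale1r ler_pdivrMl.
  have mp x : m x <= p x.
    by rewrite (le_trans (mle _ _ Ar0))//; exact: (svalP r0).2.
  exists (exist _ m (conj sm mp)) => r Ar; apply/asboolP => x /=; exact: mle.
exists q => // x.
have tp y : tilt q x y <= p y by rewrite (le_trans (tilt_le x sq y)).
pose r : T := exist _ (tilt q x) (conj (tilt_sublinear x sq) tp).
have /qmin/(congr1 (fun r : T => sval r))/= tq : le (exist _ q (conj sq qp)) r.
  by apply/asboolP => y /=; exact: tilt_le.
have : q (- x) <= - q x.
  by rewrite -{1}tq; exact: tilt_opp.
have := sublinear_ge_opp x sq; lra.
Qed.

(** The minimal functional is taken below the tilt of [p] rather than below [p]: at [- x0] it is
    then at most [- p x0], which forces equality at [x0]. Domination by the norm gives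
    continuity. *)
Lemma hahn_banach p x0 : sublinear p -> (forall x, p x <= `|x|) ->
  exists2 phi : dual X, phi x0 = p x0 & forall x, phi x <= p x.
Proof.
move=> sp pn.
have [q [sq qp] qN] := minimal_sublinear (tilt_sublinear x0 sp).
have qp' x : q x <= p x by rewrite (le_trans (qp _))// tilt_le.
have lq : linear q.
  have qZ a x : q (a *: x) = a * q x.
    have [a0|a0] := leP 0 a; first by rewrite sq.2.
    by rewrite -[in LHS](opprK a) scaleNr qN sq.2 ?mulNr ?opprK// oppr_ge0 ltW.
  move=> a x y; rewrite /GRing.scale/=; apply/eqP; rewrite eq_le; apply/andP; split.
    by rewrite (le_trans (sq.1 _ _))// qZ.
  have := sq.1 (- (a *: x)) (- y); rewrite -opprD !qN qZ; lra.
have qnorm x : `|q x| <= `|x|.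
  rewrite ler_norml lerNl -qN; apply/andP; split.
    by rewrite (le_trans (qp' _))// (le_trans (pn _))// normrN.
  by rewrite (le_trans (qp' _)).
have cq : continuous q.
  move=> x; apply/(@cvgrPdist_le _ _ _ (nbhs x) _) => e e0.
  apply/(@nbhs_normP _ X); exists e => //= y; rewrite /ball_/= => /ltW xy.
  have -> : q x - q y = q (x - y).
    by have := lq (-1) y x; rewrite !scaleN1r (addrC x) => ->; rewrite addrC.
  by rewrite (le_trans (qnorm _)).
have mq : q \in @continuous_linear R X by rewrite inE.
exists (Dual mq) => //=.
apply/eqP; rewrite eq_le qp' /=.
have := qp (- x0); rewrite qN => h; have := le_trans h (tilt_opp x0 sp).
by rewrite lerN2.
Qed.

Lemma norming_functional (x : X) :
  exists2 phi : dual X, `|phi| <= 1 & phi x = `|x|.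
Proof.
have [||phi px ple] := @hahn_banach (fun x => `|x|) x.
- by split=> [u v|a u a0]; [exact: ler_normD|rewrite normrZ ger0_norm].
- by [].
exists phi => //; apply: dual_norm_le_bound => // y; rewrite mul1r.
rewrite ler_norml lerNl ple andbT.
by have := ple (- y); rewrite normrN -scaleN1r dual_scale mulN1r.
Qed.

Lemma dual_sep (x y : X) : (forall phi : dual X, phi x = phi y) -> x = y.
Proof.
move=> h; have [phi _] := norming_functional (x - y).
by rewrite dualB h subrr => /esym/normr0_eq0/eqP; rewrite subr_eq0 => /eqP.
Qed.

Lemma le_norm_dual (x : X) M :
  (forall phi : dual X, `|phi| <= 1 -> phi x <= M) -> `|x| <= M.
Proof. by move=> h; have [phi p1 <-] := norming_functional x; exact: h. Qed.

End hahn_banach.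

(** * Scalar and weak limits along ultrafilters *)

Section ultralimits.
Context {R : realType}.

(** The image of an ultrafilter is an ultrafilter, and here it contains the compact segment from
    [- M] to [M]. *)
Lemma ultra_bounded_cvg (U : set_system nat) (UU : UltraFilter U)
    (u : nat -> R) (M : R) :
  (forall n, `|u n| <= M) -> cvg (u n @[n --> U]).
Proof.
move=> uM.
have := @segment_compact R (- M) M; rewrite compact_ultra => /(_ (u @ U)).
have UfU : UltraFilter (u @ U).
  apply: Build_UltraFilter => G PG uG; apply/funext => A; apply/propext.
  split=> [GA|]; last exact: uG.
  have [//|UnA] := in_ultra_setVsetC (u @^-1` A) UU.
  have GnA : G (~` A) by exact: uG.
  have : G (A `&` ~` A) by exact: filterI.
  by rewrite setICr => /filter_not_empty.
case=> [|l [_ /= ul]]; last by apply/cvg_ex; exists l.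
by apply: (@filterE _ U) => n /=; rewrite in_itv/= -ler_norml.
Qed.

Lemma cvg_ultra_lim (U : set_system nat) (u : nat -> R) (l : R) :
  \oo `<=` U -> u n @[n --> \oo] --> l -> u n @[n --> U] --> l.
Proof. by move=> sU ul A /ul; exact: sU. Qed.

End ultralimits.

Section weak_limits.
Context {R : realType} {X : normedModType R}.

(** The scalar limits along [U] depend linearly and boundedly on the functional, hence form an
    element of the bidual, which reflexivity represents by a vector. *)
Lemma reflexive_lim (U : set_system nat) (UU : UltraFilter U) (x : nat -> X)
    (M : R) : reflexive_space X -> (forall n, `|x n| <= M) ->
  exists y : X, forall phi : dual X, phi (x n) @[n --> U] --> phi y.
Proof.
move=> rX xM.
have FU : ProperFilter U by apply: ultra_proper.
have M0 : 0 <= M by rewrite (le_trans _ (xM 0%N)).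
have b (phi : dual X) n : `|phi (x n)| <= `|phi| * M.
  by rewrite (le_trans (dual_le _ _))// ler_wpM2l.
have c (phi : dual X) := ultra_bounded_cvg UU (b phi).
pose L (phi : dual X) := lim (phi (x n) @[n --> U]).
have Lb (phi : dual X) : `|L phi| <= `|phi| * M.
  have /(@cvg_norm _ R^o) cn := c phi.
  apply: (@closed_cvg _ _ U FU _ [set z | z <= `|phi| * M] _ _ _ cn).
  - exact: closed_le.
  - by apply: filterE => n /=; exact: b.
have Ll : linear L.
  move=> a phi psi; apply: cvg_lim; first exact: Rhausdorff.
  apply: cvgD; last exact: c.
  by apply: (@cvgM _ _ U _ (fun=> a) (fun n => phi (x n)) a); [exact: cvg_cst|exact: c].
have Lc : continuous L.
  move=> phi; apply/(@cvgrPdist_le _ _ _ (nbhs phi) _) => e e0.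
  have M1 : 0 < M + 1 by rewrite ltr_wpDl.
  apply/(@nbhs_normP _ (dual X)); exists (e / (M + 1)); first by rewrite /= divr_gt0.
  move=> psi; rewrite /ball_/= => /ltW xy.
  have -> : L phi - L psi = L (phi - psi).
    by have := Ll (-1) psi phi; rewrite !scaleN1r (addrC phi) => ->; rewrite addrC.
  rewrite (le_trans (Lb _))// -(@divfK _ (M + 1) _ e) ?gt_eqF//.
  by apply: ler_pM => //; rewrite lerDl.
have mL : L \in @continuous_linear R (dual X) by rewrite inE.
have : [set: dual (dual X)] (Dual mL) by [].
rewrite -rX => -[y _ yL]; exists y => phi.
have -> : phi y = L phi by have /(congr1 (fun f : dual (dual X) => f phi)) := yL.
exact: c.
Qed.

End weak_limits.

(** * Separability of a space whose dual is separable *)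

Section separability.
Context {R : realType} {X : normedModType R}.

Lemma separable_seq (T : topologicalType) : separable T -> T ->
  exists s : nat -> T, forall O : set T, open O -> O !=set0 -> exists n, O (s n).
Proof.
move=> [D cD dD] x.
have [D0|/set0P[d Dd]] := eqVneq D set0.
  have := @dD setT; rewrite D0 setI0 => /(_ _ openT) [].
  - by exists x.
  - by [].
have /pfcard_geP[D0|/unsquash f] : (D #<= [set: nat])%card by [].
  by rewrite D0 in Dd.
exists f => O oO O0; have [z [Oz Dz]] := dD O O0 oO.
have [n _ fn] := @surj _ _ _ _ f z Dz.
by exists n; rewrite fn.
Qed.

Lemma separable_approx (Y : normedModType R) : separable Y ->
  exists s : nat -> Y, forall y e, 0 < e -> exists n, `|y - s n| < e.
Proof.
move=> sY; have [s sd] := separable_seq sY 0; exists s => y e e0.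
have [||n] := sd (ball y e).
- exact: ball_open.
- by exists y; exact: ballxx.
by rewrite -ball_normE /= => yn; exists n.
Qed.

Lemma almost_norming (phi : dual X) : exists2 x : X, `|x| <= 1 & `|phi| <= 2 * phi x.
Proof.
have [p0|p0] := eqVneq `|phi| 0.
  by exists 0; rewrite ?normr0// dual0 mulr0 p0.
have pp : 0 < `|phi| / 2 by rewrite divr_gt0// lt_neqAle eq_sym p0 /=.
have [_ [x /= x1 <-]] := sup_adherent pp (dual_has_sup phi).
rewrite -/(dual_norm phi) -[dual_norm phi]/(`|phi|) => h.
have {}h : `|phi| < 2 * `|phi x| by lra.
have [px|px] := leP 0 (phi x).
  by exists x => //; rewrite (ger0_norm px) in h; exact: ltW.
exists (- x); first by rewrite normrN.
by rewrite dualN; rewrite (ltr0_norm px) in h; exact: ltW.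
Qed.

Variable x : nat -> X.

(** The linear span through coefficient lists: the offset [k] makes the recursion structural, and
    lists of rationals, being countable, enumerate a dense part of it. *)
Fixpoint lincomb k (s : seq R) : X :=
  if s is a :: s' then a *: x k + lincomb k.+1 s' else 0.

Lemma lincombD k s t : exists u, lincomb k u = lincomb k s + lincomb k t.
Proof.
elim: s k t => [|a s IH] k [|b t].
- by exists [::]; rewrite addr0.
- by exists (b :: t); rewrite add0r.
- by exists (a :: s); rewrite addr0.
have [u e] := IH k.+1 t; exists (a + b :: u).
by rewrite /= e scalerDl addrACA.
Qed.

Lemma lincombZ k a s : lincomb k [seq a * b | b <- s] = a *: lincomb k s.
Proof.
by elim: s k => [|b s IH] k /=; rewrite ?scaler0// IH scalerDr scalerA.
Qed.

Lemma lincomb_nth k j : exists s, lincomb k s = x (k + j).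
Proof.
elim: j k => [|j IH] k; first by exists [:: 1]; rewrite /= scale1r addr0 addn0.
have [s e] := IH k.+1; exists (0 :: s).
by rewrite /= scale0r add0r e addSnnS.
Qed.

Lemma lincomb_rat k s e : 0 < e ->
  exists q : seq rat, `|lincomb k s - lincomb k (map ratr q)| < e.
Proof.
elim: s k e => [|a s IH] k e e0; first by exists [::]; rewrite subrr normr0.
have e2 : 0 < e / 2 by rewrite divr_gt0.
have [q hq] := IH k.+1 (e / 2) e2.
have nx : 0 < `|x k| + 1 by rewrite ltr_wpDl.
have d0 : 0 < e / 2 / (`|x k| + 1) by rewrite divr_gt0.
have [r] : exists r : rat, ratr r \in `]a, (a + e / 2 / (`|x k| + 1))[.
  by apply: rat_in_itvoo; rewrite ltrDl.
rewrite in_itv/= => /andP[ar ra].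
exists (r :: q) => /=; rewrite opprD addrACA -scalerBl.
rewrite (le_lt_trans (ler_normD _ _))// (splitr e) ler_ltD// normrZ.
have h : `|a - ratr r| <= e / 2 / (`|x k| + 1).
  by rewrite distrC ger0_norm ?subr_ge0 ?(ltW ar)// lerBlDl ltW.
rewrite (@le_trans _ _ (e / 2 / (`|x k| + 1) * `|x k|)) ?ler_wpM2r//.
by rewrite mulrAC ler_pdivrMr// ler_wpM2l ?ltW// ltrDl.
Qed.

Let A y := [set `|y - lincomb 0 s| | s in [set: seq R]].

Let A_inf y : has_inf (A y).
Proof.
by split; [exists `|y - lincomb 0 [::]|, [::]|exists 0 => _ [s _ <-]].
Qed.

(** The seminorm given to Hahn-Banach: a functional below it vanishes at every [x k]. *)
Definition dist_span y := inf (A y).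

Let dist_le y s : dist_span y <= `|y - lincomb 0 s|.
Proof. by apply: ge_inf; [exact: (A_inf y).2|exists s]. Qed.

Let le_dist y (m : R) :
  (forall s, m <= `|y - lincomb 0 s|) -> m <= dist_span y.
Proof.
move=> h; apply: lb_le_inf; first exact: (A_inf y).1.
by move=> _ [s _ <-]; exact: h.
Qed.

Lemma dist_span_norm y : dist_span y <= `|y|.
Proof. by have := dist_le y [::]; rewrite subr0. Qed.

Lemma dist_span_sublinear : sublinear dist_span.
Proof.
split=> [y z|a y].
  suff : dist_span (y + z) - dist_span z <= dist_span y by lra.
  apply: le_dist => s.
  suff : dist_span (y + z) - `|y - lincomb 0 s| <= dist_span z by lra.
  apply: le_dist => t; rewrite lerBlDl; have [u uE] := lincombD 0 s t.
  rewrite (le_trans (dist_le _ u))// uE opprD addrACA.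
  exact: ler_normD.
have pos (b : R) z : 0 < b -> b * dist_span z <= dist_span (b *: z).
  move=> b0; apply: le_dist => s; rewrite -ler_pdivlMl//.
  rewrite (le_trans (dist_le _ [seq b^-1 * c | c <- s]))// lincombZ.
  rewrite -{1}(scale1r z) -(@mulVf _ b) ?gt_eqF// -scalerA -scalerBr normrZ.
  by rewrite gtr0_norm// invr_gt0.
rewrite le_eqVlt => /predU1P[<-|a0].
  rewrite scale0r mul0r; apply/eqP; rewrite eq_le; apply/andP; split.
    by rewrite (le_trans (dist_span_norm _))// normr0.
  by apply: le_dist.
apply/eqP; rewrite eq_le pos// andbT.
have := pos a^-1 (a *: y); rewrite invr_gt0 => /(_ a0).
by rewrite scalerA mulVf ?gt_eqF// scale1r ler_pdivrMl.
Qed.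

Lemma dist_span_nth k : dist_span (x k) <= 0.
Proof.
by have [s sE] := lincomb_nth 0 k; rewrite (le_trans (dist_le _ s))// sE subrr normr0.
Qed.

Lemma dist_spanN_nth k : dist_span (- x k) <= 0.
Proof.
have [s sE] := lincomb_nth 0 k.
rewrite (le_trans (dist_le _ [seq -1 * b | b <- s]))// lincombZ sE scaleN1r.
by rewrite subrr normr0.
Qed.

Lemma dist_span_approx y e : dist_span y < e -> exists s, `|y - lincomb 0 s| < e.
Proof.
move=> h; have [_ [s _ <-] sd] := inf_adherent (eqbRL (subr_gt0 _ _) h) (A_inf y).
by exists s; rewrite (lt_le_trans sd)// -/(dist_span y) addrC subrK.
Qed.

End separability.

(** Vectors almost norming a dense sequence of functionals span a dense subspace: a functional [psi]
    vanishing on them has arbitrarily close neighbours [phi k] whose norm is controlled by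
    [(phi k - psi) (x k)], so that [psi] is zero. Rational combinations of the vectors are then
    dense. *)
Lemma separable_predual {R : realType} {X : normedModType R} :
  separable (dual X) ->
  exists y : nat -> X, forall x e, 0 < e -> exists n, `|x - y n| < e.
Proof.
move=> /(@separable_approx R)-[phi phid].
have /choice[x xP] k : exists z : X, `|z| <= 1 /\ `|phi k| <= 2 * (phi k : dual X) z.
  by have [z ? ?] := almost_norming (phi k); exists z.
have dist0 y : dist_span x y <= 0.
  have [psi <- ple] := hahn_banach y (dist_span_sublinear x) (dist_span_norm x).
  have psi0 k : psi (x k) = 0.
    apply/eqP; rewrite eq_le (le_trans (ple _) (dist_span_nth x k)) /=.
    by rewrite -oppr_le0 -dualN (le_trans (ple _) (dist_spanN_nth x k)).
  suff -> : psi = 0 by [].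
  apply/eqP; rewrite -normr_eq0; apply: contraT => pn.
  (* The norm of [phi k] will be at most twice the distance to [psi], so that of [psi] is at most
     three times this distance; a quarter is less than a third. *)
  have p0 : 0 < `|psi| / 4 by rewrite divr_gt0// normr_gt0 -normr_eq0.
  have [k hk] := phid psi _ p0.
  have [x1 xk] := xP k.
  have h1 : phi k (x k) <= `|phi k - psi|.
    have -> : phi k (x k) = (phi k - psi) (x k).
      by rewrite -[RHS]/(phi k (x k) - psi (x k)) psi0 subr0.
    rewrite (le_trans (ler_norm _))// (le_trans (dual_le _ _))//.
    by rewrite ler_piMr.
  have h2 : `|psi| <= `|psi - phi k| + `|phi k|.
    by rewrite -{1}(subrK (phi k) psi) ler_normD.
  rewrite distrC in h1; lra.
pose y n := lincomb x 0 (map ratr (odflt [::] (unpickle n : option (seq rat)))).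
exists y => z e e0.
have e2 : 0 < e / 2 by rewrite divr_gt0.
have [s hs] := dist_span_approx (le_lt_trans (dist0 z) e2).
have [q hq] := lincomb_rat x 0 s e2.
exists (pickle q); rewrite /y pickleK/=.
rewrite -(subrK (lincomb x 0 s) z) -addrA (le_lt_trans (ler_normD _ _))//.
by rewrite (splitr e) ltrD.
Qed.

Section helly.
Context {R : realType} {X : normedModType R}.

Lemma dual_sumE (I : Type) (r : seq I) (F : I -> dual X) (x : X) :
  (\sum_(i <- r) F i) x = \sum_(i <- r) F i x.
Proof. by elim/big_rec2: _ => [|i y z _ <-]. Qed.

(* At a near-minimiser [x0] of the quadratic defect [D] on the ball, the
   functional [psi = \sum_i (L phi_i - phi_i x0) phi_i] nearly attains its
   maximum over the ball, while [L psi = psi x0 + D x0] must not exceed it. *)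
Lemma helly (L : dual (dual X)) (phi : nat -> dual X) n e : 0 < e ->
  exists2 x : X, `|x| <= `|L| + 1 & forall i, (i < n)%N -> `|phi i x - L (phi i)| <= e.
Proof.
move=> e0; pose M := `|L| + 1; have M0 : 0 < M by rewrite ltr_wpDl.
pose D x := \sum_(i < n) (phi i x - L (phi i)) ^+ 2.
pose A := [set D x | x in [set x | `|x| <= M]].
have D0 x : 0 <= D x by apply: sumr_ge0 => i _; exact: sqr_ge0.
have hA : has_inf A.
  split; first by exists (D 0), 0; rewrite //= normr0 ltW.
  by exists 0 => _ [x _ <-].
have dD x : `|x| <= M -> inf A <= D x.
  by move=> xM; apply: ge_inf; [exact: hA.2|exists x].
suff infA : inf A <= 0.
  have e2 : 0 < e ^+ 2 by rewrite exprn_gt0.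
  have [_ [x /= xM <-]] := inf_adherent e2 hA => Dx.
  exists x => // i ni; rewrite -ler_sqr ?nnegrE ?(ltW e0)// real_normK ?num_real//.
  rewrite (@le_trans _ _ (D x))//.
    by rewrite /D (bigD1 (Ordinal ni))//= lerDl sumr_ge0// => j _; exact: sqr_ge0.
  by rewrite (le_trans (ltW Dx))// -{2}(add0r (e ^+ 2)) lerD2r.
rewrite leNgt; apply/negP => d0; set d := inf A in d0 dD.
pose C := \sum_(i < n) (`|phi i| * (M + M)) ^+ 2 + 1.
have C0 : 0 < C by rewrite ltr_wpDl// sumr_ge0// => i _; exact: sqr_ge0.
(* At most 1, so that moving from [x0] towards [y] by the fraction [t] stays in the ball; small
   enough that the error [t * C] is at most half of the infimum [d]. *)
pose t := Num.min 1 (d / (2 * C)).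
have t0 : 0 < t by rewrite lt_min ltr01 divr_gt0// mulr_gt0.
have t1 : t <= 1 by rewrite ge_min lexx.
have tC : t * C <= d / 2.
  by rewrite -ler_pdivlMr// ge_min -mulrA -invfM lexx orbT.
have t2C : 0 < t ^+ 2 * C by rewrite mulr_gt0// exprn_gt0.
have [_ [x0 /= x0M <-]] := inf_adherent t2C hA; rewrite -/d => Dx0.
pose a i := L (phi i) - phi i x0.
pose psi : dual X := \sum_(i < n) a i *: phi i.
have psiE x : psi x = \sum_(i < n) a i * phi i x by rewrite dual_sumE.
have step y : `|y| <= M -> psi (y - x0) <= t * C.
  move=> yM.
  have := @dD (x0 + t *: (y - x0)).
  have -> : x0 + t *: (y - x0) = (1 - t) *: x0 + t *: y.
    by rewrite scalerBr scalerBl scale1r addrA addrAC.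
  have xM : `|(1 - t) *: x0 + t *: y| <= M.
    rewrite (le_trans (ler_normD _ _))// !normrZ (gtr0_norm t0).
    rewrite ger0_norm ?subr_ge0//.
    have : (1 - t) * `|x0| <= (1 - t) * M by rewrite ler_wpM2l// subr_ge0.
    have : t * `|y| <= t * M by rewrite ler_wpM2l// ltW.
    lra.
  move=> /(_ xM).
  have -> : D ((1 - t) *: x0 + t *: y) =
      D x0 - 2 * t * psi (y - x0) + t ^+ 2 * \sum_(i < n) (phi i (y - x0)) ^+ 2.
    rewrite psiE !mulr_sumr /D -sumrN -!big_split/=; apply: eq_bigr => i _.
    by rewrite dualD !dual_scale dualB /a; ring.
  have hC : \sum_(i < n) (phi i (y - x0)) ^+ 2 <= C.
    rewrite ler_wpDr//; apply: ler_sum => i _.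
    rewrite -real_normK ?num_real// ler_sqr ?nnegrE ?mulr_ge0// ?addr_ge0 ?(ltW M0)//.
    rewrite (le_trans (dual_le _ _))// ler_wpM2l// (le_trans (ler_normB _ _))//.
    exact: lerD.
  have : t ^+ 2 * \sum_(i < n) (phi i (y - x0)) ^+ 2 <= t ^+ 2 * C.
    by rewrite ler_wpM2l// sqr_ge0.
  move=> h1 h2.
  (* One [t ^+ 2 * C] bounds the quadratic term, the other the excess of [D x0] over the infimum. *)
  have : 2 * t * psi (y - x0) <= 2 * t * (t * C) by lra.
  by rewrite ler_pM2l// mulr_gt0.
have Mpsi : M * `|psi| <= psi x0 + t * C.
  rewrite -ler_pdivlMl//; apply: dual_norm_le => z z1; rewrite ler_pdivlMl//.
  have zM : `|M *: z| <= M by rewrite normrZ gtr0_norm// ler_piMr// ltW.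
  have := step _ zM; have := step (- (M *: z)); rewrite normrN => /(_ zM).
  rewrite !dualB dualN dual_scale => h1 h2.
  by rewrite -{1}(gtr0_norm M0) -normrM ler_norml; lra.
have : L psi = D x0 + psi x0.
  rewrite dual_sum psiE /D -big_split/=; apply: eq_bigr => i _.
  by rewrite dual_scale /a; ring.
have := dD x0 x0M; have := ler_norm (L psi); have := dual_le L psi.
have : `|L| * `|psi| <= M * `|psi| by rewrite ler_wpM2r// lerDl.
lra.
Qed.

End helly.

(** * Weak regularity *)

Section elementary_inequalities.
Context {R : realType}.
Implicit Types x m d K : R.

(** The graph of a convex power lies above its tangent at [m]; averaging this with [m] the mean
    yields Jensen's inequality. *)
Lemma tangent_exp x m n : 0 <= x -> 0 <= m ->
  m ^+ n + n%:R * m ^+ n.-1 * (x - m) <= x ^+ n.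
Proof.
move=> x0 m0; elim: n => [|n IH]; first by rewrite expr0 mul0r mul0r addr0.
have := ler_wpM2l x0 IH; rewrite -exprS; apply: le_trans.
case: n {IH} => [|n]; first by rewrite !expr0 !expr1 /=; lra.
rewrite -subr_ge0 [_.-1]/= [n.+2.-1]/=.
suff -> : x * (m ^+ n.+1 + n.+1%:R * m ^+ n * (x - m)) -
    (m ^+ n.+2 + n.+2%:R * m ^+ n.+1 * (x - m)) =
    n.+1%:R * m ^+ n * (x - m) ^+ 2.
  by rewrite mulr_ge0 ?sqr_ge0// mulr_ge0// exprn_ge0.
by rewrite !exprS -!(natr1 n.+1) -!(natr1 n); ring.
Qed.

(** This inequality with a free parameter takes the place of Cauchy-Schwarz: a first moment is at
    most [K] plus a second moment over [K]. *)
Lemma young d K : 0 < K -> `|d| <= K + d ^+ 2 / K.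
Proof.
move=> K0; rewrite -real_normK ?num_real//.
rewrite -(ler_pM2r K0) mulrDl divfK ?gt_eqF//; have := normr_ge0 d; nra.
Qed.

Lemma young_mul d m K : 0 < K -> 0 <= d -> 0 <= m -> d * m <= K * d + d * m ^+ 2 / K.
Proof.
move=> K0 d0 m0; rewrite mulrC (mulrC K) -mulrA -mulrDr mulrC ler_wpM2l//.
by rewrite (le_trans _ (young m K0))// ler_norm.
Qed.

(** The product is at most a power of its largest factor. This plays the part of Hölder's inequality
    and leaves summands that each involve one index; the 1 serves the empty product. *)
Lemma prod_le_sum_exp (I : finType) (P : pred I) (z : I -> R) :
  (forall i, P i -> 0 <= z i) ->
  \prod_(i | P i) z i <= 1 + \sum_(i | P i) z i ^+ #|P|.
Proof.
move=> z0; case: (pickP P) => [i0 Pi0|P0]; last first.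
  by rewrite !big_pred0// addr0.
have [j Pj jmax] : exists2 j, P j & forall i, P i -> z i <= z j.
  have [j Pj h] := @Order.TotalTheory.arg_maxP _ _ _ i0 P z Pi0.
  by exists j.
rewrite (@le_trans _ _ (z j ^+ #|P|))//.
  by rewrite -prodr_const; apply: ler_prod => i Pi; rewrite z0//= jmax.
rewrite ler_wpDl// (bigD1 j)//= lerDl sumr_ge0// => i /andP[Pi _].
by rewrite exprn_ge0// z0.
Qed.

End elementary_inequalities.

(** * Conditional averages over finite partitions *)

Section averages.
Context {R : realType} {T : finType} {K : eqType}.
Variable c : T -> K.

Definition class_size (t : T) : R := \sum_(s | c s == c t) 1.

Lemma class_size_gt0 t : 0 < class_size t.
Proof. by rewrite /class_size (bigD1 t)//= ltr_wpDr// sumr_ge0. Qed.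

Lemma class_size_inv_ge0 t : 0 <= (class_size t)^-1.
Proof. by rewrite invr_ge0 ltW// class_size_gt0. Qed.

Lemma class_size_eq s t : c s == c t -> class_size s = class_size t.
Proof. by move=> /eqP e; rewrite /class_size e. Qed.

(** Conditional expectation on the partition into fibres of [c]. The codomain is arbitrary because
    decorations in [X] and their scalar images are both averaged. *)
Definition cavg (E : lmodType R) (f : T -> E) t : E :=
  (class_size t)^-1 *: \sum_(s | c s == c t) f s.

Lemma cavg_eq (E : lmodType R) (f : T -> E) s t : c s == c t -> cavg f s = cavg f t.
Proof. by move=> st; rewrite /cavg (class_size_eq st) (eqP st). Qed.

Lemma cavg_id (E : lmodType R) (f : T -> E) :
  (forall s t, c s == c t -> f s = f t) -> cavg f =1 f.
Proof.
move=> fc t; rewrite /cavg (eq_bigr (fun=> 1 *: f t)); last first.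
  by move=> s st; rewrite scale1r; exact: fc.
by rewrite -scaler_suml scalerA mulVf ?scale1r// gt_eqF// class_size_gt0.
Qed.

Lemma dual_cavg (X : normedModType R) (phi : dual X) (g : T -> X) t :
  phi (cavg g t) = cavg (phi \o g : T -> R^o) t.
Proof. by rewrite dual_scale dual_sum. Qed.

Implicit Types f h : T -> R^o.

Lemma cavgC f h : \sum_t cavg f t * h t = \sum_t f t * cavg h t.
Proof.
transitivity (\sum_t \sum_(s | c s == c t) (class_size t)^-1 * (f s * h t)).
  apply: eq_bigr => t _; rewrite /cavg /GRing.scale/= -mulrA mulr_suml mulr_sumr.
  by [].
rewrite (exchange_big_dep predT)//=; apply: eq_bigr => s _.
rewrite /cavg /GRing.scale/= mulrCA !mulr_sumr; apply: eq_big => t.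
  by rewrite eq_sym.
by rewrite eq_sym => st; rewrite (class_size_eq st).
Qed.

Lemma sum_cavg_mul f h : (forall s t, c s == c t -> h s = h t) ->
  \sum_t cavg f t * h t = \sum_t f t * h t.
Proof. by move=> hc; rewrite cavgC; apply: eq_bigr => t _; rewrite cavg_id. Qed.

Lemma sum_cavg f : \sum_t cavg f t = \sum_t f t.
Proof.
have := @sum_cavg_mul f (fun=> 1) (fun _ _ _ => erefl).
by under eq_bigr do rewrite mulr1; under [in RHS]eq_bigr do rewrite mulr1.
Qed.

Lemma norm_cavg_le1 f : (forall t, `|f t| <= 1) -> forall t, `|cavg f t| <= 1.
Proof.
move=> f1 t; rewrite /cavg /GRing.scale/= normrM normfV (gtr0_norm (class_size_gt0 t)).
rewrite ler_pdivrMl ?class_size_gt0// mulr1 (le_trans (ler_norm_sum _ _ _))//.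
exact: ler_sum.
Qed.

(** Conditional Jensen inequality: [tangent_exp] at the mean norm [m] is summed over the class,
    where the linear terms cancel. *)
Lemma norm_cavg_exp (X : normedModType R) (g : T -> X) n t :
  `|cavg g t| ^+ n <= cavg (fun s => `|g s| ^+ n : R^o) t.
Proof.
set m : R := cavg (fun s => `|g s| : R^o) t.
have c0 := class_size_gt0 t.
have m0 : 0 <= m.
  by rewrite /m /cavg /GRing.scale/= mulr_ge0 ?class_size_inv_ge0// sumr_ge0.
have gm : `|cavg g t| <= m.
  rewrite /m /cavg normrZ normfV (gtr0_norm c0) /GRing.scale/=.
  by rewrite ler_wpM2l ?class_size_inv_ge0// ler_norm_sum.
rewrite (@le_trans _ _ (m ^+ n))//.
  by case: n => [|n]; rewrite ?expr0// lerXn2r ?nnegrE.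
rewrite /cavg /GRing.scale/= ler_pdivlMl//.
rewrite (@le_trans _ _ (\sum_(s | c s == c t)
    (m ^+ n + n%:R * m ^+ n.-1 * (`|g s| - m))))//; last first.
  by apply: ler_sum => s _; exact: tangent_exp.
rewrite big_split/= -mulr_sumr big_split/= sumrN.
have -> : \sum_(s | c s == c t) `|g s| = class_size t * m.
  by rewrite /m /cavg /GRing.scale/= mulrA divff ?mul1r// gt_eqF.
have cm (z : R) : \sum_(s | c s == c t) z = class_size t * z.
  by rewrite /class_size mulr_suml; under [RHS]eq_bigr do rewrite mul1r.
by rewrite !cm subrr mulr0 addr0.
Qed.

Lemma sum_norm_cavg_exp (X : normedModType R) (g : T -> X) n :
  \sum_t `|cavg g t| ^+ n <= \sum_t `|g t| ^+ n.
Proof.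
rewrite -(sum_cavg (fun s => `|g s| ^+ n)); apply: ler_sum => t _.
exact: norm_cavg_exp.
Qed.

Lemma sum_cavg_sqr_le f : \sum_t cavg f t ^+ 2 <= \sum_t f t ^+ 2.
Proof.
have := sum_norm_cavg_exp f 2.
by under eq_bigr do rewrite real_normK ?num_real//;
  under [leRHS]eq_bigr do rewrite real_normK ?num_real//.
Qed.

End averages.

Section refinements.
Context {R : realType} {T : finType} {K K' : eqType}.
Variables (c : T -> K) (c' : T -> K').
Hypothesis cc' : forall s t, c' s == c' t -> c s == c t.
Implicit Types f : T -> R^o.

Lemma cavg_refine f : cavg c' (cavg c f) =1 cavg c f.
Proof. by apply: cavg_id => s t st; exact/cavg_eq/cc'. Qed.

(** Pythagoras: the coarse average is the orthogonal projection of the fine one. *)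
Lemma sum_cavg_refine f :
  \sum_t (cavg c' f t - cavg c f t) ^+ 2 =
  \sum_t cavg c' f t ^+ 2 - \sum_t cavg c f t ^+ 2.
Proof.
have e1 : \sum_t cavg c' f t * cavg c f t = \sum_t cavg c f t ^+ 2.
  rewrite sum_cavg_mul; last by move=> s t st; exact/cavg_eq/cc'.
  by rewrite -(@sum_cavg_mul _ _ _ c)//; move=> s t; exact: cavg_eq.
have -> : \sum_t (cavg c' f t - cavg c f t) ^+ 2 =
    \sum_t cavg c' f t ^+ 2 - 2 * (\sum_t cavg c' f t * cavg c f t) +
    \sum_t cavg c f t ^+ 2.
  by rewrite mulr_sumr -sumrN -!big_split/=; apply: eq_bigr => t _; ring.
by rewrite e1; ring.
Qed.

End refinements.

Section pair_averages.
Context {R : realType} {V : finType} {K : eqType}.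
Variable c : V -> K.

Definition pair_class (p : V * V) : K * K := (c p.1, c p.2).

Lemma cavg_pair (a b : V -> R^o) p :
  cavg pair_class (fun q => a q.1 * b q.2 : R^o) p = cavg c a p.1 * cavg c b p.2.
Proof.
have pc (F H : V -> R) : \sum_(q | pair_class q == pair_class p) F q.1 * H q.2 =
    (\sum_(s | c s == c p.1) F s) * (\sum_(s | c s == c p.2) H s).
  rewrite big_distrlr/= pair_big_dep/=; apply: eq_bigl => -[u v] /=.
  by rewrite /pair_class xpair_eqE.
rewrite /cavg /GRing.scale/= pc.
have -> : class_size pair_class p = class_size c p.1 * class_size c p.2 :> R.
  by rewrite /class_size -pc; apply: eq_bigr => q _; rewrite mulr1.
by rewrite invfM mulrACA.
Qed.

End pair_averages.

Section means.
Context {R : realType}.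

Definition fmean (T : finType) (f : T -> R) : R := (#|T|%:R)^-1 * \sum_t f t.

Variable T : finType.
Implicit Types f h : T -> R.

Lemma fmeanD f h : fmean (fun t => f t + h t) = fmean f + fmean h.
Proof. by rewrite /fmean big_split mulrDr. Qed.

Lemma fmeanB f h : fmean (fun t => f t - h t) = fmean f - fmean h.
Proof. by rewrite /fmean sumrB mulrBr. Qed.

Lemma fmeanZ (a : R) f : fmean (fun t => a * f t) = a * fmean f.
Proof. by rewrite /fmean -mulr_sumr mulrCA. Qed.

Lemma fmean_sum (J : Type) (r : seq J) (Q : pred J) (g : J -> T -> R) :
  fmean (fun t => \sum_(j <- r | Q j) g j t) = \sum_(j <- r | Q j) fmean (g j).
Proof. by rewrite /fmean exchange_big mulr_sumr. Qed.

Lemma fmean_cst (a : R) : (0 < #|T|)%N -> fmean (fun _ : T => a) = a.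
Proof.
move=> T0; rewrite /fmean sumr_const -[a *+ _]mulr_natl mulrA mulVf ?mul1r//.
by rewrite pnatr_eq0 -lt0n.
Qed.

Lemma ler_fmean f h : (forall t, f t <= h t) -> fmean f <= fmean h.
Proof. by move=> fh; rewrite /fmean ler_wpM2l ?invr_ge0// ler_sum. Qed.

Lemma eq_fmean f h : f =1 h -> fmean f = fmean h.
Proof. by move=> fh; rewrite /fmean; congr *%R; exact: eq_bigr. Qed.

Lemma fmean_ge0 f : (forall t, 0 <= f t) -> 0 <= fmean f.
Proof. by move=> f0; rewrite /fmean mulr_ge0 ?invr_ge0// sumr_ge0. Qed.

Lemma ler_norm_fmean f : `|fmean f| <= fmean (fun t => `|f t|).
Proof.
by rewrite /fmean normrM ger0_norm ?invr_ge0// ler_wpM2l ?invr_ge0// ler_norm_sum.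
Qed.

Lemma ler_norm_fmean_le f h : (forall t, `|f t| <= h t) -> `|fmean f| <= fmean h.
Proof. by move=> fh; rewrite (le_trans (ler_norm_fmean _))// ler_fmean. Qed.

Lemma fmean_sqr_le K f : (0 < #|T|)%N -> 0 < K ->
  `|fmean f| <= K + fmean (fun t => f t ^+ 2) / K.
Proof.
move=> T0 K0; rewrite (@le_trans _ _ (fmean (fun t => K + K^-1 * f t ^+ 2)))//.
  by apply: ler_norm_fmean_le => t; rewrite mulrC young.
by rewrite fmeanD fmean_cst// fmeanZ mulrC.
Qed.

End means.

(** * Cut norm and energy increments *)

Section cut_norm.
Context {R : realType} {V : finType}.
Implicit Types D : V * V -> R.

Definition sgb (b : bool) : R := if b then -1 else 1.

Lemma norm_sgb b : `|sgb b| = 1.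
Proof. by case: b; rewrite /sgb ?normrN normr1. Qed.

Lemma normE_sgb (x : R) : `|x| = sgb (x < 0) * x.
Proof.
rewrite /sgb; have [x0|x0] := ltrP x 0; first by rewrite ltr0_norm// mulN1r.
by rewrite ger0_norm// mul1r.
Qed.

(** The supremum over [a] and [b] bounded by one is the cut norm of [D], in its form of an operator
    norm from L^oo to L^1. *)
Definition corr D (a b : V -> R) := fmean (fun p => D p * (a p.1 * b p.2)).

Lemma corrE D a b : corr D a b =
  (#|{: V * V}|%:R)^-1 * \sum_u a u * \sum_v b v * D (u, v).
Proof.
rewrite /corr /fmean; congr *%R; under [RHS]eq_bigr do rewrite mulr_sumr.
by rewrite pair_bigA; apply: eq_bigr => -[u v] _ /=; rewrite mulrC mulrA.
Qed.

Lemma corrE' D a b : corr D a b =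
  (#|{: V * V}|%:R)^-1 * \sum_v b v * \sum_u a u * D (u, v).
Proof.
rewrite corrE; congr *%R.
under eq_bigr do rewrite mulr_sumr; rewrite exchange_big/=.
by apply: eq_bigr => u _; rewrite mulr_sumr; apply: eq_bigr => v _; rewrite mulrCA.
Qed.

Let sum_sgb (a L : V -> R) : (forall u, `|a u| <= 1) ->
  `|\sum_u a u * L u| <= \sum_u sgb (L u < 0) * L u.
Proof.
move=> a1; rewrite (le_trans (ler_norm_sum _ _ _))//; apply: ler_sum => u _.
by rewrite -normE_sgb normrM ler_piMl.
Qed.

(** A bilinear form on a product of cubes is largest at extreme points: [a], then [b], is replaced
    by the signs of the coefficients it meets. *)
Lemma corr_sgb D (a b : V -> R) :
  (forall u, `|a u| <= 1) -> (forall u, `|b u| <= 1) ->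
  exists s t : V -> bool, `|corr D a b| <= corr D (sgb \o s) (sgb \o t).
Proof.
move=> a1 b1; pose s u := \sum_v b v * D (u, v) < 0.
pose t v := \sum_u (sgb \o s) u * D (u, v) < 0.
exists s, t; rewrite corrE normrM ger0_norm ?invr_ge0//.
rewrite (@le_trans _ _ (corr D (sgb \o s) b))//.
  by rewrite corrE ler_wpM2l ?invr_ge0// sum_sgb.
rewrite !corrE' ler_wpM2l ?invr_ge0//.
by rewrite (le_trans (ler_norm _))// sum_sgb.
Qed.

Lemma corrB D D' a b : corr (fun p => D p - D' p) a b = corr D a b - corr D' a b.
Proof. by rewrite /corr -fmeanB; apply: eq_fmean => p; rewrite mulrBl. Qed.

Lemma corr_norm_le D a b : (forall u, `|a u| <= 1) -> (forall u, `|b u| <= 1) ->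
  `|corr D a b| <= fmean (fun p => `|D p|).
Proof.
move=> a1 b1; apply: ler_norm_fmean_le => p; rewrite normrM ler_piMr//.
by rewrite normrM mulr_ile1.
Qed.

(** A partition that is good once stays good under refinement, up to a factor two: averaging over
    [c'] moves onto the test functions, so the new error is the old one at [(a, b)] minus the old
    one at the averaged pair. *)
Lemma corr_cavg_refine (K K' : eqType) (c : V -> K) (c' : V -> K') (w : V * V -> R)
    (a b : V -> R) (e : R) :
  (forall s t, c' s == c' t -> c s == c t) ->
  (forall a b : V -> R, (forall u, `|a u| <= 1) -> (forall u, `|b u| <= 1) ->
    `|corr (fun p => w p - cavg (pair_class c) (w : _ -> R^o) p) a b| <= e) ->
  (forall u, `|a u| <= 1) -> (forall u, `|b u| <= 1) ->
  `|corr (fun p => w p - cavg (pair_class c') (w : _ -> R^o) p) a b| <= 2 * e.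
Proof.
move=> cc' h a1 b1.
pose a' : V -> R := cavg c' (a : V -> R^o); pose b' : V -> R := cavg c' (b : V -> R^o).
have pcc' p q : pair_class c' p == pair_class c' q -> pair_class c p == pair_class c q.
  by rewrite /pair_class !xpair_eqE => /andP[/cc' -> /cc' ->].
have step (f : V * V -> R) : corr (cavg (pair_class c') (f : _ -> R^o)) a b = corr f a' b'.
  rewrite /corr /fmean; congr *%R.
  rewrite (cavgC (pair_class c') f (fun p => a p.1 * b p.2)).
  by apply: eq_bigr => p _; rewrite cavg_pair.
pose wc : V * V -> R := cavg (pair_class c) (w : _ -> R^o).
have wc' : corr wc a' b' = corr wc a b.
  rewrite -step; apply: eq_fmean => p; congr (_ * _).
  exact: cavg_refine.
have -> : corr (fun p => w p - cavg (pair_class c') (w : _ -> R^o) p) a b =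
    corr (fun p => w p - wc p) a b - corr (fun p => w p - wc p) a' b'.
  by rewrite !corrB step wc'; ring.
rewrite (le_trans (ler_normB _ _))// mulr2n mulrDl mul1r lerD// h//.
  exact: norm_cavg_le1.
exact: norm_cavg_le1.
Qed.

End cut_norm.

Section refine4.
Context {R : realType} {V : finType}.
Hypothesis V0 : (0 < #|V|)%N.
Implicit Types (c : V -> nat) (d : {ffun V -> 'I_4}) (w : V * V -> R).

(** Appends one digit in base four. Cutting a class by two vertex subsets leaves at most four
    pieces. *)
Definition refine4 c d u : nat := 4 * c u + d u.

Lemma refine4_eq c d s t : refine4 c d s == refine4 c d t ->
  c s == c t /\ d s = d t.
Proof.
rewrite /refine4 => /eqP h; have := ltn_ord (d s); have := ltn_ord (d t).
by move=> h1 h2; split; [apply/eqP|apply/val_inj => /=]; lia.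
Qed.

Definition energy c w : R :=
  fmean (fun p => cavg (pair_class c) (w : _ -> R^o) p ^+ 2).

Lemma energy_refine c c' w : (forall s t, c' s == c' t -> c s == c t) ->
  fmean (fun p => (cavg (pair_class c') (w : _ -> R^o) p -
                   cavg (pair_class c) (w : _ -> R^o) p) ^+ 2) =
  energy c' w - energy c w.
Proof.
move=> cc'; rewrite /energy /fmean sum_cavg_refine ?mulrBr// => p q.
by rewrite /pair_class !xpair_eqE => /andP[/cc' -> /cc' ->].
Qed.

Lemma energy_mono c c' w : (forall s t, c' s == c' t -> c s == c t) ->
  energy c w <= energy c' w.
Proof.
move=> cc'; rewrite -subr_ge0 -energy_refine//.
by apply: fmean_ge0 => p; exact: sqr_ge0.
Qed.

Lemma energy_le c w : energy c w <= fmean (fun p => w p ^+ 2).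
Proof. by rewrite /energy /fmean ler_wpM2l ?invr_ge0// sum_cavg_sqr_le. Qed.

(** Maximising the energy makes one choice at least as good as the refinement by any pair of sign
    patterns. *)
Definition best_refinement c w : {ffun V -> 'I_4} :=
  [arg max_(d > [ffun=> ord0]) energy (refine4 c d) w]%O.

Lemma best_refinementP c w d :
  energy (refine4 c d) w <= energy (refine4 c (best_refinement c w)) w.
Proof.
by rewrite /best_refinement; case: Order.TotalTheory.arg_maxP => // i _; apply.
Qed.

(** Energy increment argument: a correlation with sign patterns is unchanged when [w] is replaced by
    its average over the refinement by these patterns, hence is controlled by the energy which that
    refinement gains, and the best refinement gains at least as much. *)
Lemma corr_best c w (a b : V -> R) (e : R) : 0 < e ->
  energy (refine4 c (best_refinement c w)) w <= energy c w + e ^+ 2 ->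
  (forall u, `|a u| <= 1) -> (forall u, `|b u| <= 1) ->
  `|corr (fun p => w p - cavg (pair_class c) (w : _ -> R^o) p) a b| <= 2 * e.
Proof.
move=> e0 be a1 b1.
have [s [t /le_trans->//]] := corr_sgb (fun p => w p - cavg (pair_class c) (w : _ -> R^o) p) a1 b1.
pose d : {ffun V -> 'I_4} := [ffun u => inord ((s u).*2 + t u)].
have dE u v : d u = d v -> s u = s v /\ t u = t v.
  rewrite !ffunE => /(congr1 val)/=; rewrite !inordK; last 2 first.
  - by case: (s v); case: (t v).
  - by case: (s u); case: (t u).
  by case: (s u); case: (t u); case: (s v); case: (t v).
have cd u v : refine4 c d u == refine4 c d v -> c u == c v.
  by move=> /refine4_eq[].
pose w' : V * V -> R := cavg (pair_class (refine4 c d)) (w : _ -> R^o).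
have -> : corr (fun p => w p - cavg (pair_class c) (w : _ -> R^o) p) (sgb \o s) (sgb \o t) =
    corr (fun p => w' p - cavg (pair_class c) (w : _ -> R^o) p) (sgb \o s) (sgb \o t).
  rewrite !corrB; congr (_ - _); rewrite /corr /fmean; congr *%R; apply/esym.
  apply: (@sum_cavg_mul R _ _ _ w) => p q.
  rewrite /pair_class xpair_eqE => /andP[/refine4_eq[_ /dE[h1 _]] /refine4_eq[_ /dE[_ h2]]].
  by rewrite /= h1 h2.
rewrite (le_trans (ler_norm _))//.
have VV : (0 < #|{: V * V}|)%N by rewrite card_prod muln_gt0 V0.
rewrite (le_trans (fmean_sqr_le _ VV e0))//.
have h : fmean (fun p => (w' p - cavg (pair_class c) (w : _ -> R^o) p) ^+ 2) <= e ^+ 2.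
  rewrite energy_refine// lerBlDl (le_trans _ be)//; exact: best_refinementP.
suff : fmean (fun p => ((w' p - cavg (pair_class c) (w : _ -> R^o) p) *
    ((sgb \o s) p.1 * (sgb \o t) p.2)) ^+ 2) / e <= e by lra.
rewrite ler_pdivrMr// -expr2 (le_trans _ h)//; apply: ler_fmean => p.
rewrite exprMn -[leRHS]mulr1 ler_wpM2l ?sqr_ge0//.
by rewrite -real_normK ?num_real// normrM !norm_sgb mulr1 expr1n.
Qed.

End refine4.

(** * Vertex codes and uniform weak regularity *)

Section codes.
Context {R : realType} {X : normedModType R}.
Variable phi : nat -> dual X.
Implicit Type G : target_graph X.

Definition gpair G (p : target_vertex G * target_vertex G) : X :=
  target_decoration p.1 p.2.

Definition fpair G (psi : dual X) (p : target_vertex G * target_vertex G) : R :=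
  psi (gpair p).

(** The 2-adic valuation takes every value infinitely often, so each functional is treated at
    infinitely many stages, the same for all graphs. *)
Definition stage_functional b := phi (logn 2 b.+1).

(** The recursion refines for one functional at a time, and whatever the graph the codes of level
    [b] are numbers below [4 ^ b]. *)
Fixpoint code (G : target_graph X) (b : nat) : target_vertex G -> nat :=
  if b is b'.+1 then
    refine4 (@code G b') (best_refinement (@code G b') (@fpair G (stage_functional b')))
  else fun=> 0%N.
Arguments code : clear implicits.

Lemma code_lt G b u : (code G b u < 4 ^ b)%N.
Proof.
elim: b u => [//|b IH] u /=; rewrite /refine4 expnS.
set d := best_refinement _ _; have := ltn_ord (d u); have := IH u; lia.
Qed.

(** A coarse code is a prefix in base four of a fine one. Coarsening is thus a division that does
    not mention the graph, and it survives the passage to the limit. *)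
Lemma code_div G b b' u : (b <= b')%N -> code G b u = (code G b' u %/ 4 ^ (b' - b))%N.
Proof.
move=> /subnK <-; rewrite addnK; elim: (b' - b)%N => [|k IH]; first by rewrite divn1.
rewrite IH addSn /= /refine4; set d := best_refinement _ _.
by rewrite expnS divnMA (mulnC 4) divnMDl// (divn_small (ltn_ord (d u))) addn0.
Qed.

Lemma code_refine G b b' : (b <= b')%N ->
  forall s t, code G b' s == code G b' t -> code G b s == code G b t.
Proof. by move=> bb' s t /eqP e; rewrite !(code_div _ bb') e. Qed.

Lemma stage_functional_often k i :
  exists2 b, (i <= b)%N & stage_functional b = phi k.
Proof.
have o : (0 < 2 ^ k * i.*2.+1)%N by rewrite muln_gt0 expn_gt0.
exists (2 ^ k * i.*2.+1).-1.
  rewrite -ltnS prednK// (leq_ltn_trans _ (leq_pmull _ _)) ?expn_gt0//.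
  by rewrite -addnn leq_addr.
rewrite /stage_functional prednK// lognM ?expn_gt0// pfactorK//.
by rewrite logn_coprime ?addn0// coprime2n /= odd_double.
Qed.

(* By pigeonhole, among [J + 1] stages at which [phi k] is treated, one raises
   the energy, which is bounded by [M], by at most [e ^+ 2]. *)
Lemma weak_regularity_seq k (M e : R) : 0 < e ->
  exists B0, forall G b, fmean (fun p => `|@gpair G p| ^+ 2) <= M -> (B0 <= b)%N ->
  forall x y : target_vertex G -> R, (forall u, `|x u| <= 1) -> (forall u, `|y u| <= 1) ->
  `|corr (fun p => fpair (phi k) p -
      cavg (pair_class (code G b)) (fpair (phi k) : _ -> R^o) p) x y| <= e.
Proof.
(* A factor two is lost in [corr_best] and another one in the passage to finer codes. *)
move=> e0; pose h := e / 4; have h0 : 0 < h by rewrite divr_gt0.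
pose M' := `|phi k| ^+ 2 * M.
have [J hJ] : exists J : nat, M' < J%:R * h ^+ 2.
  exists (Num.bound `|M' / h ^+ 2|); rewrite -ltr_pdivrMr ?exprn_gt0//.
  by rewrite (le_lt_trans (ler_norm _))// archi_boundP.
have /choice[next nextP] i : exists b, (i <= b)%N /\ stage_functional b = phi k.
  by have [b ? ?] := stage_functional_often k i; exists b.
pose st j := iter j (fun b => next b.+1) (next 0%N).
have stS j : (st j < st j.+1)%N by rewrite /st /=; have [] := nextP (st j).+1.
have stk j : stage_functional (st j) = phi k.
  by case: j => [|j]; rewrite /st /=; [have [] := nextP 0%N|have [] := nextP (st j).+1].
exists (st J) => G b GM Bb x y x1 y1.
have V0 := target_nonempty G.
pose w := @fpair G (phi k).
have wM c : energy c w <= M'.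
  rewrite (le_trans (energy_le _ _))// (le_trans _ (ler_wpM2l (sqr_ge0 `|phi k|) GM))//.
  rewrite -fmeanZ; apply: ler_fmean => p.
  rewrite -real_normK ?num_real// -exprMn lerXn2r ?nnegrE ?mulr_ge0//.
  exact: dual_le.
have stmono i j : (i <= j)%N -> (st i <= st j)%N.
  move=> /subnK<-; elim: (j - i)%N => // l IH; rewrite (leq_trans IH)// addSn.
  exact/ltnW.
have [j jJ small] : exists2 j, (j < J)%N &
    energy (code G (st j).+1) w <= energy (code G (st j)) w + h ^+ 2.
  apply: contrapT => /forall2NP no.
  have grow j : (j <= J)%N -> j%:R * h ^+ 2 <= energy (code G (st j)) w.
    elim: j => [_|j IH jJ].
      by rewrite mul0r; apply: fmean_ge0 => p; exact: sqr_ge0.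
    have := IH (ltnW jJ); have [//|/negP] := no j; rewrite -ltNge => big.
    have : energy (code G (st j).+1) w <= energy (code G (st j.+1)) w.
      exact/energy_mono/code_refine.
    rewrite -natr1; lra.
  have := grow _ (leqnn J); have := wM (code G (st J)); lra.
have h2 : e = 2 * (2 * h) by rewrite /h; lra.
rewrite h2; apply: (@corr_cavg_refine _ _ _ _ (code G (st j))) => //.
  by apply: code_refine; rewrite (leq_trans _ Bb)// stmono// ltnW.
move=> a' b' a1 b1; apply: corr_best => //.
by move: small; rewrite /= stk.
Qed.

Hypothesis phi_dense : forall (psi : dual X) e, 0 < e -> exists k, `|psi - phi k| < e.

(** The correlation is at most the mean norm of the kernel, so replacing [psi] by a nearby [phi k]
    costs their distance times the first moments of the decoration and of its average; these two
    account for the 2 in the choice of the distance. *)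
Lemma weak_regularity (psi : dual X) (M e : R) : 0 < e ->
  exists B0, forall G b, fmean (fun p => `|@gpair G p|) <= M ->
  fmean (fun p => `|@gpair G p| ^+ 2) <= M -> (B0 <= b)%N ->
  forall x y : target_vertex G -> R, (forall u, `|x u| <= 1) -> (forall u, `|y u| <= 1) ->
  `|corr (fun p => psi (gpair p) - psi (cavg (pair_class (code G b)) (@gpair G) p)) x y|
    <= e.
Proof.
move=> e0; have d0 : 0 < e / 2 / (2 * (`|M| + 1)).
  by rewrite divr_gt0 ?divr_gt0// mulr_gt0// ltr_wpDl.
have [k hk] := phi_dense psi d0.
have e2 : 0 < e / 2 by rewrite divr_gt0.
have [B0 B0P] := weak_regularity_seq k M e2.
exists B0 => G b M1 M2 Bb x y x1 y1.
set c := pair_class (code G b).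
have dec p : psi (gpair p) - psi (cavg c (@gpair G) p) =
    (phi k (gpair p) - phi k (cavg c (@gpair G) p)) -
    ((phi k - psi) (gpair p) - (phi k - psi) (cavg c (@gpair G) p)).
  rewrite -[(phi k - psi) (gpair p)]/(phi k (gpair p) - psi (gpair p)).
  rewrite -[(phi k - psi) (cavg _ _ _)]/(phi k (cavg c (@gpair G) p) - psi (cavg c (@gpair G) p)).
  by ring.
have -> : corr (fun p => psi (gpair p) - psi (cavg c (@gpair G) p)) x y =
  corr (fun p => phi k (gpair p) - phi k (cavg c (@gpair G) p)) x y -
  corr (fun p => (phi k - psi) (gpair p) - (phi k - psi) (cavg c (@gpair G) p)) x y.
  by rewrite -corrB; apply: eq_fmean => p; rewrite dec.
rewrite (splitr e) (le_trans (ler_normB _ _))// lerD//.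
  have := B0P G b M2 Bb x y x1 y1; congr (`|_| <= _); apply: eq_fmean => p.
  by rewrite dual_cavg.
rewrite (le_trans (corr_norm_le _ x1 y1))//.
have gM : fmean (fun p => `|cavg c (@gpair G) p|) <= M.
  rewrite (le_trans _ M1)// /fmean ler_wpM2l ?invr_ge0//.
  exact: (sum_norm_cavg_exp c (@gpair G) 1).
set d := e / 2 / (2 * (`|M| + 1)) in d0 hk.
rewrite (@le_trans _ _ (fmean (fun p => d * (`|gpair p| + `|cavg c (@gpair G) p|))))//.
  apply: ler_fmean => p; rewrite (le_trans (ler_normB _ _))// mulrDr lerD//.
    by rewrite (le_trans (dual_le _ _))// ler_wpM2r// distrC ltW.
  by rewrite (le_trans (dual_le _ _))// ler_wpM2r// distrC ltW.
rewrite fmeanZ fmeanD (@le_trans _ _ (d * (2 * (`|M| + 1))))//.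
  rewrite ler_wpM2l ?(ltW d0)//; have := ler_norm M; lra.
by rewrite /d divfK// gt_eqF// mulr_gt0// ltr_wpDl.
Qed.

End codes.

Arguments code {R X} phi G b u.

(** * Counting lemma *)

Section resampling.
Context {R : realType} {I V : finType}.
Hypothesis V0 : (0 < #|V|)%N.
Implicit Types (phi : {ffun I -> V}) (h : {ffun I -> V} -> R).

(** Resampling a coordinate expresses Fubini on the space of maps without splitting that space into
    a product. *)
Definition upd phi i u : {ffun I -> V} := [ffun k => if k == i then u else phi k].

Lemma updE phi i u : upd phi i u i = u.
Proof. by rewrite ffunE eqxx. Qed.

Lemma upd_neq phi i u k : k != i -> upd phi i u k = phi k.
Proof. by move=> /negbTE ki; rewrite ffunE ki. Qed.

(* [(phi, u) |-> (upd phi i u, phi i)] is an involution. *)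
Lemma fmean_upd h i : fmean h = fmean (fun phi => fmean (fun u => h (upd phi i u))).
Proof.
pose s (q : {ffun I -> V} * V) := (upd q.1 i q.2, q.1 i).
have ss : involutive s.
  move=> [phi u]; rewrite /s /= updE; congr pair; apply/ffunP => k.
  by rewrite !ffunE; case: eqP => // ->.
rewrite /fmean; congr *%R; under [RHS]eq_bigr do rewrite mulr_sumr.
rewrite pair_bigA/= (reindex_inj (inv_inj ss)) /=.
rewrite -(pair_bigA _ (fun phi u => #|V|%:R^-1 * h (upd (upd phi i u) i (phi i))))/=.
apply: eq_bigr => phi _.
rewrite (eq_bigr (fun=> #|V|%:R^-1 * h phi)); last first.
  by move=> u _; congr (_ * h _); apply/ffunP => k; rewrite !ffunE; case: eqP => // ->.
rewrite sumr_const -[_ *+ _]mulr_natl mulrA divff ?mul1r//.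
by rewrite pnatr_eq0 -lt0n.
Qed.

Lemma fmean_pair (k : V * V -> R) :
  fmean k = fmean (fun u => fmean (fun v => k (u, v))).
Proof.
rewrite /fmean card_prod natrM invfM -mulrA -mulr_sumr; congr (_ * (_ * _)).
by rewrite pair_bigA; apply: eq_bigr => -[].
Qed.

Lemma fmean_upd2 h i j : i != j -> fmean h =
  fmean (fun phi => fmean (fun p : V * V => h (upd (upd phi i p.1) j p.2))).
Proof.
move=> ij; rewrite (fmean_upd _ j) (fmean_upd _ i); apply: eq_fmean => phi.
by rewrite fmean_pair.
Qed.

Lemma card_ffun_gt0 : (0 < #|{: {ffun I -> V}}|)%N.
Proof. by rewrite card_ffun expn_gt0 V0. Qed.

Lemma fmean_marginal (k : V * V -> R) i j : i != j ->
  fmean (fun phi : {ffun I -> V} => k (phi i, phi j)) = fmean k.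
Proof.
move=> ij; rewrite (fmean_upd2 _ ij) -[RHS](fmean_cst _ card_ffun_gt0).
apply: eq_fmean => phi; apply: eq_fmean => -[u v] /=.
by rewrite upd_neq// !updE.
Qed.

End resampling.

Section truncation.
Context {R : realType}.
Implicit Types x K : R.

Definition trunc K x := if `|x| <= K then x else 0.

Lemma trunc_le K x : 0 <= K -> `|trunc K x| <= K.
Proof. by move=> K0; rewrite /trunc; case: ifP => // _; rewrite normr0. Qed.

Lemma trunc_le_norm K x : `|trunc K x| <= `|x|.
Proof. by rewrite /trunc; case: ifP => // _; rewrite normr0. Qed.

Lemma trunc_dist K x : 0 < K -> `|x - trunc K x| <= x ^+ 2 / K.
Proof.
move=> K0; rewrite /trunc; case: (leP `|x| K) => xK.
  by rewrite subrr normr0 mulr_ge0 ?sqr_ge0// invr_ge0 ltW.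
rewrite subr0 ler_pdivlMr// -real_normK ?num_real// expr2 ler_wpM2l//.
exact: ltW.
Qed.

End truncation.

Section counting.
Context {R : realType} {I V : finType}.
Hypothesis V0 : (0 < #|V|)%N.
Variable P : pred (I * I).
Hypothesis P_neq : forall e, P e -> e.1 != e.2.
Hypothesis P_anti : forall e, P e -> ~~ P (e.2, e.1).
Implicit Types (phi : {ffun I -> V}) (e : I * I).

Definition at_edge phi e : V * V := (phi e.1, phi e.2).

Variable H : V * V -> R.
Hypothesis H1 : forall p, 1 <= H p.

Let H0 p : 0 <= H p. Proof. by rewrite (le_trans _ (H1 p)). Qed.

Let C := fmean (fun phi => \prod_(e | P e) H (at_edge phi e) ^+ 2).

Lemma fmean_prod_le :
  C <= 1 + \sum_(e | P e) fmean (fun p => H p ^+ (2 * #|P|)).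
Proof.
rewrite /C (@le_trans _ _ (fmean (fun phi => 1 +
    \sum_(e | P e) H (at_edge phi e) ^+ (2 * #|P|))))//.
  apply: ler_fmean => phi; under [in leRHS]eq_bigr do rewrite exprM.
  by apply: prod_le_sum_exp => e _; exact: sqr_ge0.
rewrite fmeanD fmean_cst ?card_ffun_gt0// lerD2l fmean_sum; apply: ler_sum => e Pe.
by rewrite -(fmean_marginal V0 (fun p => H p ^+ (2 * #|P|)) (P_neq Pe)).
Qed.

Variables (K delta : R).
Hypothesis K0 : 0 < K.

Section one_edge.
Variables (e0 : I * I) (D : V * V -> R) (h : I * I -> V * V -> R).
Hypothesis Pe0 : P e0.
Hypothesis DH : forall p, `|D p| <= H p.
Hypothesis hH : forall e p, P e -> `|h e p| <= H p.
Hypothesis D_corr : forall a b : V -> R, (forall u, `|a u| <= 1) ->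
  (forall u, `|b u| <= 1) -> `|corr D a b| <= delta.

(** The other edges are sorted by whether they contain the first end of [e0]. Those that do avoid
    its second end, as no other edge joins the two ends, and those that do not ignore its first end.
    With the remaining vertices fixed, the product is [D] tested against a function of each end. *)
Let touch e := (e.1 == e0.1) || (e.2 == e0.1).
Let A phi := \prod_(e | P e && (e != e0) && touch e) h e (at_edge phi e).
Let B phi := \prod_(e | P e && (e != e0) && ~~ touch e) h e (at_edge phi e).

Let AupdE phi v : A (upd phi e0.2 v) = A phi.
Proof.
apply: eq_bigr => -[k l] /andP[/andP[Pe ee0] /orP[]/=/eqP ke].
  rewrite /at_edge /= !upd_neq//.
    by apply: contra ee0 => /eqP ->; rewrite ke -surjective_pairing.
  by rewrite ke P_neq.
rewrite /at_edge /= !upd_neq//; first by rewrite ke P_neq.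
apply/eqP => kj; move: Pe; rewrite ke kj; exact/negP/P_anti.
Qed.

Let BupdE phi u : B (upd phi e0.1 u) = B phi.
Proof.
apply: eq_bigr => -[k l] /andP[_]; rewrite /touch negb_or => /andP[ki li].
by rewrite /at_edge !upd_neq.
Qed.

(** Truncated at [K] and divided by [K], both factors are admissible test functions for the cut
    norm, whence the [K ^+ 2]. *)
Let main_term :
  `|fmean (fun phi => D (at_edge phi e0) * (trunc K (A phi) * trunc K (B phi)))|
    <= K ^+ 2 * delta.
Proof.
rewrite (fmean_upd2 V0 _ (P_neq Pe0)).
rewrite -[leRHS](@fmean_cst _ {ffun I -> V}) ?card_ffun_gt0//.
apply: ler_norm_fmean_le => phi.
pose a u := K^-1 * trunc K (A (upd phi e0.1 u)).
pose b v := K^-1 * trunc K (B (upd phi e0.2 v)).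
have t1 x : `|K^-1 * trunc K x| <= 1.
  by rewrite normrM gtr0_norm ?invr_gt0// ler_pdivrMl// mulr1 trunc_le// ltW.
rewrite (_ : fmean _ = K ^+ 2 * corr D a b).
  rewrite normrM ger0_norm ?sqr_ge0// ler_wpM2l ?sqr_ge0//.
  by apply: D_corr => u; exact: t1.
rewrite -fmeanZ; apply: eq_fmean => -[u v] /=.
rewrite {1}/at_edge upd_neq ?P_neq// !updE AupdE.
have -> : upd (upd phi e0.1 u) e0.2 v = upd (upd phi e0.2 v) e0.1 u.
  apply/ffunP => k; rewrite !ffunE; case: eqP => // ->; case: eqP => // e21.
  by have := P_neq Pe0; rewrite e21 eqxx.
by rewrite BupdE /a /b mulrCA [in RHS]mulrACA !mulrA; field; rewrite gt_eqF.
Qed.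

(** Truncation errors bring in the square of one factor. As [H] is at least 1, every such product is
    dominated by the same product of squares, with mean [C]. *)
Let AB_le phi :
  `|D (at_edge phi e0)| * `|A phi| ^+ 2 * `|B phi| <=
    \prod_(e | P e) H (at_edge phi e) ^+ 2 /\
  `|D (at_edge phi e0)| * `|A phi| * `|B phi| ^+ 2 <=
    \prod_(e | P e) H (at_edge phi e) ^+ 2.
Proof.
pose HA := \prod_(e | P e && (e != e0) && touch e) H (at_edge phi e).
pose HB := \prod_(e | P e && (e != e0) && ~~ touch e) H (at_edge phi e).
have prod_ge1 (Q : pred (I * I)) : 1 <= \prod_(e | Q e) H (at_edge phi e).
  by elim/big_rec: _ => // e x _ x1; rewrite mulr_ege1.
have HA1 : 1 <= HA by exact: prod_ge1.
have HB1 : 1 <= HB by exact: prod_ge1.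
have AH : `|A phi| <= HA.
  by rewrite normr_prod; apply: ler_prod => e /andP[/andP[Pe _] _]; rewrite normr_ge0 hH.
have BH : `|B phi| <= HB.
  by rewrite normr_prod; apply: ler_prod => e /andP[/andP[Pe _] _]; rewrite normr_ge0 hH.
have -> : \prod_(e | P e) H (at_edge phi e) ^+ 2 =
    H (at_edge phi e0) ^+ 2 * (HA ^+ 2 * HB ^+ 2).
  by rewrite (bigD1 e0)//= (bigID touch)/= -!prodrXl.
have HD : `|D (at_edge phi e0)| <= H (at_edge phi e0) ^+ 2.
  rewrite (le_trans (DH _))// expr2 ler_peMl//.
have sq (x : R) : 1 <= x -> x <= x ^+ 2.
  by move=> x1; rewrite expr2 ler_peMl// (le_trans _ x1).
have HA0 : 0 <= HA by rewrite (le_trans _ HA1).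
have HB0 : 0 <= HB by rewrite (le_trans _ HB1).
split; rewrite -mulrA ler_pM ?mulr_ge0 ?exprn_ge0// ler_pM ?exprn_ge0//.
- by rewrite lerXn2r// nnegrE.
- by rewrite (le_trans BH)// sq.
- by rewrite (le_trans AH)// sq.
- by rewrite lerXn2r// nnegrE.
Qed.

Lemma fmean_edge_le :
  `|fmean (fun phi => D (at_edge phi e0) *
      \prod_(e | P e && (e != e0)) h e (at_edge phi e))| <=
  K ^+ 2 * delta + 2 * C / K.
Proof.
pose E phi := D (at_edge phi e0) * (A phi * B phi - trunc K (A phi) * trunc K (B phi)).
have -> : fmean (fun phi => D (at_edge phi e0) *
      \prod_(e | P e && (e != e0)) h e (at_edge phi e)) =
    fmean (fun phi => D (at_edge phi e0) * (trunc K (A phi) * trunc K (B phi))) +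
    fmean E.
  rewrite -fmeanD; apply: eq_fmean => phi; rewrite (bigID touch)/= /E -mulrDr.
  by rewrite [in RHS]addrC subrK.
rewrite (le_trans (ler_normD _ _))// lerD//.
rewrite mulrAC /C -fmeanZ; apply: ler_norm_fmean_le => phi.
have [h1 h2] := AB_le phi.
have -> : E phi = D (at_edge phi e0) * ((A phi - trunc K (A phi)) * B phi) +
    D (at_edge phi e0) * (trunc K (A phi) * (B phi - trunc K (B phi))).
  by rewrite /E; ring.
have c1 : `|D (at_edge phi e0)| * (`|A phi - trunc K (A phi)| * `|B phi|) <=
    K^-1 * \prod_(e | P e) H (at_edge phi e) ^+ 2.
  rewrite (le_trans _ (ler_wpM2l _ h1)) ?invr_ge0 ?(ltW K0)//.
  rewrite (_ : K^-1 * _ = `|D (at_edge phi e0)| * (A phi ^+ 2 / K * `|B phi|)).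
    by rewrite ler_wpM2l// ler_wpM2r// trunc_dist.
  by rewrite real_normK ?num_real//; ring.
have c2 : `|D (at_edge phi e0)| * (`|trunc K (A phi)| * `|B phi - trunc K (B phi)|) <=
    K^-1 * \prod_(e | P e) H (at_edge phi e) ^+ 2.
  rewrite (le_trans _ (ler_wpM2l _ h2)) ?invr_ge0 ?(ltW K0)//.
  rewrite (_ : K^-1 * _ = `|D (at_edge phi e0)| * (`|A phi| * (B phi ^+ 2 / K))).
    by rewrite ler_wpM2l// ler_pM ?trunc_le_norm ?trunc_dist.
  by rewrite real_normK ?num_real//; ring.
rewrite (le_trans (ler_normD _ _))// !normrM -mulrA mulr2n mulrDl mul1r.
exact: lerD.
Qed.

End one_edge.

(** Kernels are exchanged one edge at a time: in the hybrid product, the edges listed in [s] already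
    carry [w']. *)
Lemma counting (w w' : I * I -> V * V -> R) :
  (forall e p, P e -> `|w e p| <= H p) -> (forall e p, P e -> `|w' e p| <= H p) ->
  (forall e p, P e -> `|w e p - w' e p| <= H p) ->
  (forall e, P e -> forall a b : V -> R, (forall u, `|a u| <= 1) ->
    (forall u, `|b u| <= 1) -> `|corr (fun p => w e p - w' e p) a b| <= delta) ->
  `|fmean (fun phi => \prod_(e | P e) w e (at_edge phi e)) -
    fmean (fun phi => \prod_(e | P e) w' e (at_edge phi e))| <=
  #|P|%:R * (K ^+ 2 * delta + 2 * C / K).
Proof.
move=> wH w'H ww'H wcorr.
pose hyb (s : seq (I * I)) e := if e \in s then w' e else w e.
have hybH s e p : P e -> `|hyb s e p| <= H p.
  by move=> Pe; rewrite /hyb; case: ifP => _; [exact: w'H|exact: wH].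
suff tele s : uniq s -> all P s ->
    `|fmean (fun phi => \prod_(e | P e) w e (at_edge phi e)) -
      fmean (fun phi => \prod_(e | P e) hyb s e (at_edge phi e))| <=
    (size s)%:R * (K ^+ 2 * delta + 2 * C / K).
  have := tele (enum P) (enum_uniq _); rewrite -cardE.
  have aP : all P (enum P) by apply/allP => e; rewrite mem_enum.
  move=> /(_ aP); congr (`|_ - _| <= _).
  by apply: eq_fmean => phi; apply: eq_bigr => e Pe; rewrite /hyb mem_enum -[e \in P]/(P e) Pe.
elim: s => [_ _|e0 s IH /= /andP[e0s us] /andP[Pe0 Ps]].
  by rewrite mul0r subrr normr0.
set X := fmean _; rewrite -/X in IH.
set Y := fmean (fun phi => \prod_(e | P e) hyb s e _) in IH.
set Z := fmean _.
have YZ : `|Y - Z| <= K ^+ 2 * delta + 2 * C / K.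
  have -> : Y - Z = fmean (fun phi => (w e0 (at_edge phi e0) - w' e0 (at_edge phi e0)) *
      \prod_(e | P e && (e != e0)) hyb s e (at_edge phi e)).
    rewrite /Y /Z -fmeanB; apply: eq_fmean => phi.
    rewrite (bigD1 e0)//= [X in _ - X](bigD1 e0)//=.
    rewrite {1}/hyb (negbTE e0s) {2}/hyb mem_head mulrBl; congr (_ - _ * _).
    by apply: eq_bigr => e /andP[_ /negbTE ee0]; rewrite /hyb inE ee0.
  apply: (@fmean_edge_le e0 (fun p => w e0 p - w' e0 p) (hyb s)) => //.
  - by move=> p; exact: ww'H.
  - by move=> e p Pe; exact: hybH.
  - exact: wcorr.
have -> : X - Z = (X - Y) + (Y - Z) by ring.
rewrite (le_trans (ler_normD _ _))// -natr1 mulrDl mul1r lerD//.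
exact: IH.
Qed.

End counting.

(** * Densities of target graphs and of their averages *)

Section test_graphs.
Context {R : realType} {X : normedModType R}.
Implicit Types (F : test_graph X) (G : target_graph X).

Lemma oriented_edge_neq F e : @oriented_edge R X F e -> e.1 != e.2.
Proof. by move=> /andP[_ h]; apply/eqP => ee; rewrite ee ltnn in h. Qed.

Lemma oriented_edge_anti F e : @oriented_edge R X F e -> ~~ @oriented_edge R X F (e.2, e.1).
Proof. by move=> /andP[_ h]; rewrite /oriented_edge negb_and /= -leqNgt (ltnW h) orbT. Qed.

Lemma hom_densityE F G : hom_density F G =
  fmean (fun phi : {ffun test_vertex F -> target_vertex G} =>
    \prod_(e | oriented_edge e) test_decoration e.1 e.2 (gpair (at_edge phi e))).
Proof. by rewrite /hom_density /fmean card_ffun natrX. Qed.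

Definition averaged_density F G (K : eqType) (c : target_vertex G -> K) : R :=
  fmean (fun phi : {ffun test_vertex F -> target_vertex G} =>
    \prod_(e | oriented_edge e)
      test_decoration e.1 e.2 (cavg (pair_class c) (@gpair R X G) (at_edge phi e))).

(** A sum of three terms is at most three times the largest of them. *)
Lemma exp_sum3_le (x y : R) n : 0 <= x -> 0 <= y ->
  (1 + x + y) ^+ n <= 3 ^+ n * (1 + x ^+ n + y ^+ n).
Proof.
move=> x0 y0.
have key z : 0 <= z -> 1 + x + y <= 3 * z -> z ^+ n <= 1 + x ^+ n + y ^+ n ->
    (1 + x + y) ^+ n <= 3 ^+ n * (1 + x ^+ n + y ^+ n).
  move=> z0 h1 h2; rewrite (@le_trans _ _ ((3 * z) ^+ n))//.
    by rewrite lerXn2r// nnegrE ?mulr_ge0// !addr_ge0.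
  by rewrite exprMn ler_wpM2l// exprn_ge0.
have xn : 0 <= x ^+ n by exact: exprn_ge0.
have yn : 0 <= y ^+ n by exact: exprn_ge0.
have [xy|yx] := leP x y.
  have [y1|y1] := leP y 1.
    by apply: (key 1) => //; rewrite ?expr1n; lra.
  by apply: (key y) => //; lra.
have [x1|x1] := leP x 1.
  by apply: (key 1) => //; rewrite ?expr1n; lra.
by apply: (key x) => //; lra.
Qed.

Definition test_bound F : R := 1 + 2 * \sum_e `|@test_decoration R X F e.1 e.2|.

Lemma test_bound_ge F e : 2 * `|@test_decoration R X F e.1 e.2| <= test_bound F.
Proof.
rewrite /test_bound ler_wpDl// ler_wpM2l// (bigD1 e)//= lerDl.
by rewrite sumr_ge0.
Qed.

Lemma test_bound_ge1 F : 1 <= test_bound F.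
Proof. by rewrite /test_bound lerDl mulr_ge0// sumr_ge0. Qed.

Section averaged.
Variables (F : test_graph X) (G : target_graph X) (K : eqType).
Variable c : target_vertex G -> K.

(** A single kernel, at least 1, above the tested decoration, its average and their difference for
    all edges together, as the counting lemma asks. *)
Definition dominating p : R :=
  test_bound F * (1 + `|gpair p| + `|cavg (pair_class c) (@gpair R X G) p|).

Lemma dominating_ge1 p : 1 <= dominating p.
Proof. by rewrite mulr_ege1 ?test_bound_ge1// -addrA lerDl addr_ge0. Qed.

Lemma test_dominating e (x : X) p : `|x| <= `|gpair p| + `|cavg (pair_class c) (@gpair R X G) p| ->
  `|@test_decoration R X F e.1 e.2 x| <= dominating p.
Proof.
move=> xp; rewrite (le_trans (dual_le _ _))//.
have := test_bound_ge e => be.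
rewrite ler_pM//; last by rewrite (le_trans xp)// -addrA lerDr.
by rewrite (le_trans _ be)// ler_peMl// ler1n.
Qed.

Lemma fmean_dominating n (M : R) : fmean (fun p => `|@gpair R X G p| ^+ n) <= M ->
  fmean (fun p => dominating p ^+ n) <= test_bound F ^+ n * (3 ^+ n * (1 + M + M)).
Proof.
move=> gM.
rewrite (@le_trans _ _ (fmean (fun p => test_bound F ^+ n * (3 ^+ n *
    ((1 + `|gpair p| ^+ n) + `|cavg (pair_class c) (@gpair R X G) p| ^+ n)))))//.
  apply: ler_fmean => p; rewrite /dominating exprMn ler_wpM2l ?exp_sum3_le//.
  by rewrite exprn_ge0// (le_trans _ (test_bound_ge1 F)).
have G0 : (0 < #|{: target_vertex G * target_vertex G}|)%N.
  by rewrite card_prod muln_gt0 target_nonempty.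
rewrite fmeanZ ler_wpM2l ?exprn_ge0 ?(le_trans _ (test_bound_ge1 F))//.
rewrite fmeanZ ler_wpM2l ?exprn_ge0// !fmeanD fmean_cst// lerD ?lerD2l//.
by rewrite (le_trans _ gM)// /fmean ler_wpM2l ?invr_ge0// sum_norm_cavg_exp.
Qed.

(** It involves only the test graph and the moment bounds, neither the target graph nor the
    partition; this is the source of the uniformity. *)
Definition count_bound (M : nat -> R) : R :=
  let E := #|@oriented_edge R X F| in
  1 + \sum_(e | @oriented_edge R X F e)
    test_bound F ^+ (2 * E) * (3 ^+ (2 * E) * (1 + M (2 * E)%N + M (2 * E)%N)).

Lemma fmean_prod_dominating (M : nat -> R) :
  (forall n, fmean (fun p => `|@gpair R X G p| ^+ n) <= M n) ->
  fmean (fun phi : {ffun test_vertex F -> target_vertex G} =>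
    \prod_(e | oriented_edge e) dominating (at_edge phi e) ^+ 2) <= count_bound M.
Proof.
move=> gM.
rewrite (le_trans (fmean_prod_le (target_nonempty G) (@oriented_edge_neq F) dominating))//.
by rewrite lerD2l; apply: ler_sum => e _; exact: fmean_dominating.
Qed.

End averaged.

(** The truncation level, the regularity parameter and the stage [B0] are fixed in this order from
    [F], [M] and [eps], before any target graph is considered. *)
Lemma regularity_counting (phi : nat -> dual X) F (M : nat -> R) (eps : R) :
  (forall (psi : dual X) e, 0 < e -> exists k, `|psi - phi k| < e) -> 0 < eps ->
  exists B0, forall G b, (forall n, fmean (fun p => `|@gpair R X G p| ^+ n) <= M n) ->
    (B0 <= b)%N -> `|hom_density F G - averaged_density F (code phi G b)| <= eps.
Proof.
move=> phid e0; pose P := @oriented_edge R X F; pose N : R := #|P|%:R + 1.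
have N0 : 0 < N by rewrite ltr_wpDl.
(* With this [K] the truncation errors over all edges total at most [eps / 2]; [delta] below then
   makes the main terms total at most [eps / 2]. *)
pose C := count_bound F M; pose K := 4 * N * (`|C| + 1) / eps.
have K0 : 0 < K by rewrite /K divr_gt0// !mulr_gt0// ltr_wpDl.
pose delta := eps / (2 * N * K ^+ 2).
have NK : 0 < 2 * N * K ^+ 2 by rewrite mulr_gt0 ?exprn_gt0// mulr_gt0.
have d0 : 0 < delta by rewrite divr_gt0.
have M12 (G : target_graph X) n :
    (forall n, fmean (fun p => `|@gpair R X G p| ^+ n) <= M n) -> (n == 1%N) || (n == 2%N) ->
    fmean (fun p => `|@gpair R X G p| ^+ n) <= Num.max (M 1%N) (M 2%N).
  by move=> gM /orP[]/eqP->; rewrite le_max gM ?orbT.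
have /choice[B0 B0P] (e : test_vertex F * test_vertex F) :=
  weak_regularity phid (@test_decoration R X F e.1 e.2) (Num.max (M 1%N) (M 2%N)) d0.
exists (\max_e B0 e)%N => G b gM Bb.
rewrite hom_densityE /averaged_density.
have V0 := target_nonempty G.
pose H := @dominating F G _ (code phi G b).
have H1 p : 1 <= H p by exact: dominating_ge1.
have := @counting R _ _ V0 P (@oriented_edge_neq F) (@oriented_edge_anti F) H H1 K delta K0
  (fun e p => test_decoration e.1 e.2 (gpair p))
  (fun e p => test_decoration e.1 e.2 (cavg (pair_class (code phi G b)) (@gpair R X G) p)).
set C' : R := fmean (fun f : {ffun test_vertex F -> target_vertex G} =>
  \prod_(e | P e) H (at_edge f e) ^+ 2).
have CC : C' <= `|C|.
  by rewrite (le_trans _ (ler_norm _))//; exact: fmean_prod_dominating.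
have C'0 : 0 <= C'.
  by apply: fmean_ge0 => ?; apply: prodr_ge0 => ? _; exact: sqr_ge0.
move=> /(_ _ _ _ _)/le_trans; apply.
- by move=> e p _; apply: test_dominating; rewrite lerDl.
- by move=> e p _; apply: test_dominating; rewrite lerDr.
- by move=> e p _; rewrite -dualB; apply: test_dominating; exact: ler_normB.
- move=> e _ x y x1 y1; apply: (B0P e) => //.
  + by have := M12 G 1%N gM isT; congr (_ <= _); apply: eq_fmean.
  + exact: (M12 G 2%N gM isT).
  + by rewrite (leq_trans _ Bb)// (leq_bigmax e).
rewrite (@le_trans _ _ (N * (K ^+ 2 * delta + 2 * `|C| / K)))//.
  apply: ler_pM => //.
  - apply: addr_ge0; first by apply: mulr_ge0; [exact: sqr_ge0|exact: ltW].
    by apply: divr_ge0; [exact: mulr_ge0|exact: ltW].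
  - by rewrite lerDl.
  - by rewrite lerD2l ler_wpM2r ?invr_ge0 ?(ltW K0)// ler_wpM2l.
have -> : K ^+ 2 * delta = eps / (2 * N).
  by rewrite /delta; field; rewrite !gt_eqF.
have : N * (2 * `|C| / K) <= eps / 2.
  rewrite /K invfM invrK.
  have -> : N * (2 * `|C| * ((4 * N * (`|C| + 1))^-1 * eps)) =
      (eps / 2) * (`|C| / (`|C| + 1)).
    by field; rewrite !gt_eqF// ltr_wpDl.
  rewrite ler_piMr ?divr_ge0 ?(ltW e0)// ler_pdivrMr ?ltr_wpDl// mul1r lerDl.
  by [].
rewrite mulrDr; have -> : N * (eps / (2 * N)) = eps / 2 by field; rewrite gt_eqF.
lra.
Qed.

End test_graphs.

(** * Limits along an ultrafilter *)

Section filter_limits.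
Context {R : realType} {T : Type} (F : set_system T) {FF : ProperFilter F}.
Implicit Types (f g : T -> R) (a b : R).

Lemma cvg_sumF (I : Type) (r : seq I) (P : pred I) (f : I -> T -> R) (a : I -> R) :
  (forall i, P i -> f i x @[x --> F] --> a i) ->
  \sum_(i <- r | P i) f i x @[x --> F] --> \sum_(i <- r | P i) a i.
Proof.
move=> fa; apply: cvg_big => //.
by move=> x; exact: (@add_continuous R^o x).
Qed.

Lemma cvg_prodF (I : Type) (r : seq I) (P : pred I) (f : I -> T -> R) (a : I -> R) :
  (forall i, P i -> f i x @[x --> F] --> a i) ->
  \prod_(i <- r | P i) f i x @[x --> F] --> \prod_(i <- r | P i) a i.
Proof.
move=> fa; apply: cvg_big => //.
by move=> x; exact: (@mul_continuous R x).
Qed.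

Lemma cvg_exprF f a n : f x @[x --> F] --> a -> f x ^+ n @[x --> F] --> a ^+ n.
Proof.
move=> fa; elim: n => [|n IH]; first exact: cvg_cst.
by rewrite exprS; under eq_fun do rewrite exprS; exact: cvgM.
Qed.

Lemma cvgF_le f a b : f x @[x --> F] --> a -> (forall x, f x <= b) -> a <= b.
Proof. by move=> fa fb; apply: (cvgr_to_le fa); apply: (@filterE _ F). Qed.

Lemma cvgF_ge f a b : f x @[x --> F] --> a -> (forall x, b <= f x) -> b <= a.
Proof. by move=> fa fb; apply: (cvgr_to_ge fa); apply: (@filterE _ F). Qed.

Lemma cvgF_unique f a b : f x @[x --> F] --> a -> f x @[x --> F] --> b -> a = b.
Proof. by move=> fa fb; apply: (@cvg_unique R^o _ _ _ _ _ fa fb); exact: Rhausdorff. Qed.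

Lemma cvgF_ext f g a : f =1 g -> g x @[x --> F] --> a -> f x @[x --> F] --> a.
Proof. by move=> /funext ->. Qed.

Lemma cvgF_normP f a : (forall e, 0 < e -> \forall x \near F, `|a - f x| <= e) <->
  f x @[x --> F] --> a.
Proof. by split=> [h|/cvgrPdist_le//]; apply/cvgrPdist_le. Qed.

(* For every [K], [|f|] is at most [K g + C / K]. *)
Lemma cvg0_young f g (C : R) : 0 <= C -> g x @[x --> F] --> (0 : R) ->
  (forall x K, 0 < K -> `|f x| <= K * g x + C / K) -> f x @[x --> F] --> (0 : R).
Proof.
move=> C0 g0 fg; apply/cvgF_normP => e e0.
pose K := 2 * (C + 1) / e.
have K0 : 0 < K by rewrite divr_gt0// mulr_gt0// ltr_wpDl.
have d0 : 0 < e / (2 * K) by rewrite divr_gt0// mulr_gt0.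
have := (cvgF_normP _ _).2 g0 _ d0; apply: filterS => x; rewrite !sub0r !normrN => gx.
rewrite (le_trans (fg x K K0))//.
have : K * g x <= e / 2.
  rewrite (@le_trans _ _ (K * (e / (2 * K))))//.
    by rewrite ler_wpM2l ?(ltW K0)// (le_trans _ gx)// ler_norm.
  by rewrite le_eqVlt; apply/orP; left; apply/eqP; field; rewrite gt_eqF.
suff : C / K <= e / 2 by lra.
rewrite ler_pdivrMr// /K.
have -> : e / 2 * (2 * (C + 1) / e) = C + 1 by field; rewrite gt_eqF.
by rewrite lerDl.
Qed.

End filter_limits.

(** * Measures and masses of vertex classes *)

Section class_sums.
Context {R : realType} {V : finType}.

Definition class_measure (c : V -> nat) (s : nat) : R := fmean (fun u => (c u == s)%:R).

Lemma class_measure_ge0 c s : 0 <= class_measure c s.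
Proof. exact: fmean_ge0. Qed.

Lemma sum_class_measure c n : (0 < #|V|)%N -> (forall u, c u < n)%N ->
  \sum_(s < n) class_measure c s = 1.
Proof.
move=> V0 cn; rewrite -fmean_sum -[RHS](fmean_cst 1 V0); apply: eq_fmean => u.
rewrite (bigD1 (Ordinal (cn u)))//= eqxx big1 ?addr0// => i iu.
by rewrite (_ : (c u == i) = false)//; apply: contraNF iu => /eqP cu; apply/eqP/val_inj.
Qed.

Lemma class_measure_le1 c s : (0 < #|V|)%N -> class_measure c s <= 1.
Proof. by move=> V0; rewrite -[leRHS](fmean_cst 1 V0); apply: ler_fmean => u; rewrite lern1 leq_b1. Qed.

Lemma class_measureE c s : class_measure c s = (#|V|%:R)^-1 * \sum_(u | c u == s) 1.
Proof.
by rewrite /class_measure /fmean; congr *%R; rewrite [RHS]big_mkcond;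
  apply: eq_bigr => u _; case: ifP.
Qed.

Lemma class_sizeE c u : (0 < #|V|)%N ->
  class_size c u = #|V|%:R * class_measure c (c u).
Proof.
by move=> V0; rewrite class_measureE mulrA divff ?mul1r// pnatr_eq0 -lt0n.
Qed.

(** The values of a uniformly random map are independent, so their codes have a product law.
    Densities become finite sums over an index set common to all graphs. *)
Lemma fmean_code (I : finType) (c : V -> nat) n (cn : forall u, (c u < n)%N)
    (h : {ffun I -> 'I_n} -> R) :
  fmean (fun phi : {ffun I -> V} => h [ffun i => Ordinal (cn (phi i))]) =
  \sum_(s : {ffun I -> 'I_n}) (\prod_i class_measure c (s i)) * h s.
Proof.
transitivity (fmean (fun phi : {ffun I -> V} =>
    \sum_(s : {ffun I -> 'I_n}) h s * \prod_i (c (phi i) == s i)%:R)).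
  apply: eq_fmean => phi; rewrite (bigD1 [ffun i => Ordinal (cn (phi i))])//=.
  rewrite big1 ?mulr1 => [|i _]; last by rewrite ffunE eqxx.
  rewrite big1 ?addr0// => s /eqP sphi.
  suff [i si] : exists i, c (phi i) != s i.
    by rewrite (bigD1 i)//= (negbTE si) mul0r mulr0.
  apply/existsP; apply: contraT; rewrite negb_exists => /forallP h'.
  exfalso; apply: sphi; apply/ffunP => i; rewrite ffunE; apply/val_inj => /=.
  by apply/esym/eqP; have := h' i; rewrite negbK.
rewrite fmean_sum; apply: eq_bigr => s _; rewrite fmeanZ mulrC; congr (_ * _).
rewrite /fmean -(bigA_distr_bigA (fun i u => (c u == s i)%:R)).
rewrite /class_measure /fmean big_split/= prodr_const card_ffun natrX exprVn.
by congr (_^-1 * _); rewrite cardT.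
Qed.

End class_sums.

Section target_limits.
Context {R : realType} {X : normedModType R}.
Variable G : target_graph X.
Let V := target_vertex G.

(** Limits are taken of masses rather than averages: masses add up under coarsening and need no
    division by a class measure that may tend to zero. *)
Definition pair_mass (c : V -> nat) (s t : nat) : X :=
  (#|{: V * V}|%:R)^-1 *: \sum_(p : V * V | pair_class c p == (s, t)) gpair p.

Definition pair_value (c : V -> nat) (s t : nat) : X :=
  (class_measure c s * class_measure c t : R)^-1 *: pair_mass c s t.

Lemma cavg_pair_value c p : cavg (pair_class c) (@gpair R X G) p = pair_value c (c p.1) (c p.2).
Proof.
have V0 := target_nonempty G; have V0' : #|V|%:R != 0 :> R by rewrite pnatr_eq0 -lt0n.
rewrite /cavg /pair_value /pair_mass scalerA; congr (_ *: _).
rewrite -invfM card_prod natrM; congr (_^-1).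
rewrite mulrACA [X in X * _]mulrC [X in _ * X]mulrC -!class_sizeE//.
rewrite /class_size big_distrlr/= pair_big_dep/=.
by apply: eq_big => [[u v]|*]; rewrite ?mulr1// /pair_class xpair_eqE.
Qed.

Lemma pair_mass_sym c s t : pair_mass c s t = pair_mass c t s.
Proof.
rewrite /pair_mass; congr (_ *: _).
have sw : involutive (fun p : V * V => (p.2, p.1)) by case.
rewrite (reindex_inj (inv_inj sw))/=; apply: eq_big => -[u v] /=.
  by rewrite /pair_class /= !xpair_eqE andbC.
by move=> _; rewrite /gpair/= target_sym.
Qed.

Lemma class_measure_coarsen (c c' : V -> nat) n q : (forall u, c' u < n)%N ->
  (forall u, c u = (c' u %/ q)%N) -> forall s,
  class_measure c s = \sum_(i < n | (i %/ q)%N == s) class_measure c' i :> R.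
Proof.
move=> cn cq s; rewrite class_measureE.
rewrite (partition_big (fun u => Ordinal (cn u)) (fun i => (i %/ q)%N == s))/=; last first.
  by move=> u /eqP <-; rewrite cq.
rewrite mulr_sumr; apply: eq_bigr => i /eqP si; rewrite class_measureE; congr (_ * _).
apply: eq_bigl => u; rewrite -val_eqE/= cq andbC; case: eqP => //= ->.
by rewrite si eqxx.
Qed.

Lemma pair_mass_coarsen (c c' : V -> nat) n q : (forall u, c' u < n)%N ->
  (forall u, c u = (c' u %/ q)%N) -> forall s t,
  pair_mass c s t =
  \sum_(i < n | (i %/ q)%N == s) \sum_(j < n | (j %/ q)%N == t) pair_mass c' i j.
Proof.
move=> cn cq s t; rewrite /pair_mass.
rewrite (partition_big (fun p : V * V => (Ordinal (cn p.1), Ordinal (cn p.2)))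
  (fun ij : 'I_n * 'I_n => ((ij.1 %/ q)%N == s) && ((ij.2 %/ q)%N == t)))/=; last first.
  by move=> [u v]; rewrite /pair_class xpair_eqE /= !cq.
rewrite scaler_sumr [RHS]pair_big_dep/=; apply: eq_bigr => -[i j] /= /andP[/eqP si /eqP tj].
congr (_ *: _); apply: eq_bigl => -[u v].
rewrite /pair_class !xpair_eqE/= -!val_eqE/= !cq.
by rewrite andbC; case: (c' u =P i) => //= ->; case: (c' v =P j) => //= ->;
  rewrite ?si ?tj ?eqxx// andbF.
Qed.

(** Uniform integrability of the decorations: pairs of classes of small measure carry little
    mass. *)
Lemma norm_pair_mass_young c s t (K M : R) : 0 < K ->
  fmean (fun p => `|@gpair R X G p| ^+ 2) <= M ->
  `|pair_mass c s t| <= K * (class_measure c s * class_measure c t) + M / K.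
Proof.
move=> K0 gM; rewrite /pair_mass normrZ ger0_norm ?invr_ge0//.
rewrite (@le_trans _ _ (fmean (fun p => K * ((c p.1 == s)%:R * (c p.2 == t)%:R) +
    K^-1 * `|@gpair R X G p| ^+ 2)))//.
  rewrite /fmean ler_wpM2l ?invr_ge0// (le_trans (ler_norm_sum _ _ _))//.
  rewrite big_mkcond; apply: ler_sum => p _; rewrite /pair_class xpair_eqE.
  have K10 : 0 <= K^-1 * `|gpair p| ^+ 2 by rewrite mulr_ge0 ?sqr_ge0// invr_ge0 ltW.
  case: (c p.1 == s); last by rewrite mul0r mulr0 add0r.
  case: (c p.2 == t); last by rewrite mulr0 mulr0 add0r.
  by rewrite !mulr1/= (mulrC K^-1) (le_trans (ler_norm _))// (young _ K0).
rewrite fmeanD !fmeanZ mulrC lerD//; last first.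
  by rewrite mulrC ler_wpM2r// invr_ge0 ltW.
rewrite mulrC ler_wpM2l ?(ltW K0)// fmean_pair /class_measure.
have e u : fmean (fun v => (c u == s)%:R * (c v == t)%:R) =
    fmean (fun v => (c v == t)%:R) * (c u == s)%:R :> R.
  by rewrite fmeanZ mulrC.
rewrite (eq_fmean e) fmeanZ mulrC.
by rewrite lexx.
Qed.

Lemma norm_pair_mass c s t (M : R) : fmean (fun p => `|@gpair R X G p| ^+ 1) <= M ->
  `|pair_mass c s t| <= M.
Proof.
apply: le_trans; rewrite /pair_mass normrZ ger0_norm ?invr_ge0//.
rewrite /fmean ler_wpM2l ?invr_ge0// (le_trans (ler_norm_sum _ _ _))//.
by rewrite big_mkcond; apply: ler_sum => p _; case: ifP.
Qed.

Lemma sum_pair_value_exp c n m (M : R) : (forall u, c u < n)%N ->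
  fmean (fun p => `|@gpair R X G p| ^+ m) <= M ->
  \sum_(s < n) \sum_(t < n)
    class_measure c s * class_measure c t * `|pair_value c s t| ^+ m <= M.
Proof.
move=> cn; apply: le_trans.
rewrite (@le_trans _ _ (fmean (fun p => `|cavg (pair_class c) (@gpair R X G) p| ^+ m)))//;
  last by rewrite /fmean ler_wpM2l ?invr_ge0// sum_norm_cavg_exp.
rewrite le_eqVlt; apply/orP; left; apply/eqP.
have -> : fmean (fun p => `|cavg (pair_class c) (@gpair R X G) p| ^+ m) =
    fmean (fun u => fmean (fun v => `|pair_value c (c u) (c v)| ^+ m)).
  by rewrite fmean_pair; apply: eq_fmean => u; apply: eq_fmean => v; rewrite cavg_pair_value.
have one (h : nat -> R) : fmean (fun u => h (c u)) = \sum_(s < n) class_measure c s * h s.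
  rewrite (@eq_fmean _ _ _ (fun u => \sum_(s < n) h s * (c u == s)%:R)); last first.
    move=> u; rewrite (bigD1 (Ordinal (cn u)))//= eqxx mulr1 big1 ?addr0// => i iu.
    rewrite (_ : (c u == i) = false) ?mulr0//.
    by apply: contraNF iu => /eqP cu; apply/eqP/val_inj.
  by rewrite fmean_sum; apply: eq_bigr => s _; rewrite fmeanZ mulrC.
rewrite (one (fun s => fmean (fun v => `|pair_value c s (c v)| ^+ m))).
apply: eq_bigr => s _; rewrite (one (fun t => `|pair_value c s t| ^+ m)) mulr_sumr.
by apply: eq_bigr => t _; rewrite mulrA.
Qed.

Lemma averaged_densityE (F : test_graph X) c n (cn : forall u, (c u < n)%N) :
  averaged_density F c =
  \sum_(s : {ffun test_vertex F -> 'I_n}) (\prod_i class_measure c (s i)) *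
    \prod_(e | oriented_edge e) test_decoration e.1 e.2 (pair_value c (s e.1) (s e.2)).
Proof.
rewrite -(fmean_code cn); apply: eq_fmean => phi; apply: eq_bigr => e _.
by rewrite cavg_pair_value !ffunE.
Qed.

(** A second moment of the density summands, needed for the code assignments whose weight vanishes
    in the limit. *)
Lemma averaged_sqr_le (F : test_graph X) c n (cn : forall u, (c u < n)%N) (M : nat -> R) :
  (forall n, fmean (fun p => `|@gpair R X G p| ^+ n) <= M n) ->
  \sum_(s : {ffun test_vertex F -> 'I_n}) (\prod_i class_measure c (s i)) *
    (\prod_(e | oriented_edge e) test_decoration e.1 e.2 (pair_value c (s e.1) (s e.2))) ^+ 2
    <= count_bound F M.
Proof.
move=> gM; rewrite (le_trans _ (fmean_prod_dominating F c gM))//.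
rewrite -(fmean_code cn); apply: ler_fmean => phi; rewrite prodrXl -real_normK ?num_real//.
rewrite normr_prod; rewrite lerXn2r ?nnegrE ?prodr_ge0//.
  by move=> e _; rewrite (le_trans _ (dominating_ge1 _ _ _)).
apply: ler_prod => e _; rewrite normr_ge0/= !ffunE/=.
have := cavg_pair_value c (at_edge phi e); rewrite /at_edge/= => <-.
by apply: test_dominating; rewrite lerDr.
Qed.

End target_limits.

(** * Ultralimits of the averaged graphs *)

Section ultralimit_graph.
Context {R : realType} {X : normedModType R}.
Hypothesis X_refl : reflexive_space X.
Variables (U : set_system nat) (UU : UltraFilter U).
Variables (G : nat -> target_graph X) (phi : nat -> dual X) (M : nat -> R).
Hypothesis GM : forall n m, fmean (fun p => `|@gpair R X (G n) p| ^+ m) <= M m.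


Let mu_ n b s : R := class_measure (code phi (G n) b) s.
Let a_ n b s t := pair_mass (code phi (G n) b) s t.
Let v_ n b s t := pair_value (code phi (G n) b) s t.

Definition lim_measure b s : R := lim (mu_ n b s @[n --> U]).

Lemma lim_measureP b s : mu_ n b s @[n --> U] --> lim_measure b s.
Proof.
apply: (ultra_bounded_cvg UU (M := 1)) => n; rewrite ger0_norm ?class_measure_ge0//.
by apply: class_measure_le1; exact: target_nonempty.
Qed.

Arguments lim_measureP : clear implicits.

Let lim_mass_ex b s t :
  exists y : X, forall psi : dual X, psi (a_ n b s t) @[n --> U] --> psi y.
Proof. by apply: (reflexive_lim UU (M := M 1%N)) => // n; exact: norm_pair_mass. Qed.

Definition lim_mass b s t : X := projT1 (cid (lim_mass_ex b s t)).

Lemma lim_massP b s t (psi : dual X) : psi (a_ n b s t) @[n --> U] --> psi (lim_mass b s t).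
Proof. exact: (projT2 (cid (lim_mass_ex b s t))). Qed.

Arguments lim_massP : clear implicits.

(** On a pair of zero limit measure the inverse is [0], and so is the value; the mass is still
    recovered, as it vanishes there too. *)
Definition lim_value b s t : X := (lim_measure b s * lim_measure b t)^-1 *: lim_mass b s t.

Lemma lim_measure_ge0 b s : 0 <= lim_measure b s.
Proof. by apply: (cvgF_ge (lim_measureP b s)) => n; exact: class_measure_ge0. Qed.

Lemma sum_lim_measure b : \sum_(s < 4 ^ b) lim_measure b s = 1.
Proof.
have h : \sum_(s < 4 ^ b) mu_ n b s @[n --> U] --> \sum_(s < 4 ^ b) lim_measure b s.
  by apply: cvg_sumF => i _; exact: lim_measureP.
apply: (cvgF_unique h); apply: (@cvgF_ext _ _ _ _ (fun=> 1)); last exact: cvg_cst.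
move=> n; apply: sum_class_measure => [|u]; first exact: target_nonempty.
exact: code_lt.
Qed.

Lemma lim_measure_coarsen b b' s : (b <= b')%N ->
  lim_measure b s = \sum_(i < 4 ^ b' | (i %/ 4 ^ (b' - b))%N == s) lim_measure b' i.
Proof.
move=> bb'; apply: (cvgF_unique (lim_measureP b s)).
apply: (@cvgF_ext _ _ _ _
  (fun n => \sum_(i < 4 ^ b' | (i %/ 4 ^ (b' - b))%N == s) mu_ n b' i)) => [n|]; last first.
  by apply: cvg_sumF => i _; exact: lim_measureP.
rewrite /mu_ (@class_measure_coarsen _ _ (G n) _ (code phi (G n) b') (4 ^ b') (4 ^ (b' - b)))//.
- exact: code_lt.
- by move=> u; exact: code_div.
Qed.

Lemma lim_mass_coarsen b b' s t : (b <= b')%N ->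
  lim_mass b s t = \sum_(i < 4 ^ b' | (i %/ 4 ^ (b' - b))%N == s)
    \sum_(j < 4 ^ b' | (j %/ 4 ^ (b' - b))%N == t) lim_mass b' i j.
Proof.
move=> bb'; apply: dual_sep => psi; apply: (cvgF_unique (lim_massP b s t psi)).
rewrite dual_sum; under eq_bigr do rewrite dual_sum.
apply: (@cvgF_ext _ _ _ _ (fun n => \sum_(i < 4 ^ b' | (i %/ 4 ^ (b' - b))%N == s)
    \sum_(j < 4 ^ b' | (j %/ 4 ^ (b' - b))%N == t) psi (a_ n b' i j))) => [n|]; last first.
  by apply: cvg_sumF => i _; apply: cvg_sumF => j _; exact: lim_massP.
rewrite /a_ (@pair_mass_coarsen _ _ (G n) _ (code phi (G n) b') (4 ^ b') (4 ^ (b' - b)))//.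
- by rewrite dual_sum; apply: eq_bigr => i _; rewrite dual_sum.
- exact: code_lt.
- by move=> u; exact: code_div.
Qed.

Lemma lim_mass_sym b s t : lim_mass b s t = lim_mass b t s.
Proof.
apply: dual_sep => psi; apply: (cvgF_unique (lim_massP b s t psi)).
by under eq_fun do rewrite /a_ pair_mass_sym; exact: lim_massP.
Qed.

Lemma lim_value_sym b s t : lim_value b s t = lim_value b t s.
Proof. by rewrite /lim_value lim_mass_sym mulrC. Qed.

Let M_ge0 m : 0 <= M m.
Proof. by apply: (le_trans _ (GM 0 m)); apply: fmean_ge0 => p; exact: exprn_ge0. Qed.

Lemma lim_mass_eq0 b s t : lim_measure b s * lim_measure b t = 0 -> lim_mass b s t = 0.
Proof.
move=> st0; apply: dual_sep => psi; rewrite dual0; apply: (cvgF_unique (lim_massP b s t psi)).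
have m0 : `|psi| * (mu_ n b s * mu_ n b t) @[n --> U] --> (0 : R).
  rewrite -(mulr0 `|psi|) -st0; apply: cvgM; first exact: cvg_cst.
  by apply: cvgM; exact: lim_measureP.
apply: (cvg0_young (C := `|psi| * M 2%N) _ m0); first by rewrite mulr_ge0.
move=> n K K0; rewrite (le_trans (dual_le _ _))//.
rewrite (le_trans (ler_wpM2l _ (norm_pair_mass_young _ _ _ K0 (GM n 2))))//.
by rewrite mulrDr mulrCA lerD2l mulrA.
Qed.

Lemma lim_massE b s t : lim_mass b s t = (lim_measure b s * lim_measure b t) *: lim_value b s t.
Proof.
rewrite /lim_value scalerA; have [st0|st0] := eqVneq (lim_measure b s * lim_measure b t) 0.
  by rewrite st0 mul0r scale0r lim_mass_eq0.
by rewrite divff// scale1r.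
Qed.

Lemma lim_valueP b s t (psi : dual X) : lim_measure b s * lim_measure b t != 0 ->
  psi (v_ n b s t) @[n --> U] --> psi (lim_value b s t).
Proof.
move=> st0; rewrite /lim_value dual_scale; under eq_fun do rewrite /v_ /pair_value dual_scale.
apply: cvgM; last exact: lim_massP.
by apply: cvgV => //; apply: cvgM; exact: lim_measureP.
Qed.

(** Weak lower semicontinuity of the norm: each of the finitely many limit values is tested with its
    norming functional. Pairs of zero measure are dropped beforehand, since the averages need not
    converge there. *)
Lemma sum_lim_value_exp b m :
  \sum_(s < 4 ^ b) \sum_(t < 4 ^ b)
    lim_measure b s * lim_measure b t * `|lim_value b s t| ^+ m <= M m.
Proof.
have /choice[psi psiP] (p : nat * nat) :
    exists psi : dual X, `|psi| <= 1 /\ psi (lim_value b p.1 p.2) = `|lim_value b p.1 p.2|.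
  by have [psi ? ?] := norming_functional (lim_value b p.1 p.2); exists psi.
pose Q (s t : 'I_(4 ^ b)) := lim_measure b s * lim_measure b t != 0.
have h : \sum_(s < 4 ^ b) \sum_(t < 4 ^ b | Q s t)
      mu_ n b s * mu_ n b t * psi (s : nat, t : nat) (v_ n b s t) ^+ m @[n --> U] -->
    \sum_(s < 4 ^ b) \sum_(t < 4 ^ b | Q s t) lim_measure b s * lim_measure b t *
      psi (s : nat, t : nat) (lim_value b s t) ^+ m.
  apply: cvg_sumF => s _; apply: cvg_sumF => t Qst.
  apply: cvgM; first by apply: cvgM; exact: lim_measureP.
  by apply: cvg_exprF; exact: lim_valueP.
have {}h := cvgF_le h.
rewrite (le_trans _ (h _ (M m) _))//.
  rewrite le_eqVlt; apply/orP; left; apply/eqP; apply: eq_bigr => s _.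
  rewrite [RHS]big_mkcond; apply: eq_bigr => t _; rewrite /Q.
  have [->|_] := eqVneq (lim_measure b s * lim_measure b t) 0; first by rewrite mul0r.
  by rewrite (psiP (s : nat, t : nat)).2.
move=> n; rewrite (le_trans _ (sum_pair_value_exp (@code_lt _ _ phi (G n) b) (GM n m)))//.
apply: ler_sum => s _; rewrite big_mkcond; apply: ler_sum => t _.
have mm : 0 <= class_measure (code phi (G n) b) s * class_measure (code phi (G n) b) t :> R.
  by rewrite mulr_ge0 ?class_measure_ge0.
case: ifP => _; last by rewrite mulr_ge0// exprn_ge0.
rewrite ler_wpM2l// (le_trans (ler_norm _))// normrX.
rewrite lerXn2r ?nnegrE// (le_trans (dual_le _ _))// ler_piMl//.
by have [] := psiP (s : nat, t : nat).
Qed.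

Definition limit_density (F : test_graph X) b : R :=
  \sum_(s : {ffun test_vertex F -> 'I_(4 ^ b)}) (\prod_i lim_measure b (s i)) *
    \prod_(e | oriented_edge e) test_decoration e.1 e.2 (lim_value b (s e.1) (s e.2)).

(** Assignments of positive limit weight converge factor by factor. For the others nothing is known
    about the values, but the second moment makes weight times value tend to zero with the
    weight. *)
Lemma averaged_density_lim (F : test_graph X) b :
  averaged_density F (code phi (G n) b) @[n --> U] --> limit_density F b.
Proof.
rewrite (_ : (fun n => _) = fun n => \sum_(s : {ffun test_vertex F -> 'I_(4 ^ b)})
  (\prod_i mu_ n b (s i)) *
  \prod_(e | oriented_edge e) test_decoration e.1 e.2 (v_ n b (s e.1) (s e.2))); last first.
  by apply/funext => n; exact: averaged_densityE (@code_lt _ _ phi (G n) b).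
apply: cvg_sumF => s _.
have mus : \prod_i mu_ n b (s i) @[n --> U] --> \prod_i lim_measure b (s i).
  by apply: cvg_prodF => i _; exact: lim_measureP.
have [s0|s0] := eqVneq (\prod_i lim_measure b (s i)) 0; last first.
  apply: cvgM => //; apply: cvg_prodF => e _; apply: lim_valueP.
  by move/prodf_neq0: s0 => s0; rewrite mulf_neq0// s0.
rewrite s0 mul0r; rewrite s0 in mus.
apply: (cvg0_young (C := `|count_bound F M|) _ mus) => // n K K0.
have p0 : 0 <= \prod_i mu_ n b (s i) by apply: prodr_ge0 => i _; exact: class_measure_ge0.
set P := \prod_(e | _) _; rewrite normrM (ger0_norm p0).
rewrite (le_trans (young_mul K0 p0 (normr_ge0 _)))// lerD2l ler_wpM2r ?invr_ge0 ?(ltW K0)//.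
rewrite (le_trans _ (ler_norm _))// (le_trans _ (averaged_sqr_le F (@code_lt _ _ phi (G n) b) (GM n)))//.
rewrite (bigD1 s)//= real_normK ?num_real// lerDl sumr_ge0// => i _.
by rewrite mulr_ge0 ?sqr_ge0// prodr_ge0// => j _; exact: class_measure_ge0.
Qed.

End ultralimit_graph.

(** * Step kernels *)

Section finite_valued.
Context d (T : measurableType d) (R : realType) (P : probability T R).
Variables (I : finType) (k : T -> I).
Hypothesis mk : forall i, measurable (k @^-1` [set i]).

Definition fiber_weight i : R := fine (P (k @^-1` [set i])).

Let finite_valuedE (h : I -> R) : (fun z => (h (k z))%:E) =
  (fun z => \sum_(i : I) (h i)%:E * (\1_(k @^-1` [set i]) z)%:E)%E.
Proof.
apply/funext => z; rewrite (bigD1 (k z))//= indicE mem_set// mule1.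
rewrite big1 ?adde0// => i iz; rewrite indicE memNset ?mule0//= => zi.
by rewrite zi eqxx in iz.
Qed.

Let integrable_fiber (h : I -> R) i :
  P.-integrable setT (fun z => (h i)%:E * (\1_(k @^-1` [set i]) z)%:E)%E.
Proof. by apply: integrableZl => //; exact: integrable_indic. Qed.

Lemma measurable_finite_valued (h : I -> R) : measurable_fun setT (h \o k).
Proof.
apply/measurable_EFinP; rewrite /comp finite_valuedE.
apply: emeasurable_sum => i.
by have /integrableP[] := integrable_fiber h i.
Qed.

Lemma integral_finite_valued (h : I -> R) :
  (\int[P]_z (h (k z))%:E = (\sum_i fiber_weight i * h i)%:E)%E.
Proof.
rewrite finite_valuedE integral_sum//.
rewrite -sumEFin; apply: eq_bigr => i _; rewrite integralZl//; last exact: integrable_indic.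
rewrite integral_indic// setIT EFinM muleC /fiber_weight fineK//.
exact: fin_num_measure.
Qed.

End finite_valued.

(** * Lebesgue measure of cubes and its two-dimensional marginals *)

Section cube_measure.
Context {R : realType}.
Local Notation R1 := (measurableTypeR R).
Local Notation lam := (@unit_lebesgue R).

Definition box n (A : 'I_n -> set R1) : set (n.-tuple R1) :=
  [set x | forall i, A i (tnth x i)].

Lemma measurable_box n (A : 'I_n -> set R1) :
  (forall i, measurable (A i)) -> measurable (box A).
Proof.
move=> mA; rewrite (_ : box A = \bigcap_(i in [set: 'I_n]) ((@tnth n R1)^~ i @^-1` A i)).
  apply: fin_bigcap_measurable; first exact: finite_finset.
  by move=> i _; rewrite -[X in measurable X]setTI; exact: measurable_tnth.
by apply/seteqP; split => x h i; [move=> _|]; exact: h.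
Qed.

Lemma cube_box n (A : 'I_n -> set R1) : (forall i, measurable (A i)) ->
  cube_lebesgue R n (box A) = (\prod_i fine (lam (A i)))%:E.
Proof.
elim: n A => [|n IH] A mA.
  rewrite big_ord0 /= diracE mem_set// => -[i i0].
  by [].
have -> : cube_lebesgue R n.+1 (box A) =
    (lam \x cube_lebesgue R n)%E (A ord0 `*` @box n (fun i => A (lift ord0 i))).
  rewrite /= /distribution /pushforward; congr (_ _).
  apply/seteqP; split => -[x y] /= h.
    split; first exact: (h ord0).
    by move=> i; have := h (lift ord0 i); rewrite tnthS.
  move=> i; case: (unliftP ord0 i) => [j ->|->]; last exact: h.1.
  by rewrite tnthS; exact: h.2.
rewrite product_measure1E//; last exact: measurable_box.
rewrite big_ord_recl EFinM; congr (_ * _)%E; last exact: IH.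
by rewrite fineK//; exact: fin_num_measure.
Qed.

Lemma cube_marginal_rect n (i j : 'I_n) (A B : set R1) : i != j ->
  measurable A -> measurable B ->
  (cube_lebesgue R n ((fun x => (tnth x i, tnth x j)) @^-1` (A `*` B)) = lam A * lam B)%E.
Proof.
move=> ij mA mB.
pose C k := if k == i then A else if k == j then B else setT.
have mC k : measurable (C k) by rewrite /C; case: ifP => // _; case: ifP.
have -> : (fun x : n.-tuple R1 => (tnth x i, tnth x j)) @^-1` (A `*` B) = box C.
  apply/seteqP; split => x /=.
    move=> [Ax Bx] k; rewrite /C; case: eqP => [->//|_]; case: eqP => [->//|_]; exact: I.
  move=> h; have := h i; have := h j; rewrite /C eqxx eq_sym (negbTE ij) eqxx.
  by [].
rewrite cube_box// (bigD1 i)//= (bigD1 j)/=; last by rewrite eq_sym.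
rewrite big1 => [|k /andP[ki kj]]; last first.
  by rewrite /C (negbTE ki) (negbTE kj); rewrite probability_setT.
rewrite mulr1 /C eqxx eq_sym (negbTE ij) eqxx EFinM !fineK//; exact: fin_num_measure.
Qed.

Lemma measurable_tnth_pair n (i j : 'I_n) :
  measurable_fun setT (fun x : n.-tuple R1 => (tnth x i, tnth x j)).
Proof. by apply: measurable_fun_pair; exact: measurable_tnth. Qed.

(** The image measure agrees with the product measure on rectangles, which determine the latter. *)
Lemma cube_marginal n (i j : 'I_n) (S : set (R1 * R1)) : i != j -> measurable S ->
  cube_lebesgue R n ((fun x => (tnth x i, tnth x j)) @^-1` S) = square_lebesgue R S.
Proof.
move=> ij mS; apply/esym.
pose pr (x : n.-tuple R1) := (tnth x i, tnth x j).
pose prM : {mfun n.-tuple R1 >-> (R1 * R1)%type} := HB.pack pr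
  (isMeasurableFun.Build _ _ _ _ pr (measurable_tnth_pair i j)).
pose m' : {measure set (R1 * R1) -> \bar R} := distribution (cube_lebesgue R n) prM.
by apply: (product_measure_unique (m' := m')) => // A B mA mB; exact: cube_marginal_rect.
Qed.

Lemma square_lebesgue_rect (A B : set R1) : measurable A -> measurable B ->
  square_lebesgue R (A `*` B) = (lam A * lam B)%E.
Proof. exact: product_measure1E. Qed.

Lemma ge0_integral_marginal n (i j : 'I_n) (f : R1 * R1 -> \bar R) : i != j ->
  measurable_fun setT f -> (forall z, 0 <= f z)%E ->
  (\int[cube_lebesgue R n]_x f (tnth x i, tnth x j) = \int[square_lebesgue R]_z f z)%E.
Proof.
move=> ij mf f0.
rewrite -(@eq_measure_integral _ _ _ _ _
  (pushforward (cube_lebesgue R n) (fun x => (tnth x i, tnth x j)))).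
- exact: measurable_tnth_pair.
- by move=> mt; rewrite ge0_integral_pushforward.
- by move=> mt A mA _; exact: cube_marginal.
Qed.

End cube_measure.

(** * Interval codes with prescribed masses *)

Section interval_codes.
Context {R : realType}.
Local Notation R1 := (measurableTypeR R).
Variable m : nat -> nat -> R.
Hypothesis m_ge0 : forall b s, 0 <= m b s.
Hypothesis sum_m : forall b, \sum_(s < 4 ^ b) m b s = 1.
Hypothesis m_coarsen : forall b b' s, (b <= b')%N ->
  m b s = \sum_(i < 4 ^ b' | (i %/ 4 ^ (b' - b))%N == s) m b' i.

Definition left_end b j : R := \sum_(i < j) m b i.

(** Consecutive intervals of lengths [m b s]; a code of zero mass gets a null set. Points outside
    the unit interval are coded as well: [0] on its left, by the empty maximum, and the last code on
    its right. *)
Definition interval_code b (x : R1) : nat := \max_(j < 4 ^ b | left_end b j <= x) j.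

Lemma left_end_mono b i j : (i <= j)%N -> left_end b i <= left_end b j.
Proof.
move=> /subnK<-; elim: (j - i)%N => // k IH.
by rewrite addSn /left_end big_ord_recr/= (le_trans IH)// lerDl.
Qed.

Lemma interval_code_lt b x : (interval_code b x < 4 ^ b)%N.
Proof.
rewrite /interval_code; elim/big_ind: _ => //; first by rewrite expn_gt0.
by move=> i j hi hj; rewrite gtn_max hi.
Qed.

(** The index [0] is excluded because of negative [x], which have code [0] but lie left of
    [left_end b 0]. *)
Lemma interval_codeP b x j : (0 < j < 4 ^ b)%N -> (left_end b j <= x) = (j <= interval_code b x)%N.
Proof.
move=> /andP[j0 jN]; apply/idP/idP => [jx|].
  exact: (@leq_bigmax_cond _ (fun j : 'I_(4 ^ b) => left_end b j <= x) _ (Ordinal jN)).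
rewrite /interval_code.
case: (pickP (fun i : 'I_(4 ^ b) => left_end b i <= x)) => [i0 i0x|none]; last first.
  by rewrite big_pred0// leqNgt j0.
have i0P : (0 < #|[pred i : 'I_(4 ^ b) | (left_end b i <= x)%R]|)%N.
  by apply/card_gt0P; exists i0.
have [i /= ix ->] := eq_bigmax_cond (fun i : 'I_(4 ^ b) => i : nat) i0P.
by move=> ji; rewrite (le_trans (left_end_mono _ ji)).
Qed.

Lemma left_end_coarsen b b' j : (b <= b')%N -> (j <= 4 ^ b)%N ->
  left_end b j = left_end b' (j * 4 ^ (b' - b)).
Proof.
move=> bb' jN; rewrite /left_end; set q := (4 ^ (b' - b))%N.
have q0 : (0 < q)%N by rewrite expn_gt0.
have jq : (j * q <= 4 ^ b')%N by rewrite -(subnKC bb') expnD leq_mul2r jN orbT.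
under eq_bigr do rewrite (m_coarsen _ bb').
rewrite (big_ord_widen _ (fun i => m b' i) jq) (exchange_big_dep xpredT)//=.
rewrite [RHS]big_mkcond; apply: eq_bigr => i _.
case: ltnP => iq.
  have ij : (i %/ q < j)%N by rewrite ltn_divLR.
  by rewrite (big_pred1 (Ordinal ij)).
rewrite big_pred0// => k; apply/negbTE; apply: contraTN iq => /eqP ik.
by rewrite -ltnNge -ltn_divLR// ik.
Qed.

(** Codes with a common prefix are consecutive, so the intervals are nested: threshold [j] of level
    [b] is threshold [j * q] of level [b'], and a code is determined by the thresholds below the
    point. *)
Lemma interval_code_coarsen b b' x : (b <= b')%N ->
  interval_code b x = (interval_code b' x %/ 4 ^ (b' - b))%N.
Proof.
move=> bb'; set q := (4 ^ (b' - b))%N.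
have q0 : (0 < q)%N by rewrite expn_gt0.
have N : (4 ^ b' = 4 ^ b * q)%N by rewrite -expnD subnKC.
have lt1 := interval_code_lt b x.
have lt2 : (interval_code b' x %/ q < 4 ^ b)%N by rewrite ltn_divLR// -N interval_code_lt.
have key j : (0 < j < 4 ^ b)%N ->
    (j <= interval_code b x)%N = (j <= interval_code b' x %/ q)%N.
  move=> /andP[j0 jN]; rewrite -interval_codeP ?j0// leq_divRL// -interval_codeP.
    by rewrite (left_end_coarsen bb')// ltnW.
  by rewrite muln_gt0 j0 q0 N ltn_mul2r q0.
apply/eqP; rewrite eqn_leq; apply/andP; split.
  have [->//|c0] := posnP (interval_code b x).
  by rewrite -key ?c0.
have [->//|c0] := posnP (interval_code b' x %/ q).
by rewrite key ?c0.
Qed.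

Let E b s := [set x : R1 | (s <= interval_code b x)%N].

Let EE b s : (0 < s < 4 ^ b)%N -> E b s = `[left_end b s, +oo[%classic.
Proof.
move=> sN; apply/seteqP; split => x /=; rewrite in_itv/= andbT interval_codeP//.
Qed.

Let E0 b : E b 0 = setT. Proof. by apply/seteqP; split. Qed.

Let Ebig b s : (4 ^ b <= s)%N -> E b s = set0.
Proof.
move=> Ns; apply/seteqP; split => // x /= h.
by have := interval_code_lt b x; rewrite ltnNge (leq_trans Ns h).
Qed.

Let mE b s : measurable (E b s).
Proof.
have [->|s0] := posnP s; first by rewrite E0.
have [sN|Ns] := ltnP s (4 ^ b); last by rewrite Ebig.
by rewrite EE ?s0//; exact: measurable_itv.
Qed.

Lemma left_end_01 b s : (s <= 4 ^ b)%N -> 0 <= left_end b s <= 1.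
Proof.
move=> sN; rewrite sumr_ge0//= -(sum_m b).
exact: (left_end_mono b sN).
Qed.

Let unit_E b s : (s <= 4 ^ b)%N -> unit_lebesgue (E b s) = (1 - left_end b s)%:E.
Proof.
move=> sN; have [->|s0] := posnP s.
  by rewrite E0 /left_end big_ord0 subr0 unit_lebesgue_setT.
move: sN; rewrite leq_eqVlt => /predU1P[->|sN].
  by rewrite Ebig// measure0 /left_end sum_m subrr.
rewrite EE ?s0// /unit_lebesgue /mrestr.
have /andP[l0 l1] := left_end_01 (ltnW sN).
have -> : `[left_end b s, +oo[%classic `&` `[0, 1]%classic = `[left_end b s, 1]%classic :> set R.
  apply/seteqP; split => x /=; rewrite !in_itv/=.
    by move=> [/andP[-> _] /andP[_ ->]].
  by move=> /andP[lx x1]; rewrite lx x1 (le_trans l0 lx).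
rewrite lebesgue_measure_itv/= lte_fin; case: ltP => h; first by rewrite EFinB.
by rewrite (_ : left_end b s = 1) ?subrr//; apply/eqP; rewrite eq_le l1 h.
Qed.

Lemma interval_codeE b s : [set x | interval_code b x = s] = E b s `\` E b s.+1.
Proof.
apply/seteqP; split => x /=; rewrite /E/=; first by move=> ->; rewrite leqnn ltnn.
by move=> [h1 /negP h2]; apply/eqP; rewrite eqn_leq h1 andbT leqNgt.
Qed.

Lemma measurable_interval_code b s : measurable [set x | interval_code b x = s].
Proof. by rewrite interval_codeE; exact: measurableD. Qed.

Lemma unit_interval_code b s : (s < 4 ^ b)%N ->
  unit_lebesgue [set x | interval_code b x = s] = (m b s)%:E.
Proof.
move=> sN; rewrite interval_codeE measureD//; last first.
  by rewrite (le_lt_trans (probability_le1 _ _))// ltry.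
rewrite setIidr; last by move=> x /=; exact: ltnW.
transitivity ((1 - left_end b s)%:E - (1 - left_end b s.+1)%:E)%E.
  by congr (_ - _)%E; apply: unit_E; rewrite // ltnW.
rewrite -EFinB; congr (_%:E).
by rewrite /left_end big_ord_recr/=; ring.
Qed.

Definition interval_ord b (x : R1) : 'I_(4 ^ b) := Ordinal (interval_code_lt b x).

Lemma interval_ord_fiber b (s : 'I_(4 ^ b)) :
  interval_ord b @^-1` [set s] = [set x | interval_code b x = s].
Proof.
apply/seteqP; split => x /=; first by move=> <-.
by move=> xs; apply/val_inj.
Qed.

Lemma measurable_interval_ord b (s : 'I_(4 ^ b)) : measurable (interval_ord b @^-1` [set s]).
Proof. by rewrite interval_ord_fiber; exact: measurable_interval_code. Qed.

Definition cube_code b n (x : n.-tuple R1) : {ffun 'I_n -> 'I_(4 ^ b)} :=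
  [ffun i => interval_ord b (tnth x i)].

Lemma cube_code_fiber b n (s : {ffun 'I_n -> 'I_(4 ^ b)}) :
  @cube_code b n @^-1` [set s] = box (fun i => interval_ord b @^-1` [set s i]).
Proof.
apply/seteqP; split => x /=; first by move=> <- i; rewrite /= ffunE.
by move=> h; apply/ffunP => i; rewrite ffunE h.
Qed.

Lemma measurable_cube_code b n (s : {ffun 'I_n -> 'I_(4 ^ b)}) :
  measurable (@cube_code b n @^-1` [set s]).
Proof.
by rewrite cube_code_fiber; apply: measurable_box => i; exact: measurable_interval_ord.
Qed.

Lemma integral_cube_code b n (h : {ffun 'I_n -> 'I_(4 ^ b)} -> R) :
  (\int[cube_lebesgue R n]_x (h (cube_code b x))%:E =
   (\sum_(s : {ffun 'I_n -> 'I_(4 ^ b)}) (\prod_i m b (s i)) * h s)%:E)%E.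
Proof.
rewrite (integral_finite_valued (cube_lebesgue R n) (@measurable_cube_code b n)); congr (_%:E).
apply: eq_bigr => s _; congr (_ * _); rewrite /fiber_weight cube_code_fiber.
rewrite cube_box/=; last by move=> i; exact: measurable_interval_ord.
by apply: eq_bigr => i _; rewrite interval_ord_fiber unit_interval_code.
Qed.

Definition square_code b (z : R1 * R1) : 'I_(4 ^ b) * 'I_(4 ^ b) :=
  (interval_ord b z.1, interval_ord b z.2).

Lemma square_code_fiber b s :
  square_code b @^-1` [set s] =
  (interval_ord b @^-1` [set s.1]) `*` (interval_ord b @^-1` [set s.2]).
Proof.
apply/seteqP; split => -[x y] /=; first by move=> <-.
by rewrite /square_code/= => -[-> ->]; rewrite -surjective_pairing.
Qed.

Lemma measurable_square_code b s : measurable (square_code b @^-1` [set s]).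
Proof.
by rewrite square_code_fiber; apply: measurableX; exact: measurable_interval_ord.
Qed.

Lemma integral_square_code b (h : nat -> nat -> R) :
  (\int[square_lebesgue R]_z (h (interval_code b z.1) (interval_code b z.2))%:E =
   (\sum_(s < 4 ^ b) \sum_(t < 4 ^ b) m b s * m b t * h s t)%:E)%E.
Proof.
have := integral_finite_valued (square_lebesgue R) (@measurable_square_code b)
  (fun s => h s.1 s.2).
rewrite /square_code/= => ->; congr (_%:E); rewrite pair_bigA/=.
apply: eq_bigr => -[s t] _ /=; congr (_ * _); rewrite /fiber_weight square_code_fiber.
rewrite square_lebesgue_rect/=; [|exact: measurable_interval_ord|exact: measurable_interval_ord].
by rewrite !interval_ord_fiber !unit_interval_code.
Qed.

Lemma measurable_square_step b (h : nat -> nat -> R) :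
  measurable_fun setT (fun z : R1 * R1 => h (interval_code b z.1) (interval_code b z.2)).
Proof. exact: (measurable_finite_valued (square_lebesgue R) (@measurable_square_code b) (fun s => h s.1 s.2)). Qed.

End interval_codes.

(** * Step kernels as a martingale *)

Section step_kernels.
Context {R : realType} {X : normedModType R}.
Local Notation R1 := (measurableTypeR R).
Local Notation sq := (square_lebesgue R).
Variables (m : nat -> nat -> R) (v : nat -> nat -> nat -> X) (M : nat -> R).
Hypothesis m_ge0 : forall b s, 0 <= m b s.
Hypothesis sum_m : forall b, \sum_(s < 4 ^ b) m b s = 1.
Hypothesis m_coarsen : forall b b' s, (b <= b')%N ->
  m b s = \sum_(i < 4 ^ b' | (i %/ 4 ^ (b' - b))%N == s) m b' i.
Hypothesis v_coarsen : forall b b' s t, (b <= b')%N ->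
  (m b s * m b t) *: v b s t = \sum_(i < 4 ^ b' | (i %/ 4 ^ (b' - b))%N == s)
    \sum_(j < 4 ^ b' | (j %/ 4 ^ (b' - b))%N == t) (m b' i * m b' j) *: v b' i j.
Hypothesis v_sym : forall b s t, v b s t = v b t s.
Hypothesis v_moments : forall b n,
  \sum_(s < 4 ^ b) \sum_(t < 4 ^ b) m b s * m b t * `|v b s t| ^+ n <= M n.

Definition step_kernel b (z : R1 * R1) : X :=
  v b (interval_code m b z.1) (interval_code m b z.2).

Lemma step_kernel_sym b x y : step_kernel b (x, y) = step_kernel b (y, x).
Proof. exact: v_sym. Qed.

Lemma measurable_step_kernel b (h : X -> R) :
  measurable_fun setT (h \o step_kernel b).
Proof. exact: (measurable_square_step m_ge0 b (fun s t => h (v b s t))). Qed.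

(** Both kernels are functions of the finer pair of codes, which takes finitely many values; this
    allows an arbitrary [h]. *)
Lemma measurable_step_kernel2 b b' (h : X -> X -> R) :
  measurable_fun setT (fun z => h (step_kernel b z) (step_kernel b' z)).
Proof.
wlog bb' : b b' h / (b <= b')%N => [hw|].
  have [|/ltnW] := leqP b b'; first exact: hw.
  exact: (hw b' b (fun x y => h y x)).
rewrite (_ : (fun z => _) = (fun z => h
  (v b (interval_code m b' z.1 %/ 4 ^ (b' - b)) (interval_code m b' z.2 %/ 4 ^ (b' - b)))
  (v b' (interval_code m b' z.1) (interval_code m b' z.2)))).
  exact: (measurable_square_step m_ge0 b' (fun s t =>
    h (v b (s %/ 4 ^ (b' - b)) (t %/ 4 ^ (b' - b))) (v b' s t))).
by apply/funext => z; rewrite /step_kernel !(interval_code_coarsen m_ge0 m_coarsen _ bb').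
Qed.

Lemma integral_step_kernel b (h : X -> R) :
  (\int[sq]_z (h (step_kernel b z))%:E =
   (\sum_(s < 4 ^ b) \sum_(t < 4 ^ b) m b s * m b t * h (v b s t))%:E)%E.
Proof. exact: (integral_square_code m_ge0 sum_m b (fun s t => h (v b s t))). Qed.

Lemma integral_step_kernel_exp b n :
  (\int[sq]_z (`|step_kernel b z| ^+ n)%:E <= (M n)%:E)%E.
Proof. by rewrite (integral_step_kernel b (fun x => `|x| ^+ n)) lee_fin. Qed.

Definition step_energy (psi : dual X) b : R :=
  \sum_(s < 4 ^ b) \sum_(t < 4 ^ b) m b s * m b t * psi (v b s t) ^+ 2.

Lemma sum_coarsen b b' (f : nat -> nat -> R) (g : nat -> nat -> R) : (b <= b')%N ->
  \sum_(i < 4 ^ b') \sum_(j < 4 ^ b')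
    f i j * g (i %/ 4 ^ (b' - b))%N (j %/ 4 ^ (b' - b))%N =
  \sum_(s < 4 ^ b) \sum_(t < 4 ^ b) g s t *
    \sum_(i < 4 ^ b' | (i %/ 4 ^ (b' - b))%N == s)
      \sum_(j < 4 ^ b' | (j %/ 4 ^ (b' - b))%N == t) f i j.
Proof.
move=> bb'; set q := (4 ^ (b' - b))%N.
have ltq (i : 'I_(4 ^ b')) : (i %/ q < 4 ^ b)%N.
  by rewrite ltn_divLR ?expn_gt0// /q -expnD subnKC.
have part (F : nat -> nat -> R) : \sum_(i < 4 ^ b') F (i %/ q)%N i =
    \sum_(s < 4 ^ b) \sum_(i < 4 ^ b' | (i %/ q)%N == s) F s i.
  rewrite (partition_big (fun i => Ordinal (ltq i)) xpredT)//=.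
  apply: eq_bigr => s _; apply: eq_big => [i|i /eqP <-//].
  by rewrite -val_eqE.
under eq_bigr => i _.
  rewrite (part (fun t j => f i j * g (i %/ q)%N t)).
  over.
rewrite (part (fun s i => \sum_(t < 4 ^ b) \sum_(j < 4 ^ b' | (j %/ q)%N == t)
  f i j * g s t)).
apply: eq_bigr => s _; rewrite exchange_big/=; apply: eq_bigr => t _.
rewrite mulr_sumr; apply: eq_bigr => i _; rewrite mulr_sumr; apply: eq_bigr => j _.
by rewrite mulrC.
Qed.

(** Orthogonality of martingale increments as an identity of finite sums: by [v_coarsen], a coarse
    value is the weighted average of the fine values under it. *)
Lemma step_energy_diff (psi : dual X) b b' : (b <= b')%N ->
  \sum_(i < 4 ^ b') \sum_(j < 4 ^ b') m b' i * m b' j *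
    (psi (v b' i j) - psi (v b (i %/ 4 ^ (b' - b)) (j %/ 4 ^ (b' - b)))) ^+ 2 =
  step_energy psi b' - step_energy psi b.
Proof.
move=> bb'; set q := (4 ^ (b' - b))%N.
have e1 : \sum_(i < 4 ^ b') \sum_(j < 4 ^ b')
    (m b' i * m b' j * psi (v b' i j)) * psi (v b (i %/ q) (j %/ q)) = step_energy psi b.
  rewrite (sum_coarsen (fun i j => m b' i * m b' j * psi (v b' i j))
    (fun s t => psi (v b s t)) bb').
  apply: eq_bigr => s _; apply: eq_bigr => t _.
  have := congr1 psi (v_coarsen s t bb'); rewrite dual_scale dual_sum.
  under eq_bigr do rewrite dual_sum; move=> e.
  transitivity (psi (v b s t) * (m b s * m b t * psi (v b s t))); last by ring.
  rewrite e; congr (_ * _); apply: eq_bigr => i _; apply: eq_bigr => j _.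
  by rewrite dual_scale.
have e2 : \sum_(i < 4 ^ b') \sum_(j < 4 ^ b')
    (m b' i * m b' j) * psi (v b (i %/ q) (j %/ q)) ^+ 2 = step_energy psi b.
  rewrite (sum_coarsen (fun i j => m b' i * m b' j)
    (fun s t => psi (v b s t) ^+ 2) bb').
  apply: eq_bigr => s _; apply: eq_bigr => t _; rewrite mulrC; congr (_ * _).
  rewrite (m_coarsen _ bb') [in RHS](m_coarsen _ bb') mulr_suml.
  by apply: eq_bigr => i _; rewrite mulr_sumr.
transitivity (step_energy psi b' - 2 * (\sum_(i < 4 ^ b') \sum_(j < 4 ^ b')
    (m b' i * m b' j * psi (v b' i j)) * psi (v b (i %/ q) (j %/ q))) +
    \sum_(i < 4 ^ b') \sum_(j < 4 ^ b')
    (m b' i * m b' j) * psi (v b (i %/ q) (j %/ q)) ^+ 2); last by rewrite e1 e2; ring.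
rewrite /step_energy mulr_sumr -sumrN -!big_split/=; apply: eq_bigr => i _.
rewrite mulr_sumr -sumrN -!big_split/=; apply: eq_bigr => j _; ring.
Qed.

Lemma step_energy_mono (psi : dual X) b b' : (b <= b')%N ->
  step_energy psi b <= step_energy psi b'.
Proof.
move=> bb'; rewrite -subr_ge0 -(step_energy_diff _ bb'); apply: sumr_ge0 => i _.
by apply: sumr_ge0 => j _; apply: mulr_ge0; [exact: mulr_ge0|exact: sqr_ge0].
Qed.

Lemma step_energy_le (psi : dual X) b : step_energy psi b <= `|psi| ^+ 2 * M 2.
Proof.
rewrite (le_trans _ (ler_wpM2l (sqr_ge0 `|psi|) (v_moments b 2)))//.
rewrite mulr_sumr; apply: ler_sum => s _; rewrite mulr_sumr; apply: ler_sum => t _.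
rewrite [leRHS]mulrCA ler_wpM2l ?mulr_ge0// -exprMn -[leLHS]real_normK ?num_real//.
by rewrite lerXn2r ?nnegrE ?mulr_ge0// dual_le.
Qed.

Definition step_dist (psi : dual X) b b' : \bar R :=
  (\int[sq]_z (`|psi (step_kernel b' z) - psi (step_kernel b z)|)%:E)%E.

Lemma step_dist_le (psi : dual X) b b' (K : R) : (b <= b')%N -> 0 < K ->
  (step_dist psi b b' <= (K + (step_energy psi b' - step_energy psi b) / K)%:E)%E.
Proof.
move=> bb' K0; rewrite /step_dist; set q := (4 ^ (b' - b))%N.
have -> : (fun z => (`|psi (step_kernel b' z) - psi (step_kernel b z)|)%:E) =
  (fun z => ((fun s t => `|psi (v b' s t) - psi (v b (s %/ q)%N (t %/ q)%N)|)
    (interval_code m b' z.1) (interval_code m b' z.2))%:E).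
  apply/funext => z /=; rewrite /step_kernel.
  by rewrite !(interval_code_coarsen m_ge0 m_coarsen _ bb').
rewrite (integral_square_code m_ge0 sum_m b'
  (fun s t => `|psi (v b' s t) - psi (v b (s %/ q)%N (t %/ q)%N)|)).
rewrite lee_fin -(step_energy_diff _ bb') -/q.
have e1 : \sum_(s < 4 ^ b') \sum_(t < 4 ^ b') m b' s * m b' t = 1.
  rewrite -[RHS](sum_m b'); apply: eq_bigr => s _; rewrite -mulr_sumr sum_m.
  by rewrite mulr1.
rewrite -[X in X + _]mulr1 -{1}e1 mulr_sumr mulr_suml -big_split/=; apply: ler_sum => s _.
rewrite mulr_sumr mulr_suml -big_split/=; apply: ler_sum => t _.
rewrite (mulrC K) -[X in _ <= _ + X]mulrA -mulrDr ler_wpM2l ?mulr_ge0//.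
exact: young.
Qed.

Lemma step_distC psi b b' : step_dist psi b b' = step_dist psi b' b.
Proof. by apply: eq_integral => z _; rewrite distrC. Qed.

Lemma step_dist_cauchy (psi : dual X) (e : R) : 0 < e ->
  exists N, forall b b', (N <= b)%N -> (N <= b')%N -> (step_dist psi b b' <= e%:E)%E.
Proof.
move=> e0; pose S := range (step_energy psi).
have hS : has_sup S.
  split; first by exists (step_energy psi 0), 0%N.
  by exists (`|psi| ^+ 2 * M 2) => _ [b _ <-]; exact: step_energy_le.
(* Past an index within [(e / 2) ^+ 2] of the supremum of the energies, the bound of [step_dist_le]
   with [K = e / 2] is at most [e]. *)
have d0 : 0 < (e / 2) ^+ 2 by rewrite exprn_gt0// divr_gt0.
have [_ [N _ <-] hN] := sup_adherent d0 hS.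
have Sup b : step_energy psi b <= sup S by apply: sup_upper_bound => //; exists b.
exists N; suff h b b' : (N <= b)%N -> (b <= b')%N -> (step_dist psi b b' <= e%:E)%E.
  move=> b b' Nb Nb'; have [bb'|/ltnW b'b] := leqP b b'; first exact: h.
  by rewrite step_distC; exact: h.
move=> Nb bb'; have e2 : 0 < e / 2 by rewrite divr_gt0.
rewrite (le_trans (step_dist_le _ bb' e2))// lee_fin [leRHS](splitr e) lerD2l ler_pdivrMr//.
rewrite -expr2; have := Sup b'; have := step_energy_mono psi Nb; lra.
Qed.

End step_kernels.

(** * Weak limits of martingales *)

Section ereal_sequences.
Context {R : realType}.
Implicit Types (u : nat -> \bar R).

Lemma limn_einf_lt u (a : \bar R) n : (limn_einf u < a)%E ->
  exists2 j, (n <= j)%N & (u j < a)%E.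
Proof.
rewrite limn_einf_lim => h.
have : (einfs u n < a)%E.
  rewrite (le_lt_trans _ h)//; apply: lime_ge; first exact: is_cvg_einfs.
  by exists n => // k /= nk; exact: nondecreasing_einfs.
by move=> /ereal_inf_lt[_ [j /= nj <-] ja]; exists j.
Qed.

Lemma limn_einf_le u (a : \bar R) N : (forall j, (N <= j)%N -> (u j <= a)%E) ->
  (limn_einf u <= a)%E.
Proof.
move=> ua; rewrite limn_einf_lim; apply: lime_le; first exact: is_cvg_einfs.
exists N => // k /= Nk; rewrite (le_trans _ (ua k Nk))//.
by apply: ereal_inf_lbound; exists k => /=.
Qed.

Lemma limn_einf_ge u (a : \bar R) : (forall j, (a <= u j)%E) -> (a <= limn_einf u)%E.
Proof.
move=> ua; rewrite limn_einf_lim; apply: lime_ge; first exact: is_cvg_einfs.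
by apply: nearW => n; apply: le_ereal_inf_tmp => _ [j _ <-].
Qed.

Lemma measurable_limn_einf d (T : measurableType d) (f : nat -> T -> \bar R) :
  (forall n, measurable_fun setT (f n)) ->
  measurable_fun setT (fun z => limn_einf (f ^~ z)).
Proof.
move=> mf; rewrite (_ : (fun z => _) =
    (fun z => - limn_esup (fun n => - f n z))%E); last first.
  by apply/funext => z; rewrite -limn_einfN; congr limn_einf; apply/funext => n /=;
    rewrite oppeK.
apply: measurableT_comp => //.
apply: (@measurable_fun_limn_esup _ _ _ _ (fun n z => - f n z)%E) => n.
exact: measurableT_comp.
Qed.

Lemma cvg_summable_increments (a : nat -> R) :
  (\sum_(0 <= j <oo) (`|a j.+1 - a j|)%:E < +oo)%E -> cvgn a.
Proof.
set S := (X in (X < _)%E) => Soo.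
have S0 : (0 <= S)%E by apply: nneseries_ge0 => n _ _; rewrite lee_fin.
have cs : cvgn [normed series (telescope a)].
  apply: nondecreasing_is_cvgn.
    by apply: nondecreasing_series => n _ _; rewrite normr_ge0.
  exists (fine S) => _ [n _ <-]; rewrite -lee_fin fineK ?ge0_fin_numE//.
  change ((\sum_(0 <= k < n) `|telescope a k|)%:E <= S)%E; rewrite -sumEFin.
  by apply: nneseries_lim_ge => i _ _; rewrite lee_fin.
have := @normed_cvg _ R^o _ cs; rewrite telescopeK => h.
have {}h : cvgn (fun n => (a n - a 0%N) + a 0%N) by apply: is_cvgD => //; exact: is_cvg_cst.
by move: h; under eq_fun do rewrite subrK.
Qed.

End ereal_sequences.

(** * The almost everywhere weak limit *)

Section limit_function.
Context d (T : measurableType d) (R : realType) (P : probability T R).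
Context {X : normedModType R}.
Hypothesis X_refl : reflexive_space X.
Variables (u : nat -> T -> X) (phi : nat -> dual X) (M : nat -> R).
Hypothesis phi_dense : forall (psi : dual X) (e : R), 0 < e -> exists k, `|psi - phi k| < e.
Hypothesis mu1 : forall j (h : X -> R), measurable_fun setT (h \o u j).
Hypothesis mu2 : forall i j (h : X -> X -> R), measurable_fun setT (fun z => h (u i z) (u j z)).
Hypothesis u_moments : forall j n, (\int[P]_z (`|u j z| ^+ n)%:E <= (M n)%:E)%E.
Hypothesis u_summable : forall k,
  (\sum_(0 <= j <oo) \int[P]_z (`|phi k (u j.+1 z) - phi k (u j z)|)%:E < +oo)%E.
Hypothesis u_cauchy : forall (psi : dual X) (e : R), 0 < e -> exists N, forall i j,
  (N <= i)%N -> (N <= j)%N -> (\int[P]_z (`|psi (u j z) - psi (u i z)|)%:E <= e%:E)%E.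

Lemma dense_sep (x y : X) : (forall k, phi k x = phi k y) -> x = y.
Proof.
move=> h; apply/eqP; rewrite -subr_eq0 -normr_le0; apply/ler_addgt0Pl => e e0.
rewrite addr0; apply: le_norm_dual => psi _.
have d0 : 0 < e / (`|x - y| + 1) by rewrite divr_gt0// ltr_wpDl.
have [k hk] := phi_dense psi d0.
have -> : psi (x - y) = (psi - phi k) (x - y).
  rewrite -[RHS]/(psi (x - y) - phi k (x - y)) [phi k _]dualB h.
  by rewrite subrr subr0.
rewrite (le_trans (ler_norm _))// (le_trans (dual_le _ _))//.
rewrite (@le_trans _ _ (e / (`|x - y| + 1) * `|x - y|)) ?ler_wpM2r ?(ltW hk)//.
by rewrite mulrAC ler_pdivrMr ?ltr_wpDl// ler_wpM2l ?(ltW e0)// lerDl.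
Qed.

Let incr k z : \bar R := (\sum_(0 <= j <oo) (`|phi k (u j.+1 z) - phi k (u j z)|)%:E)%E.
Let linf z : \bar R := limn_einf (fun j => (`|u j z|)%:E).

(** Summable increments make each [phi k (u j z)] converge along the whole sequence, and a finite
    lower limit of the norms supplies a bounded subsequence with a weak cluster point; together
    these replace a bound on all the norms at [z]. *)
Definition good_points : set T :=
  [set z | (forall k, (incr k z < +oo)%E) /\ (linf z < +oo)%E].

Let m_incr_term k j : measurable_fun setT (fun z => (`|phi k (u j.+1 z) - phi k (u j z)|)%:E).
Proof. by apply/measurable_EFinP; exact: (mu2 j.+1 j (fun x y => `|phi k x - phi k y|)). Qed.

Let m_incr k : measurable_fun setT (incr k).
Proof. by apply: ge0_emeasurable_sum => // *; rewrite ?lee_fin. Qed.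

Let m_linf : measurable_fun setT linf.
Proof. by apply: measurable_limn_einf => j; apply/measurable_EFinP; exact: (mu1 j). Qed.

Let linf_ge0 z : (0 <= linf z)%E.
Proof. by apply: limn_einf_ge => j; rewrite lee_fin. Qed.

Let incr_ge0 k z : (0 <= incr k z)%E.
Proof. by apply: nneseries_ge0 => *; rewrite lee_fin. Qed.

Lemma measurable_good_points : measurable good_points.
Proof.
have mlt (f : T -> \bar R) : measurable_fun setT f -> measurable [set z | (f z < +oo)%E].
  move=> mf; rewrite -[X in measurable X]setTI.
  exact: (emeasurable_fun_infty_o _ mf).
rewrite (_ : good_points = (\bigcap_k [set z | (incr k z < +oo)%E]) `&`
    [set z | (linf z < +oo)%E]).
  by apply: measurableI; [apply: bigcapT_measurable => k|]; exact: mlt.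
apply/seteqP; split => z [h1 h2]; split => // k; last exact: h1.
by move=> _; exact: h1.
Qed.

Let ae_lty (f : T -> \bar R) : measurable_fun setT f -> (forall z, 0 <= f z)%E ->
  (\int[P]_z f z < +oo)%E -> {ae P, forall z, (f z < +oo)%E}.
Proof.
move=> mf f0 foo.
have fi : P.-integrable setT f.
  apply/integrableP; split => //.
  by under eq_integral => z _ do rewrite gee0_abs//.
have := integrable_ae measurableT fi; apply: filterS => z /(_ I).
by rewrite ge0_fin_numE.
Qed.

Lemma ae_good_points : {ae P, forall z, good_points z}.
Proof.
have h1 : {ae P, forall z, forall k, (incr k z < +oo)%E}.
  apply/ae_foralln => k; apply: ae_lty => //.
  by rewrite /incr integral_nneseries//; move=> *; rewrite ?lee_fin.
have h2 : {ae P, forall z, (linf z < +oo)%E}.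
  apply: ae_lty => //.
  rewrite (@le_lt_trans _ _ (M 1)%:E) ?ltry//.
  rewrite (le_trans (fatou P measurableT _ _))//.
  - by move=> j; apply/measurable_EFinP; exact: (mu1 j).
  - apply: (@limn_einf_le _ _ _ 0%N) => j _; rewrite (le_trans _ (u_moments j 1))//.
by apply: filterS2 h1 h2 => z a b; split.
Qed.

Definition weak_limit z : X :=
  if `[< good_points z >] then
    xget 0 [set w | forall k, phi k (u j z) @[j --> \oo] --> phi k w]
  else 0.

(** The definition, choice operator included, sees [z] only through the sequence, so the symmetry of
    the kernels passes to the limit at every point. *)
Lemma eq_weak_limit z z' : u^~ z = u^~ z' -> weak_limit z = weak_limit z'.
Proof.
exact: (congr1 (fun s : nat -> X => if `[< (forall k,
    (\sum_(0 <= j <oo) (`|phi k (s j.+1) - phi k (s j)|)%:E < +oo)%E) /\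
    (limn_einf (fun j => (`|s j|)%:E) < +oo)%E >]
  then xget 0 [set w | forall k, phi k (s j) @[j --> \oo] --> phi k w] else 0)).
Qed.

(* A subsequence along which [`|u j z| ^+ n <= a] has a weak cluster point,
   which the functionals [phi k] identify with [weak_limit z]. *)
Let subsequence_limit z n (a : R) : good_points z -> (0 < n)%N ->
  (forall i, exists2 j, (i <= j)%N & `|u j z| ^+ n <= a) ->
  exists2 w, (forall k, phi k (u j z) @[j --> \oo] --> phi k w) & `|w| ^+ n <= a.
Proof.
move=> [gi _] n0 h.
have /choice[s sP] i : exists j, (i <= j)%N /\ `|u j z| ^+ n <= a.
  by have [j ? ?] := h i; exists j.
have a0 : 0 <= a by rewrite (le_trans _ (sP 0%N).2)// exprn_ge0.
(* A norm above one is at most any of its positive powers. *)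
have sb i : `|u (s i) z| <= 1 + a.
  have [x1|/ltW x1] := leP `|u (s i) z| 1; first by rewrite ler_wpDr.
  rewrite ler_wpDl// (le_trans _ (sP i).2)//; case: n n0 {sP h} => // n _.
  by rewrite exprS ler_peMr// exprn_ege1.
have [U [UU oU]] := ultraFilterLemma (@eventually_filter).
have [w wP] := reflexive_lim UU X_refl sb.
exists w => [k|].
  have ck : cvgn (fun j => phi k (u j z)) by exact/cvg_summable_increments/gi.
  suff -> : phi k w = limn (fun j => phi k (u j z)) by [].
  apply: (cvgF_unique (wP (phi k))) => //.
  apply: cvg_ultra_lim => //; apply/cvgF_normP => e e0.
  have [N _ NP] := (cvgF_normP _ _).2 ck e e0.
  exists N => // i /= Ni; apply: NP => /=; exact: leq_trans Ni (sP i).1.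
have [psi p1 pw] := norming_functional w; rewrite -pw.
apply: (@cvgF_le _ _ U _ (fun i => psi (u (s i) z) ^+ n)) => [|i].
  by apply: cvg_exprF; exact: wP.
rewrite (le_trans (ler_norm _))// normrX (le_trans _ (sP i).2)//.
rewrite lerXn2r ?nnegrE// (le_trans (dual_le _ _))// ler_piMl//.
Qed.

Lemma weak_limitP z : good_points z ->
  forall k, phi k (u j z) @[j --> \oo] --> phi k (weak_limit z).
Proof.
move=> gz; rewrite /weak_limit asboolT//; apply: (@xgetPex _ 0
  [set w | forall k, phi k (u j z) @[j --> \oo] --> phi k w]).
have lfin : linf z \is a fin_num by rewrite ge0_fin_numE//; exact: gz.2.
have [|w wP _] := @subsequence_limit z 1 (fine (linf z) + 1) gz isT.
  move=> i; have [|j ij uj] := @limn_einf_lt R (fun j => (`|u j z|)%:E) (fine (linf z) + 1)%:E i.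
    by rewrite -/(linf z) EFinD fineK// -{1}(adde0 (linf z)) lteD2lE// lte_fin.
  by exists j => //; rewrite ltW.
by exists w.
Qed.

(** Otherwise a level [a] strictly between the two sides is undercut along a subsequence, whose weak
    limit has a smaller norm although the dense functionals identify it with [weak_limit z]. *)
Lemma weak_limit_exp_le z n : good_points z -> (0 < n)%N ->
  ((`|weak_limit z| ^+ n)%:E <= limn_einf (fun j => (`|u j z| ^+ n)%:E))%E.
Proof.
move=> gz n0; rewrite leNgt; apply/negP => lt.
set l := limn_einf _ in lt.
have l0 : (0 <= l)%E by apply: limn_einf_ge => j; rewrite lee_fin exprn_ge0.
have lfin : l \is a fin_num by rewrite ge0_fin_numE// (lt_trans lt)// ltry.
pose a := (fine l + `|weak_limit z| ^+ n) / 2.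
have ll : fine l < `|weak_limit z| ^+ n by rewrite -lte_fin fineK.
have [|w wP wa] := @subsequence_limit z n a gz n0.
  move=> i; have [|j ij uj] := @limn_einf_lt R (fun j => (`|u j z| ^+ n)%:E) a%:E i.
    by rewrite -/l -(fineK lfin) lte_fin /a; lra.
  by exists j => //; rewrite ltW.
suff ww : weak_limit z = w by move: wa; rewrite -ww /a; lra.
apply: dense_sep => k.
by apply: (@cvgF_unique _ _ \oo _ (fun j => phi k (u j z))); [exact: weak_limitP|exact: wP].
Qed.

Lemma weak_limit_bad z : ~ good_points z -> weak_limit z = 0.
Proof. by move=> bz; rewrite /weak_limit asboolF. Qed.

Let m_phi_weak_limit k : measurable_fun setT (phi k \o weak_limit).
Proof.
apply: (@measurable_fun_cvg _ _ _ _ (fun j z => \1_good_points z * phi k (u j z))) => [j|z _].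
  apply: measurable_funM; last exact: (mu1 j (phi k)).
  exact/measurable_indic/measurable_good_points.
have [gz|bz] := pselect (good_points z).
  rewrite indicE mem_set//; under eq_fun do rewrite mul1r; exact: weak_limitP.
rewrite indicE memNset//= weak_limit_bad// dual0; under eq_fun do rewrite mul0r.
exact: cvg_cst.
Qed.

Lemma measurable_dual_weak_limit (psi : dual X) : measurable_fun setT (psi \o weak_limit).
Proof.
have /choice[k kP] n : exists k, `|psi - phi k| < n.+1%:R^-1.
  by apply: phi_dense; rewrite invr_gt0.
apply: (@measurable_fun_cvg _ _ _ _ (fun n z => phi (k n) (weak_limit z))) => [n|z _].
  exact: m_phi_weak_limit.
apply/cvgF_normP => e e0; exists (Num.bound (`|weak_limit z| / e)) => // n /= Nn.
rewrite -[_ - _]/((psi - phi (k n)) (weak_limit z)) (le_trans (dual_le _ _))//.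
rewrite (le_trans (ler_wpM2r _ (ltW (kP n))))// mulrC ler_pdivrMr// mulrC -ler_pdivrMr//.
have h0 : 0 <= `|weak_limit z| / e by rewrite divr_ge0// ltW.
rewrite (le_trans (ltW (archi_boundP h0)))// ler_nat; exact: leqW.
Qed.

Variable y : nat -> X.
Hypothesis y_dense : forall (x : X) (e : R), 0 < e -> exists n, `|x - y n| < e.

(** The norm is the supremum of the countably many functionals norming a dense sequence of vectors,
    which reduces its measurability to that of scalar images. *)
Lemma measurable_norm_weak_limit (x : X) :
  measurable_fun setT (fun z => `|weak_limit z - x|).
Proof.
have /choice[psi psiP] n : exists psi : dual X, `|psi| <= 1 /\ psi (y n) = `|y n|.
  by have [psi ? ?] := norming_functional (y n); exists psi.
have psi_le n (w : X) : psi n w <= `|w|.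
  by rewrite (le_trans (ler_norm _))// (le_trans (dual_le _ _))// ler_piMl// (psiP n).1.
pose h n z := psi n (weak_limit z - x).
have hub z : has_ubound (range (h ^~ z)).
  by exists `|weak_limit z - x| => _ [n _ <-]; exact: psi_le.
rewrite (_ : (fun z => _) = fun z => sups (h ^~ z) 0).
  apply: measurable_fun_sups => [z _|n]; first exact: hub.
  rewrite (_ : h n = (psi n \o weak_limit) \- cst (psi n x)).
    by apply: measurable_funB => //; exact: measurable_dual_weak_limit.
  by apply/funext => z; rewrite /h dualB.
apply/funext => z; set w := weak_limit z - x.
have hs : has_sup (sdrop (h ^~ z) 0).
  split; first by exists (h 0%N z), 0%N.
  by exists `|w| => _ [n _ <-]; exact: psi_le.
apply/eqP; rewrite eq_le; apply/andP; split; last first.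
  by apply: ge_sup; [exact: hs.1|move=> _ [n _ <-]; exact: psi_le].
apply/ler_addgt0Pl => e e0; have e2 : 0 < e / 2 by rewrite divr_gt0.
have [n hn] := y_dense w e2.
have : psi n w <= sups (h ^~ z) 0 by apply: sup_upper_bound => //; exists n.
have : `|w| <= `|w - y n| + `|y n| by rewrite -{1}(subrK (y n) w) ler_normD.
have := psi_le n (y n - w); rewrite dualB (psiP n).2 distrC; lra.
Qed.

Lemma weak_limit_moments n : (0 < n)%N ->
  (\int[P]_z (`|weak_limit z| ^+ n)%:E <= (M n)%:E)%E.
Proof.
move=> n0; rewrite (@le_trans _ _ (\int[P]_z limn_einf (fun j => (`|u j z| ^+ n)%:E))%E)//.
  apply: ge0_le_integral => //.
  - apply/measurable_EFinP; apply: measurable_funX.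
    by have := measurable_norm_weak_limit 0; under eq_fun do rewrite subr0.
  - apply: measurable_limn_einf => j; apply/measurable_EFinP.
    exact: (mu1 j (fun x => `|x| ^+ n)).
  - move=> z _; have [gz|bz] := pselect (good_points z); first exact: weak_limit_exp_le.
    rewrite weak_limit_bad// normr0 expr0n gtn_eqF//=.
    by apply: limn_einf_ge => j; rewrite lee_fin exprn_ge0.
rewrite (le_trans (fatou P measurableT _ _))//.
- move=> j; apply/measurable_EFinP; exact: (mu1 j (fun x => `|x| ^+ n)).
- by apply: (@limn_einf_le _ _ _ 0%N) => j _; exact: u_moments.
Qed.

(** Fatou's lemma in the second index of the Cauchy bound. *)
Let L1_phi k (e : R) : 0 < e -> exists N, forall j, (N <= j)%N ->
  (\int[P]_z (`|phi k (u j z) - phi k (weak_limit z)|)%:E <= e%:E)%E.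
Proof.
move=> e0; have [N NP] := u_cauchy (phi k) e0; exists N => j Nj.
rewrite (@le_trans _ _ (\int[P]_z limn_einf (fun i => (`|phi k (u j z) - phi k (u i z)|)%:E))%E)//.
  apply: ae_ge0_le_integral => //.
  - apply/measurable_EFinP; apply: measurableT_comp => //.
    by apply: measurable_funB; [exact: (mu1 j (phi k))|exact: measurable_dual_weak_limit].
  - by move=> z _; apply: limn_einf_ge => i; rewrite lee_fin.
  - apply: measurable_limn_einf => i; apply/measurable_EFinP.
    exact: (mu2 j i (fun x x' => `|phi k x - phi k x'|)).
  apply: filterS ae_good_points => z gz _.
  have h : (fun i => (`|phi k (u j z) - phi k (u i z)|)%:E) @ \oo -->
      (`|phi k (u j z) - phi k (weak_limit z)|)%:E.
    apply: cvg_EFin; first exact: nearW.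
    apply: (@cvg_norm _ R^o); apply: cvgB; first exact: cvg_cst.
    exact: weak_limitP.
  have hc : cvgn (fun i => (`|phi k (u j z) - phi k (u i z)|)%:E) by apply/cvg_ex; eexists; exact: h.
  by rewrite (is_cvg_limn_einfE hc) (cvg_lim _ h).
rewrite (le_trans (fatou P measurableT _ _))//.
- move=> i; apply/measurable_EFinP; exact: (mu2 j i (fun x x' => `|phi k x - phi k x'|)).
- by apply: (@limn_einf_le _ _ _ N) => i Ni; exact: NP.
Qed.

Let M1_ge0 : 0 <= M 1.
Proof.
rewrite -lee_fin (le_trans _ (u_moments 0 1))//; apply: integral_ge0 => z _.
by rewrite lee_fin.
Qed.

Lemma weak_limit_L1 (psi : dual X) (e : R) : 0 < e -> exists N, forall j, (N <= j)%N ->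
  (\int[P]_z (`|psi (u j z) - psi (weak_limit z)|)%:E <= e%:E)%E.
Proof.
(* [M 1] bounds the first moments of [u j] and of the limit, hence the 2; the added one keeps the
   divisor positive. *)
move=> e0; pose dl := e / 2 / (2 * (M 1 + 1)).
have M10 : 0 < M 1 + 1 by rewrite ltr_wpDl.
have d0 : 0 < dl by rewrite divr_gt0 ?divr_gt0// mulr_gt0.
have [k hk] := phi_dense psi d0.
have [|N NP] := @L1_phi k (e / 2); first by rewrite divr_gt0.
exists N => j Nj.
have mW : measurable_fun setT (fun z => `|weak_limit z|).
  by have := measurable_norm_weak_limit 0; under eq_fun do rewrite subr0.
have mW1 : (\int[P]_z (`|weak_limit z|)%:E <= (M 1)%:E)%E by exact: (weak_limit_moments (n := 1)).
have mu1' : measurable_fun setT (fun z => `|u j z|) by exact: (mu1 j (fun x => `|x|)).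
have mk : measurable_fun setT (fun z => `|phi k (u j z) - phi k (weak_limit z)|).
  apply: measurableT_comp => //.
  by apply: measurable_funB; [exact: (mu1 j (phi k))|exact: measurable_dual_weak_limit].
rewrite (@le_trans _ _ (\int[P]_z ((`|phi k (u j z) - phi k (weak_limit z)|)%:E +
    dl%:E * ((`|u j z|)%:E + (`|weak_limit z|)%:E)))%E)//.
  apply: ge0_le_integral => //.
  - apply/measurable_EFinP; apply: measurableT_comp => //.
    by apply: measurable_funB; [exact: (mu1 j psi)|exact: measurable_dual_weak_limit].
  - apply: emeasurable_funD; first exact/measurable_EFinP.
    apply: measurable_funeM; apply: emeasurable_funD; exact/measurable_EFinP.
  - move=> z _; rewrite -[X in (_ + dl%:E * X)%E]EFinD -EFinM -EFinD lee_fin.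
    have -> : psi (u j z) - psi (weak_limit z) = (phi k (u j z) - phi k (weak_limit z)) +
        ((psi - phi k) (u j z) - (psi - phi k) (weak_limit z)).
      rewrite -[(psi - phi k) (u j z)]/(psi (u j z) - phi k (u j z)).
      by rewrite -[(psi - phi k) (weak_limit z)]/(psi (weak_limit z) - phi k (weak_limit z)); ring.
    rewrite (le_trans (ler_normD _ _))// lerD2l (le_trans (ler_normB _ _))// mulrDr.
    by rewrite lerD// (le_trans (dual_le _ _))// ler_wpM2r// ltW.
rewrite ge0_integralD//; first last.
- apply: measurable_funeM; apply: emeasurable_funD; exact/measurable_EFinP.
- by move=> z _; rewrite -[X in (dl%:E * X)%E]EFinD -EFinM lee_fin mulr_ge0 ?(ltW d0)// addr_ge0.
- exact/measurable_EFinP.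
rewrite ge0_integralZl_EFin ?(ltW d0)//; first last.
- apply: emeasurable_funD; exact/measurable_EFinP.
- by move=> z _; rewrite -EFinD lee_fin addr_ge0.
rewrite ge0_integralD//; [|exact/measurable_EFinP|exact/measurable_EFinP].
rewrite (splitr e) EFinD leeD ?NP//.
have u1 := u_moments j 1.
rewrite (@le_trans _ _ (dl%:E * ((M 1)%:E + (M 1)%:E))%E)//.
  by rewrite lee_wpmul2l ?lee_fin ?(ltW d0)// leeD// (le_trans _ u1).
rewrite -EFinD -EFinM lee_fin /dl mulrAC ler_pdivrMr ?mulr_gt0//.
by rewrite ler_wpM2l ?divr_ge0 ?(ltW e0)//; lra.
Qed.

(** Approximation as in Pettis' theorem: the nearest among [y 0], ..., [y n] is a simple function of
    [z] and tends to the limit function by density. Distance and index are computed side by side, so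
    that measurability follows by induction. *)
Fixpoint nearest_dist n z : R :=
  if n is n'.+1 then Num.min (nearest_dist n' z) `|weak_limit z - y n|
  else `|weak_limit z - y 0|.

Fixpoint nearest_index n z : nat :=
  if n is n'.+1 then
    if `|weak_limit z - y n| < nearest_dist n' z then n else nearest_index n' z
  else 0%N.

Lemma measurable_nearest_dist n : measurable_fun setT (nearest_dist n).
Proof.
elim: n => [|n IH] /=; first exact: measurable_norm_weak_limit.
by apply: measurable_minr => //; exact: measurable_norm_weak_limit.
Qed.

Lemma nearest_index_le n z : (nearest_index n z <= n)%N.
Proof. by elim: n => //= n IH; case: ifP => // _; exact: leqW. Qed.

Lemma nearest_distE n z : nearest_dist n z = `|weak_limit z - y (nearest_index n z)|.
Proof. by elim: n => //= n IH; rewrite minC minElt; case: ifP. Qed.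

Lemma nearest_dist_le n i z : (i <= n)%N -> nearest_dist n z <= `|weak_limit z - y i|.
Proof.
elim: n => [|n IH] /=; first by rewrite leqn0 => /eqP->.
rewrite leq_eqVlt => /predU1P[->|]; first by rewrite ge_min lexx orbT.
by rewrite ltnS => /IH h; rewrite ge_min h.
Qed.

Lemma measurable_nearest_index n i : measurable [set z | nearest_index n z = i].
Proof.
elim: n i => [|n IH] i /=.
  have [->|i0] := eqVneq i 0%N.
    by rewrite (_ : [set z | _] = setT)//; apply/seteqP; split.
  rewrite (_ : [set z | _] = set0)//; apply/seteqP; split => // z /= e.
  by rewrite -e eqxx in i0.
pose A := [set z | `|weak_limit z - y n.+1| < nearest_dist n z].
have mA : measurable A.
  rewrite -[X in measurable X]setTI; apply: measurable_fun_ltr => //.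
    exact: measurable_norm_weak_limit.
  exact: measurable_nearest_dist.
rewrite (_ : [set z | _] = (A `&` [set z | n.+1 = i]) `|`
    ([set z | nearest_index n z = i] `&` ~` A)).
  apply: measurableU; last by apply: measurableI => //; exact: measurableC.
  apply: measurableI => //; have [e|e] := pselect (n.+1 = i).
    by rewrite (_ : [set z | _] = setT)//; apply/seteqP; split.
  by rewrite (_ : [set z | _] = set0)//; apply/seteqP; split.
apply/seteqP; split => z /=; rewrite /A/=; case: ifPn => h.
- by left.
- by right; split => //; exact/negP.
- by move=> [[]|[_]] //.
- by move=> [[]|[]] //.
Qed.

Lemma weak_limit_bochner : bochner_measurable P weak_limit.
Proof.
exists (fun n z => y (nearest_index n z)).
  move=> n; split.
    apply: (@sub_finite_set _ _ (y @` `I_n.+1)).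
      by move=> _ [z _ <-]; exists (nearest_index n z) => //=; rewrite ltnS nearest_index_le.
    exact/finite_image/finite_II.
  move=> x; rewrite (_ : _ @^-1` _ = \bigcup_(i in [set i | y i = x])
      [set z | nearest_index n z = i]).
    by apply: bigcup_measurable => i _; exact: measurable_nearest_index.
  apply/seteqP; split => z /=; first by move=> yx; exists (nearest_index n z).
  by move=> [i /= yi ->].
apply: aeW => z; apply/cvgrPdist_le => e e0.
have [i hi] := y_dense (weak_limit z) e0.
exists i => // n /= ni; rewrite -nearest_distE (le_trans (nearest_dist_le _ ni))//.
exact: ltW.
Qed.

End limit_function.

(** * Continuity of the densities *)

Section product_differences.
Context {R : realType} {I : finType} (P : pred I).
Variables (x y h : I -> R).
Hypothesis h1 : forall i, P i -> 1 <= h i.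
Hypothesis xh : forall i, P i -> `|x i| <= h i.
Hypothesis yh : forall i, P i -> `|y i| <= h i.

Lemma norm_prod_le : `|\prod_(i | P i) x i| <= 1 + \sum_(i | P i) h i ^+ #|P|.
Proof.
rewrite normr_prod (le_trans _ (prod_le_sum_exp _))//.
  by apply: ler_prod => i Pi; rewrite normr_ge0 xh.
by move=> i Pi; rewrite (le_trans _ (h1 Pi)).
Qed.

Lemma prod_diff_le_prod (s : seq I) : all P s ->
  `|\prod_(i <- s) x i - \prod_(i <- s) y i| <=
    (\sum_(i <- s) `|x i - y i|) * \prod_(i <- s) h i.
Proof.
elim: s => [_|a s IH /= /andP[Pa Ps]]; first by rewrite !big_nil subrr normr0 mul0r.
have H0 : 0 <= \prod_(i <- s) h i.
  rewrite big_seq; apply: prodr_ge0 => i /(allP Ps) Pi.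
  by rewrite (le_trans _ (h1 Pi)).
have XH : `|\prod_(i <- s) x i| <= \prod_(i <- s) h i.
  rewrite normr_prod !big_seq; apply: ler_prod => i /(allP Ps) Pi.
  by rewrite normr_ge0 xh.
rewrite !big_cons; set X' := \prod_(i <- s) x i; set Y' := \prod_(i <- s) y i.
have -> : x a * X' - y a * Y' = (x a - y a) * X' + y a * (X' - Y') by ring.
rewrite (le_trans (ler_normD _ _))// !normrM mulrDl lerD//.
  rewrite ler_wpM2l// (le_trans XH)// ler_peMl// h1//.
by rewrite mulrCA; apply: ler_pM => //; [exact: yh|exact: IH].
Qed.

Hypothesis dh : forall i, P i -> `|x i - y i| <= h i.
Variable K : R.
Hypothesis K0 : 0 < K.

(** Telescoping gives a sum of terms [d * H] with [d] a difference and [H] the product of the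
    bounds; [young_mul] and [d <= H] turn each into [K * d + H ^+ 3 / K], and the cube is split into
    powers of single factors. Each term of the result depends on one index only. *)
Lemma prod_diff_le : `|\prod_(i | P i) x i - \prod_(i | P i) y i| <=
  #|P|%:R / K + \sum_(i | P i) (K * `|x i - y i| + #|P|%:R / K * h i ^+ (3 * #|P|)).
Proof.
set H := \prod_(i | P i) h i.
have hH i : P i -> h i <= H.
  move=> Pi; rewrite /H (bigD1 i)//= ler_peMr ?(le_trans _ (h1 Pi))//.
  by elim/big_rec: _ => // j z /andP[Pj _] z1; rewrite mulr_ege1// h1.
have H0 : 0 <= H by apply: prodr_ge0 => i Pi; rewrite (le_trans _ (h1 Pi)).
have aP : all P (enum P) by apply/allP => i; rewrite mem_enum.
have key : `|\prod_(i | P i) x i - \prod_(i | P i) y i| <= (\sum_(i | P i) `|x i - y i|) * H.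
  by have := @prod_diff_le_prod (enum P) aP; rewrite !big_enum.
rewrite (le_trans key)// mulr_suml.
rewrite (@le_trans _ _ (\sum_(i | P i) (K * `|x i - y i| + H ^+ 3 / K)))//.
  apply: ler_sum => i Pi; rewrite (le_trans (young_mul K0 _ H0))// lerD2l.
  rewrite ler_wpM2r ?invr_ge0 ?(ltW K0)// exprS ler_wpM2r ?sqr_ge0//.
  by rewrite (le_trans (dh Pi))// hH.
rewrite !big_split/= addrCA lerD2l sumr_const -[_ *+ _]mulr_natl.
rewrite -mulr_sumr.
have -> : #|P|%:R / K + #|P|%:R / K * (\sum_(i | P i) h i ^+ (3 * #|P|)) =
    #|P|%:R * ((1 + \sum_(i | P i) h i ^+ (3 * #|P|)) / K) by field; rewrite gt_eqF.
rewrite ler_wpM2l// ler_wpM2r ?invr_ge0 ?(ltW K0)// /H -prodrXl.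
rewrite (le_trans (prod_le_sum_exp _))//.
  by move=> i Pi; rewrite exprn_ge0// (le_trans _ (h1 Pi)).
by rewrite lerD2l; apply: ler_sum => i _; rewrite -exprM.
Qed.

End product_differences.

Section measurable_bigops.
Context d (T : measurableType d) {R : realType} (I : Type) (r : seq I) (P : pred I).
Variable h : I -> T -> R.
Hypothesis mh : forall i, measurable_fun setT (h i).

Lemma measurable_sum_cond : measurable_fun setT (fun x => \sum_(i <- r | P i) h i x).
Proof.
elim: r => [|i s IH]; first by under eq_fun do rewrite big_nil; exact: measurable_cst.
have [Pi|/negbTE Pi] := boolP (P i); under eq_fun do rewrite big_cons Pi; last exact: IH.
exact: measurable_funD.
Qed.

Lemma measurable_prod_cond : measurable_fun setT (fun x => \prod_(i <- r | P i) h i x).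
Proof.
elim: r => [|i s IH]; first by under eq_fun do rewrite big_nil; exact: measurable_cst.
have [Pi|/negbTE Pi] := boolP (P i); under eq_fun do rewrite big_cons Pi; last exact: IH.
exact: measurable_funM.
Qed.

End measurable_bigops.

Section density_continuity.
Context {R : realType} {X : normedModType R}.
Local Notation R1 := (measurableTypeR R).
Local Notation sq := (square_lebesgue R).
Variables (F : test_graph X) (M : nat -> R).

(** What the step kernels share with their limit. Measurability concerns scalar images and the
    norm. *)
Definition moment_kernel (w : R1 * R1 -> X) :=
  [/\ forall psi : dual X, measurable_fun setT (psi \o w),
      measurable_fun setT (fun z => `|w z|) &
      forall n, (0 < n)%N -> (\int[sq]_z (`|w z| ^+ n)%:E <= (M n)%:E)%E].

Let P := @oriented_edge R X F.
Let n := #|test_vertex F|.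
Let at_e (x : n.-tuple R1) (e : test_vertex F * test_vertex F) : R1 * R1 :=
  (tnth x (enum_rank e.1), tnth x (enum_rank e.2)).
Let f (e : test_vertex F * test_vertex F) : dual X := test_decoration e.1 e.2.

Let at_e_integral (e : test_vertex F * test_vertex F) (g : R1 * R1 -> R) : P e ->
  measurable_fun setT g -> (forall z, 0 <= g z) ->
  (\int[cube_lebesgue R n]_x (g (at_e x e))%:E = \int[sq]_z (g z)%:E)%E.
Proof.
move=> Pe mg g0; apply: (@ge0_integral_marginal _ _ _ _ (fun z => (g z)%:E)).
- by rewrite (inj_eq enum_rank_inj) oriented_edge_neq.
- exact/measurable_EFinP.
- by move=> z; rewrite lee_fin.
Qed.

Let m_at_e e (g : R1 * R1 -> R) : measurable_fun setT g ->
  measurable_fun setT (fun x => g (at_e x e)).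
Proof.
move=> mg; apply: (@measurableT_comp _ _ _ _ _ _ g _ (at_e^~ e)) => //.
exact: measurable_tnth_pair.
Qed.

Section two_kernels.
Variables (w w' : R1 * R1 -> X).
Hypotheses (mw : moment_kernel w) (mw' : moment_kernel w').

Definition joint_dominating (z : R1 * R1) : R := test_bound F * (1 + `|w z| + `|w' z|).

Lemma joint_dominating_ge1 z : 1 <= joint_dominating z.
Proof. by rewrite mulr_ege1 ?test_bound_ge1// -addrA lerDl addr_ge0. Qed.

Lemma joint_dominatingP e (x : X) z : `|x| <= `|w z| + `|w' z| -> `|f e x| <= joint_dominating z.
Proof.
move=> xp; rewrite (le_trans (dual_le _ _))//.
rewrite ler_pM//; last by rewrite (le_trans xp)// -addrA lerDr.
by rewrite (le_trans _ (test_bound_ge e))// ler_peMl// ler1n.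
Qed.

Lemma measurable_joint_dominating : measurable_fun setT joint_dominating.
Proof.
have [_ m1 _] := mw; have [_ m2 _] := mw'.
by apply: measurable_funM => //; apply: measurable_funD => //; exact: measurable_funD.
Qed.

Definition joint_bound k : R := test_bound F ^+ k * (3 ^+ k * (1 + M k + M k)).

Lemma integral_joint_dominating k : (0 < k)%N ->
  (\int[sq]_z (joint_dominating z ^+ k)%:E <= (joint_bound k)%:E)%E.
Proof.
move=> k0; have [_ mnw mow] := mw; have [_ mnw' mow'] := mw'.
have L0 : 0 <= test_bound F ^+ k.
  by rewrite exprn_ge0// (le_trans _ (test_bound_ge1 F)).
rewrite (@le_trans _ _ (\int[sq]_z ((test_bound F ^+ k * 3 ^+ k)%:E *
    (1%:E + (`|w z| ^+ k)%:E + (`|w' z| ^+ k)%:E)))%E)//.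
  apply: ge0_le_integral => //.
  - by move=> z _; rewrite lee_fin exprn_ge0// (le_trans _ (joint_dominating_ge1 z)).
  - apply/measurable_EFinP; apply: measurable_funX; exact: measurable_joint_dominating.
  - apply: measurable_funeM; apply: emeasurable_funD; last first.
      by apply/measurable_EFinP; exact: measurable_funX.
    by apply: emeasurable_funD => //; apply/measurable_EFinP; exact: measurable_funX.
  - move=> z _; rewrite -[X in (_ * X)%E]/((1 + `|w z| ^+ k + `|w' z| ^+ k)%:E) -EFinM lee_fin.
    by rewrite /joint_dominating exprMn -mulrA ler_wpM2l// exp_sum3_le.
have m1 : measurable_fun setT (fun z => (`|w z| ^+ k)%:E).
  by apply/measurable_EFinP; exact: measurable_funX.
have m2 : measurable_fun setT (fun z => (`|w' z| ^+ k)%:E).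
  by apply/measurable_EFinP; exact: measurable_funX.
rewrite ge0_integralZl_EFin//; first last.
- by rewrite mulr_ge0// exprn_ge0.
- by apply: emeasurable_funD => //; apply: emeasurable_funD.
- by move=> z _; rewrite !adde_ge0 ?lee_fin ?exprn_ge0.
have L3 : 0 <= test_bound F ^+ k * 3 ^+ k by rewrite mulr_ge0// exprn_ge0.
rewrite /joint_bound mulrA [leRHS]EFinM lee_wpmul2l ?lee_fin//.
have p1 v : forall z, setT z -> (0 <= (`|v z| ^+ k)%:E)%E by move=> z _; rewrite lee_fin exprn_ge0.
have p2 z : setT z -> (0 <= 1 + (`|w z| ^+ k)%:E)%E by move=> _; rewrite adde_ge0 ?lee_fin ?exprn_ge0.
have m3 : measurable_fun setT (fun z => 1 + (`|w z| ^+ k)%:E)%E by exact: emeasurable_funD.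
rewrite ge0_integralD// ge0_integralD//.
rewrite integral_cst//= probability_setT mule1 !EFinD.
by rewrite leeD ?mow'// leeD2l ?mow.
Qed.

Let W (v : R1 * R1 -> X) (x : n.-tuple R1) := \prod_(e | P e) f e (v (at_e x e)).

Let mW v : moment_kernel v -> measurable_fun setT (W v).
Proof.
move=> [mv _ _]; apply: (measurable_prod_cond _ _ (h := fun e x => f e (v (at_e x e)))) => e.
exact: (m_at_e e (g := f e \o v)).
Qed.

Let card_P e : P e -> (0 < #|P|)%N.
Proof. by move=> Pe; apply/card_gt0P; exists e. Qed.

Let integral_sum_edges (c : R) (g : test_vertex F * test_vertex F -> R1 * R1 -> R) :
  0 <= c -> (forall e z, 0 <= g e z) -> (forall e, measurable_fun setT (g e)) ->
  (\int[cube_lebesgue R n]_x (c + \sum_(e | P e) g e (at_e x e))%:E =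
   c%:E + \sum_(e | P e) \int[sq]_z (g e z)%:E)%E.
Proof.
move=> c0 g0 mg.
under eq_integral => x _ do rewrite EFinD -sumEFin -big_filter.
have ms : measurable_fun setT (fun x =>
    \sum_(e <- [seq e <- index_enum _ | P e]) (g e (at_e x e))%:E)%E.
  apply: emeasurable_sum => e; apply/measurable_EFinP; exact: m_at_e.
rewrite ge0_integralD//; last by move=> x _; apply: sume_ge0 => e _; rewrite lee_fin.
rewrite integral_cst//= probability_setT mule1; congr (_ + _)%E.
rewrite ge0_integral_sum//; last 2 first.
- by move=> e; apply/measurable_EFinP; exact: m_at_e.
- by move=> e x _; rewrite lee_fin.
by rewrite big_filter; apply: eq_bigr => e Pe; rewrite at_e_integral.
Qed.

Lemma integrable_density v : moment_kernel v -> (forall z, `|v z| <= `|w z| + `|w' z|) ->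
  (cube_lebesgue R n).-integrable setT (EFin \o W v).
Proof.
move=> mv vb; apply/integrableP; split; first by apply/measurable_EFinP; exact: mW.
rewrite (@le_lt_trans _ _ (\int[cube_lebesgue R n]_x
    (1 + \sum_(e | P e) joint_dominating (at_e x e) ^+ #|P|)%:E))%E//.
  apply: ge0_le_integral => //.
  - by apply/measurable_EFinP; apply: measurableT_comp => //; exact: mW.
  - apply/measurable_EFinP; apply: measurable_funD => //.
    apply: measurable_sum_cond => e; apply: (m_at_e e (g := fun z => joint_dominating z ^+ #|P|)).
    by apply: measurable_funX; exact: measurable_joint_dominating.
  - move=> x _; rewrite lee_fin; apply: norm_prod_le => e Pe.
      exact: joint_dominating_ge1.
    exact/joint_dominatingP/vb.
rewrite (@integral_sum_edges 1 (fun e z => joint_dominating z ^+ #|P|))//; last 2 first.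
- by move=> e z; rewrite exprn_ge0// (le_trans _ (joint_dominating_ge1 z)).
- by move=> e; apply: measurable_funX; exact: measurable_joint_dominating.
rewrite (@le_lt_trans _ _ (1%:E + \sum_(e | P e) (joint_bound #|P|)%:E)%E)//.
  by rewrite leeD2l//; apply: lee_sum => e Pe; apply: integral_joint_dominating; exact: card_P Pe.
by rewrite sumEFin -EFinD ltry.
Qed.

(** [prod_diff_le] is integrated edge by edge; a term involving one edge sees only a two-dimensional
    marginal of the cube, which is the measure of the square. *)
Lemma density_dist (K dl : R) : 0 < K ->
  (forall e, P e -> (\int[sq]_z (`|f e (w z) - f e (w' z)|)%:E <= dl%:E)%E) ->
  `|graphon_density F w - graphon_density F w'| <=
  #|P|%:R / K + #|P|%:R * (K * dl + #|P|%:R / K * joint_bound (3 * #|P|)).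
Proof.
move=> K0 wdl.
have iw : (cube_lebesgue R n).-integrable setT (EFin \o W w).
  by apply: integrable_density => // z; rewrite lerDl.
have iw' : (cube_lebesgue R n).-integrable setT (EFin \o W w').
  by apply: integrable_density => // z; rewrite lerDr.
have -> : graphon_density F w - graphon_density F w' =
    \int[cube_lebesgue R n]_x (W w x - W w' x) by rewrite RintegralB.
have iD : (cube_lebesgue R n).-integrable setT (EFin \o (W w \- W w')).
  by rewrite (_ : _ \o _ = (EFin \o W w) \- (EFin \o W w'))%E; [exact: integrableB|
    apply/funext => x /=; rewrite EFinB].
rewrite (le_trans (le_normr_Rintegral _ iD))//.
have cN : 0 <= #|P|%:R / K by rewrite divr_ge0// ltW.
pose g e z := K * `|f e (w z) - f e (w' z)| + #|P|%:R / K * joint_dominating z ^+ (3 * #|P|).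
have jd0 z k : 0 <= joint_dominating z ^+ k.
  by rewrite exprn_ge0// (le_trans _ (joint_dominating_ge1 z)).
have g0 e z : 0 <= g e z by rewrite addr_ge0 ?mulr_ge0 ?(ltW K0)// invr_ge0 ltW.
have mdf e : measurable_fun setT (fun z => `|f e (w z) - f e (w' z)|).
  apply: measurableT_comp => //; apply: measurable_funB; [case: mw|case: mw'] => h _ _; exact: h.
have mjd k : measurable_fun setT (fun z => joint_dominating z ^+ k).
  by apply: measurable_funX; exact: measurable_joint_dominating.
have mg e : measurable_fun setT (g e).
  by apply: measurable_funD; apply: measurable_funM.
have key : (\int[cube_lebesgue R n]_x (`|W w x - W w' x|)%:E <=
    (#|P|%:R / K + #|P|%:R * (K * dl + #|P|%:R / K * joint_bound (3 * #|P|)))%:E)%E.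
  rewrite (@le_trans _ _ (\int[cube_lebesgue R n]_x
      (#|P|%:R / K + \sum_(e | P e) g e (at_e x e))%:E)%E)//.
    apply: ge0_le_integral => //.
    - by apply/measurable_EFinP; apply: measurableT_comp => //; apply: measurable_funB; exact: mW.
    - apply/measurable_EFinP; apply: measurable_funD => //.
      by apply: measurable_sum_cond => e; exact: m_at_e.
    - move=> x _; rewrite lee_fin.
      apply: (@prod_diff_le R _ P (fun e => f e (w (at_e x e))) (fun e => f e (w' (at_e x e)))
        (fun e => joint_dominating (at_e x e))) => // e Pe.
      + exact: joint_dominating_ge1.
      + by apply: joint_dominatingP; rewrite lerDl.
      + by apply: joint_dominatingP; rewrite lerDr.
      + by rewrite -dualB; apply: joint_dominatingP; exact: ler_normB.
  rewrite integral_sum_edges// EFinD leeD2l//.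
  have -> : #|P|%:R * (K * dl + #|P|%:R / K * joint_bound (3 * #|P|)) =
      \sum_(e | P e) (K * dl + #|P|%:R / K * joint_bound (3 * #|P|)).
    by rewrite sumr_const mulr_natl.
  rewrite -sumEFin; apply: lee_sum => e Pe.
  rewrite /g; under eq_integral => z _ do rewrite EFinD EFinM [X in (_ + X)%E]EFinM.
  rewrite ge0_integralD//; first last.
  - by apply: measurable_funeM; exact/measurable_EFinP.
  - by move=> z _; rewrite -EFinM lee_fin mulr_ge0.
  - by apply: measurable_funeM; exact/measurable_EFinP.
  - by move=> z _; rewrite -EFinM lee_fin mulr_ge0// ltW.
  rewrite !ge0_integralZl_EFin ?(ltW K0)//; try exact/measurable_EFinP;
    try by move=> z _; rewrite lee_fin.
  rewrite [leRHS]EFinD; apply: leeD.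
    by rewrite [leRHS]EFinM lee_wpmul2l ?lee_fin ?(ltW K0)// wdl.
  rewrite [leRHS]EFinM lee_wpmul2l ?lee_fin//.
  by rewrite integral_joint_dominating// muln_gt0/=; exact: card_P Pe.
rewrite -lee_fin (le_trans _ key)// /Rintegral fineK//.
rewrite ge0_fin_numE; last by apply: integral_ge0 => x _; rewrite lee_fin.
by rewrite (le_lt_trans key)// ltry.
Qed.

End two_kernels.

(** Under common moment bounds, a density depends continuously on the L^1 distances of the kernels
    tested with the finitely many functionals of [F]. *)
Lemma density_dist_small (w : R1 * R1 -> X) (eps : R) : moment_kernel w -> 0 < eps ->
  exists2 dl : R, 0 < dl & forall w', moment_kernel w' ->
    (forall e, P e -> (\int[sq]_z (`|f e (w' z) - f e (w z)|)%:E <= dl%:E)%E) ->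
    `|graphon_density F w' - graphon_density F w| <= eps.
Proof.
move=> mw e0; set N : R := #|P|%:R; set J := `|joint_bound (3 * #|P|)|.
have N0 : 0 <= N by [].
have J0 : 0 <= J by exact: normr_ge0.
(* [K] makes the terms divided by it at most [eps / 2]; [dl] is chosen afterwards, so that
   [N * (K * dl)] is at most [eps / 2]. *)
pose K := 2 * (N + N * N * J + 1) / eps.
have S0 : 0 < N + N * N * J + 1 by rewrite ltr_wpDl// addr_ge0// !mulr_ge0.
have K0 : 0 < K by rewrite divr_gt0// mulr_gt0.
pose dl := eps / 2 / ((N + 1) * K).
have NK : 0 < (N + 1) * K by rewrite mulr_gt0// ltr_wpDl.
exists dl; first by rewrite divr_gt0// divr_gt0.
move=> w' mw' h; rewrite (le_trans (density_dist mw' mw K0 h))// -/N.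
rewrite (@le_trans _ _ (N / K + N * (K * dl + N / K * J)))//.
  have NK0 : 0 <= N / K by rewrite divr_ge0// ltW.
  by rewrite lerD2l ler_wpM2l// lerD2l; apply: ler_wpM2l => //; exact: ler_norm.
have -> : N / K + N * (K * dl + N / K * J) = (N + N * N * J) / K + N * (K * dl).
  by field; rewrite gt_eqF.
rewrite [leRHS]splitr lerD//.
  rewrite ler_pdivrMr// /K.
  have -> : eps / 2 * (2 * (N + N * N * J + 1) / eps) = N + N * N * J + 1.
    by field; rewrite gt_eqF.
  by rewrite lerDl.
have -> : N * (K * dl) = (eps / 2) * (N / (N + 1)).
  by rewrite /dl; field; rewrite !gt_eqF// ltr_wpDl.
rewrite ler_piMr ?divr_ge0 ?(ltW e0)// ler_pdivrMr ?ltr_wpDl// mul1r lerDl.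
by [].
Qed.

End density_continuity.

(** * Reflexive spaces *)

Section step_density.
Context {R : realType} {X : normedModType R}.
Variables (m : nat -> nat -> R) (v : nat -> nat -> nat -> X).
Hypothesis m_ge0 : forall b s, 0 <= m b s.
Hypothesis sum_m : forall b, \sum_(s < 4 ^ b) m b s = 1.

(** The codes of the coordinates have a product law with masses [m b], so this is the sum that
    arises as the ultralimit of the averaged densities; what remains is relabelling vertices by
    their ranks. *)
Lemma graphon_density_step (F : test_graph X) b :
  graphon_density F (step_kernel m v b) =
  \sum_(s : {ffun test_vertex F -> 'I_(4 ^ b)}) (\prod_i m b (s i)) *
    \prod_(e | oriented_edge e) test_decoration e.1 e.2 (v b (s e.1) (s e.2)).
Proof.
pose h (s : {ffun 'I_#|test_vertex F| -> 'I_(4 ^ b)}) := \prod_(e | @oriented_edge R X F e)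
  test_decoration e.1 e.2 (v b (s (enum_rank e.1)) (s (enum_rank e.2))).
have := integral_cube_code m_ge0 sum_m h; rewrite /graphon_density /Rintegral.
have -> : (fun x => (h (cube_code m b x))%:E) = (fun x : #|test_vertex F|.-tuple (measurableTypeR R) =>
    (\prod_(e | oriented_edge e) test_decoration e.1 e.2
      (step_kernel m v b (tnth x (enum_rank e.1), tnth x (enum_rank e.2))))%:E).
  apply/funext => x; congr (_%:E); apply: eq_bigr => e _.
  by rewrite /cube_code !ffunE.
move=> -> /=; pose rk (s : {ffun test_vertex F -> 'I_(4 ^ b)}) :
  {ffun 'I_#|test_vertex F| -> 'I_(4 ^ b)} := [ffun i => s (enum_val i)].
have rk_bij : bijective rk.
  exists (fun s : {ffun 'I_#|test_vertex F| -> 'I_(4 ^ b)} =>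
      [ffun u => s (enum_rank u)] : {ffun test_vertex F -> 'I_(4 ^ b)}) => s;
    apply/ffunP => i.
    by rewrite !ffunE enum_rankK.
  by rewrite !ffunE enum_valK.
rewrite (reindex rk) /=; last exact: onW_bij.
apply: eq_bigr => s _; congr (_ * _); last first.
  by apply: eq_bigr => e _; rewrite !ffunE !enum_rankK.
rewrite (reindex (@enum_rank (test_vertex F))) /=; last exact/onW_bij/enum_rank_bij.
by apply: eq_bigr => u _; rewrite ffunE enum_rankK.
Qed.

End step_density.

Section moments.
Context {R : realType} {X : normedModType R}.

Lemma target_norm_fmean (G : target_graph X) n : (0 < n)%N ->
  target_norm n%:R G ^+ n = fmean (fun p => `|@gpair R X G p| ^+ n).
Proof.
move=> n0; rewrite /target_norm.
have -> : (#|target_vertex G|%:R ^+ 2)^-1 *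
    (\sum_u \sum_v `|@target_decoration R X G u v| `^ n%:R) =
    fmean (fun p => `|@gpair R X G p| ^+ n).
  rewrite /fmean card_prod -natrX mulnn; congr *%R.
  rewrite pair_bigA; apply: eq_bigr => -[u v] _ /=.
  by rewrite powR_mulrn.
rewrite -powR_mulrn ?powR_ge0// -powRrM mulVf ?pnatr_eq0 -?lt0n// powRr1//.
by apply: fmean_ge0 => p; exact: exprn_ge0.
Qed.

Lemma bounded_moments (G : nat -> target_graph X) :
  (forall p : R, 1 <= p -> has_ubound (range (fun n => target_norm p (G n)))) ->
  exists M : nat -> R, forall n k, fmean (fun p => `|@gpair R X (G n) p| ^+ k) <= M k.
Proof.
move=> h; suff /choice[M MP] k : exists M : R, forall n,
    fmean (fun p => `|@gpair R X (G n) p| ^+ k) <= M by exists M.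
case: k => [|k].
  exists 1 => n; under eq_fmean do rewrite expr0; rewrite fmean_cst//.
  by rewrite card_prod muln_gt0 target_nonempty.
have [|C CP] := h k.+1%:R; first by rewrite ler1n.
exists (C ^+ k.+1) => n; rewrite -target_norm_fmean//.
have t0 : 0 <= target_norm k.+1%:R (G n) by exact: powR_ge0.
have tC : target_norm k.+1%:R (G n) <= C by apply: CP; exists n.
by rewrite lerXn2r// nnegrE// (le_trans t0).
Qed.

End moments.

Section representation.
Context {R : realType} {X : normedModType R}.
Local Notation sq := (square_lebesgue R).

(* Distances below [2 ^- j] for the first [j] functionals make all the series
   of increments summable. *)
Lemma summable_levels (phi : nat -> dual X) (d : dual X -> nat -> nat -> \bar R) :
  (forall psi b b', (0 <= d psi b b' < +oo)%E) ->
  (forall (psi : dual X) (e : R), 0 < e -> exists N, forall b b', (N <= b)%N -> (N <= b')%N ->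
    (d psi b b' <= e%:E)%E) ->
  exists2 B : nat -> nat, forall j, (j <= B j)%N &
    forall k, (\sum_(0 <= j <oo) d (phi k) (B j) (B j.+1) < +oo)%E.
Proof.
move=> d0 dc.
have e0 (j : nat) : 0 < (2 ^ j.+1)%:R^-1 :> R by rewrite invr_gt0 ltr0n expn_gt0.
have /choice[N NP] (p : nat * nat) := dc (phi p.1) _ (e0 p.2).
(* A sum instead of a maximum: it is monotone in [j], at least [j], and at least [N (k, j)] for
   every [k <= j]. *)
pose B j := (j + \sum_(i < j.+1) \sum_(k < i.+1) N (k : nat, i : nat))%N.
have BS j : (B j <= B j.+1)%N.
  by rewrite /B [in leqRHS]big_ord_recr/= leq_add// leq_addr.
have BN j k : (k <= j)%N -> (N (k, j) <= B j)%N.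
  move=> kj; rewrite /B big_ord_recr/= (bigD1 (Ordinal (kj : (k < j.+1)%N)))//=.
  by rewrite addnA addnCA leq_addr.
exists B => [j|k]; first by rewrite /B leq_addr.
have small j : (k <= j)%N -> (d (phi k) (B j) (B j.+1) <= ((2 ^ j.+1)%:R^-1)%:E)%E.
  by move=> kj; apply: (NP (k, j)) => /=; rewrite ?(leq_trans (BN _ _ kj)).
(* The functional [phi k] is controlled from index [k] on only; the earlier terms are finitely many
   and finite. *)
rewrite (nneseries_split 0 k); last by move=> j _; have /andP[] := d0 (phi k) (B j) (B j.+1).
rewrite add0n lte_add_pinfty//.
  by apply: lte_sum_pinfty => j _; have /andP[] := d0 (phi k) (B j) (B j.+1).
rewrite (@le_lt_trans _ _ 1%E) ?ltry//.
apply: lime_le.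
  by apply: is_cvg_nneseries => j _ _; have /andP[] := d0 (phi k) (B j) (B j.+1).
apply: nearW => n.
have e1 j : (2 ^ j.+1)%:R^-1 = - (2 ^ j.+1)%:R^-1 - - (2 ^ j)%:R^-1 :> R.
  by rewrite expnS natrM; field; rewrite pnatr_eq0 -lt0n expn_gt0.
have [nk|/ltnW kn] := leqP n k; first by rewrite big_geq.
rewrite (@le_trans _ _ (\sum_(k <= j < n) ((2 ^ j.+1)%:R^-1)%:E)%E)//.
  by rewrite big_nat [leRHS]big_nat; apply: lee_sum => j /andP[kj _]; exact: small.
rewrite sumEFin lee_fin; under eq_bigr do rewrite e1.
rewrite telescope_sumr// opprK addrC lerBlDr.
have i1 : (2 ^ k)%:R^-1 <= 1 :> R by rewrite invf_le1 ?ltr0n ?expn_gt0// ler1n expn_gt0.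
by rewrite (le_trans i1)// lerDl invr_ge0.
Qed.

Lemma step_dist_ltoo (m : nat -> nat -> R) (v : nat -> nat -> nat -> X) (M : nat -> R)
    (psi : dual X) b b' :
  (forall b s, 0 <= m b s) -> (forall b, \sum_(s < 4 ^ b) m b s = 1) ->
  (forall b b' s, (b <= b')%N ->
    m b s = \sum_(i < 4 ^ b' | (i %/ 4 ^ (b' - b))%N == s) m b' i) ->
  (0 <= step_dist m v psi b b' < +oo)%E.
Proof.
move=> m0 sm mc; apply/andP; split; first by apply: integral_ge0 => z _; rewrite lee_fin.
wlog bb' : b b' / (b <= b')%N => [hw|].
  have [|/ltnW] := leqP b b'; first exact: hw.
  by rewrite step_distC; exact: hw.
rewrite /step_dist (_ : (fun z => _) =
  (fun z => ((fun s t => `|psi (v b' s t) -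
      psi (v b (s %/ 4 ^ (b' - b))%N (t %/ 4 ^ (b' - b))%N)|)
    (interval_code m b' z.1) (interval_code m b' z.2))%:E)); last first.
  by apply/funext => z /=; rewrite /step_kernel !(interval_code_coarsen m0 mc _ bb').
by rewrite (integral_square_code m0 sm b' (fun s t => `|psi (v b' s t) -
      psi (v b (s %/ 4 ^ (b' - b))%N (t %/ 4 ^ (b' - b))%N)|)) ltry.
Qed.

(** A real power is at most 1 plus an integer power of larger exponent. *)
Lemma bochner_graphon_moments (W : R * R -> X) (M : nat -> R) :
  bochner_measurable sq W -> (forall x y, W (x, y) = W (y, x)) ->
  measurable_fun setT (fun z : measurableTypeR R * measurableTypeR R => `|W z|) ->
  (forall n, (0 < n)%N -> (\int[sq]_z (`|W z| ^+ n)%:E <= (M n)%:E)%E) ->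
  bochner_graphon W.
Proof.
move=> bW sW mW hM; split => // [|p p1].
  by apply: aeW => -[x y] /=.
have p0 : 0 <= p by rewrite (le_trans _ p1).
pose n := Num.bound p.
have pn : p <= n%:R by rewrite ltW// archi_boundP.
have n0 : (0 < n)%N by rewrite -(ltr0n R) (lt_le_trans _ pn)// (lt_le_trans _ p1).
rewrite (@le_lt_trans _ _ (\int[sq]_z (1 + (`|W z| ^+ n)%:E))%E)//.
  apply: ge0_le_integral => //.
  - by apply/measurable_EFinP; exact: (measurableT_comp (measurable_powR p) mW).
  - apply: emeasurable_funD => //; apply/measurable_EFinP; exact: measurable_funX.
  - move=> z _; rewrite -EFinD lee_fin.
    have [x1|/ltW x1] := leP `|W z| 1.
      rewrite ler_wpDr ?exprn_ge0// (le_trans (ge0_ler_powR p0 _ _ x1)) ?nnegrE//.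
      by rewrite powR1.
    by rewrite ler_wpDl// -powR_mulrn// ler_powR.
rewrite ge0_integralD//; last by apply/measurable_EFinP; exact: measurable_funX.
rewrite integral_cst//= probability_setT mule1.
by rewrite lte_add_pinfty ?ltry// (le_lt_trans (hM n n0))// ltry.
Qed.

(** Three comparisons at one level: the densities of [G n] with the averaged ones, uniformly in [n];
    the ultralimit of the latter, which is the density of a step kernel; and this density with that
    of [W]. *)
Lemma reflexive_representation : separable (dual X) -> reflexive_space X ->
  graphon_representation_property X.
Proof.
move=> sX rX G /bounded_moments[M GM] Gcvg.
have [phi phid] := separable_approx sX.
have [y yd] := separable_predual sX.
have [U [UU oU]] := ultraFilterLemma (@eventually_filter).
pose m := lim_measure U G phi; pose v := lim_value rX UU phi GM.
have m0 : forall b s, 0 <= m b s by exact: lim_measure_ge0.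
have sm : forall b, \sum_(s < 4 ^ b) m b s = 1 by exact: sum_lim_measure.
have mc : forall b b' s, (b <= b')%N ->
    m b s = \sum_(i < 4 ^ b' | (i %/ 4 ^ (b' - b))%N == s) m b' i by exact: lim_measure_coarsen.
have vc : forall b b' s t, (b <= b')%N ->
  (m b s * m b t) *: v b s t = \sum_(i < 4 ^ b' | (i %/ 4 ^ (b' - b))%N == s)
    \sum_(j < 4 ^ b' | (j %/ 4 ^ (b' - b))%N == t) (m b' i * m b' j) *: v b' i j.
  move=> b b' s t bb'; rewrite -(lim_massE rX UU phi GM) (lim_mass_coarsen rX UU phi GM _ _ bb').
  by apply: eq_bigr => i _; apply: eq_bigr => j _; rewrite -lim_massE.
have vs : forall b s t, v b s t = v b t s by exact: lim_value_sym.
have vm : forall b n, \sum_(s < 4 ^ b) \sum_(t < 4 ^ b) m b s * m b t * `|v b s t| ^+ n <= M n.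
  exact: sum_lim_value_exp.
have dist0 psi b b' := step_dist_ltoo v M psi b b' m0 sm mc.
have cauchy := step_dist_cauchy m0 sm mc vc vm.
have [B jB Bsum] := summable_levels phi dist0 cauchy.
pose u j := step_kernel m v (B j).
have u1 j (h : X -> R) : measurable_fun setT (h \o u j) by exact: measurable_step_kernel.
have u2 i j (h : X -> X -> R) : measurable_fun setT (fun z => h (u i z) (u j z)).
  exact: (measurable_step_kernel2 v m0 mc (B i) (B j) h).
have um j n : (\int[sq]_z (`|u j z| ^+ n)%:E <= (M n)%:E)%E.
  exact: integral_step_kernel_exp.
have uc (psi : dual X) (e : R) : 0 < e -> exists N, forall i j,
    (N <= i)%N -> (N <= j)%N -> (\int[sq]_z (`|psi (u j z) - psi (u i z)|)%:E <= e%:E)%E.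
  move=> e0; have [N NP] := cauchy psi e e0; exists N => i j Ni Nj.
  by apply: NP; [exact: leq_trans Ni (jB i)|exact: leq_trans Nj (jB j)].
pose W := weak_limit u phi.
have mW1 (psi : dual X) : measurable_fun setT (psi \o W).
  exact: (measurable_dual_weak_limit rX phid u1 u2).
have mW2 : measurable_fun setT (fun z => `|W z|).
  have := measurable_norm_weak_limit rX phid u1 u2 yd 0.
  by under eq_fun do rewrite subr0.
have mW3 n : (0 < n)%N -> (\int[sq]_z (`|W z| ^+ n)%:E <= (M n)%:E)%E.
  exact: (weak_limit_moments rX phid u1 u2 um yd).
have Wsym a b : W (a, b) = W (b, a).
  by apply: eq_weak_limit; apply/funext => j; exact: step_kernel_sym.
exists W.
  by apply: (bochner_graphon_moments _ Wsym mW2 mW3);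
    exact: (weak_limit_bochner sq rX phid u1 u2 yd).
move=> F; have /cvg_ex[D DP] := Gcvg F.
suff -> : graphon_density F W = D by exact: DP.
have mkW : moment_kernel M W by split.
have mku j : moment_kernel M (u j).
  split => [psi||n _]; [exact: u1|exact: (u1 j (fun x => `|x|))|exact: um].
have densu j : graphon_density F (u j) = limit_density rX UU phi GM F (B j).
  exact: graphon_density_step.
apply/eqP; rewrite -subr_eq0 -normr_le0; apply/ler_addgt0Pl => e e0; rewrite addr0.
have e2 : 0 < e / 2 by rewrite divr_gt0.
have [dl dl0 dlP] := density_dist_small F mkW e2.
have /choice[N NP] (p : test_vertex F * test_vertex F) :=
  weak_limit_L1 rX phid u1 u2 um Bsum uc yd (test_decoration p.1 p.2) dl0.
have [B0 B0P] := regularity_counting F M phid e2.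
(* Late enough for the L^1 estimates of all the functionals of [F], and, as [j <= B j], for the
   level [B j] to be past [B0]. *)
pose j := maxn B0 (\max_p N p).
have D1 : `|graphon_density F (u j) - graphon_density F W| <= e / 2.
  apply: (dlP _ (mku j)) => p _; apply: NP.
  by rewrite (leq_trans _ (leq_maxr _ _))// (leq_bigmax p).
have D2 : `|D - graphon_density F (u j)| <= e / 2.
  rewrite densu; apply: (@cvgF_le _ _ U _ (fun n => `|hom_density F (G n) -
      averaged_density F (code phi (G n) (B j))|)) => [|n].
    apply: cvg_norm; apply: cvgB; last exact: averaged_density_lim.
    exact: (cvg_ultra_lim oU DP).
  by apply: B0P => //; rewrite (leq_trans _ (jB j))// leq_maxl.
rewrite distrC in D1; rewrite distrC in D2.
by rewrite (splitr e) (le_trans (ler_distD (graphon_density F (u j)) _ _))// lerD.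
Qed.

End representation.

(** * Bochner means *)

Section null_sets.
Context d (T : measurableType d) (R : realType) (mu : {measure set T -> \bar R}).
Local Open Scope ereal_scope.
Variables (N : set T) (mN : measurable N) (N0 : mu N = 0).
Import HBNNSimple.

(** The integrand built from a Bochner graphon may fail to be Borel, so the comparison is made on
    the simple functions that define the integral: cutting one of them to zero on [N] leaves its
    integral unchanged. *)
Lemma ge0_le_integral_off_null (f g : T -> \bar R) :
  (forall z, 0 <= f z) -> (forall z, 0 <= g z) ->
  (forall z, ~ N z -> f z <= g z) -> \int[mu]_z f z <= \int[mu]_z g z.
Proof.
move=> f0 g0 fg; rewrite !ge0_integralTE//; apply: ge_ereal_sup => _ [h hf <-].
pose h' := proj_nnsfun h (measurableC mN).
apply: ereal_sup_ubound; exists h'.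
  move=> z /=; have [Nz|Nz] := pselect (N z).
    by rewrite mindicE memNset ?mulr0//=; exact.
  by rewrite mindicE mem_set// mulr1 (le_trans (hf z))// fg.
rewrite -!integralT_nnsfun; apply: ae_eq_integral => //.
- exact/measurable_EFinP/(measurable_funPT h').
- exact/measurable_EFinP/(measurable_funPT h).
- exists N; split => // z /= hz; apply: contrapT => Nz; apply: hz => _.
  by rewrite /= mindicE mem_set// mulr1.
Qed.

Lemma eq_integral_off_null (f g : T -> \bar R) :
  (forall z, ~ N z -> f z = g z) -> \int[mu]_z f z = \int[mu]_z g z.
Proof.
move=> fg.
have ge0_eq (f' g' : T -> \bar R) : (forall z, 0 <= f' z) -> (forall z, 0 <= g' z) ->
    (forall z, ~ N z -> f' z = g' z) -> \int[mu]_z f' z = \int[mu]_z g' z.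
  by move=> f0 g0 e; apply/eqP; rewrite eq_le; apply/andP; split;
    apply: ge0_le_integral_off_null => // z Nz; rewrite e.
rewrite integralE [RHS]integralE; congr (_ - _); apply: ge0_eq => // z Nz;
  by rewrite ?funeposE ?funenegE fg.
Qed.

End null_sets.

Section simple_functions.
Context d (T : measurableType d) (R : realType) (X : normedModType R).

Lemma simple_function_restrict (s : T -> X) (B : set T) :
  simple_function s -> measurable B -> simple_function (fun z => if z \in B then s z else 0).
Proof.
move=> [fs ms] mB; split.
  apply: (@sub_finite_set _ _ (range s `|` [set 0])); last by rewrite finite_setU.
  by move=> _ [z _ <-]; case: ifP => _; [left; exists z|right].
move=> y; rewrite (_ : _ @^-1` _ = (B `&` s @^-1` [set y]) `|`
    (~` B `&` [set z | 0 = y])).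
  apply: measurableU; first exact: measurableI.
  apply: measurableI; first exact: measurableC.
  by have [->|y0] := pselect (0 = y);
    [rewrite (_ : [set _ | _] = setT) //; apply/seteqP|
     rewrite (_ : [set _ | _] = set0) //; apply/seteqP; split => z].
apply/seteqP; split => z /=; case: ifPn; rewrite ?(inE, notin_setE) => Bz.
- by left.
- by right.
- by case=> -[].
- by case=> -[].
Qed.

Lemma measurable_simple2 (s t : T -> X) (h : X -> X -> R) :
  simple_function s -> simple_function t -> measurable_fun setT (fun z => h (s z) (t z)).
Proof.
move=> [fs ms] [ft mt] _ Y mY; rewrite setTI.
rewrite (_ : _ @^-1` Y = \bigcup_(p in [set p | range s p.1 /\ range t p.2 /\ Y (h p.1 p.2)])
    (s @^-1` [set p.1] `&` t @^-1` [set p.2])).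
  apply: fin_bigcup_measurable => [|p _]; last exact: measurableI.
  apply: (@sub_finite_set _ _ (range s `*` range t)); last exact: finite_setX.
  by move=> p /= [? [? ?]].
apply/seteqP; split => z /=.
  by move=> hY; exists (s z, t z) => //=; split; [exists z|split => //; exists z].
by move=> [p /= [_ [_ hY]] [-> ->]].
Qed.

Lemma measurable_simple (s : T -> X) (h : X -> R) :
  simple_function s -> measurable_fun setT (h \o s).
Proof. by move=> ss; exact: (measurable_simple2 (fun x _ => h x) ss ss). Qed.

Lemma simple_mean (P : probability T R) (s : T -> X) : simple_function s ->
  exists x, forall psi : dual X, (\int[P]_z (psi (s z))%:E = (psi x)%:E)%E.
Proof.
move=> [/finite_seqP[l rl] ms].
have sl z : s z \in l.
  by have : range s (s z) by [exists z]; rewrite rl.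
pose k z : seq_sub l := SeqSub (sl z).
have mk i : measurable (k @^-1` [set i]).
  rewrite (_ : _ @^-1` _ = s @^-1` [set val i])//.
  by apply/seteqP; split => z /=; [move=> <-|move=> h; exact: val_inj].
exists (\sum_i fiber_weight P k i *: val i) => psi.
rewrite (integral_finite_valued P mk (psi \o val)) dual_sum; congr (_%:E).
by apply: eq_bigr => i _; rewrite dual_scale.
Qed.

End simple_functions.

Section bochner_mean.
Context d (T : measurableType d) (R : realType) (P : probability T R).
Context {X : completeNormedModType R}.
Variables (f : T -> X) (s : nat -> T -> X).
Hypothesis ss : forall n, simple_function (s n).
Hypothesis sf : forall z, s n z @[n --> \oo] --> f z.
Hypothesis f_fin : (\int[P]_z (`|f z|)%:E < +oo)%E.

Let mf : measurable_fun setT (fun z => `|f z|).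
Proof.
apply: (@measurable_fun_cvg _ _ _ _ (fun n z => `|s n z|)) => [n|z _].
  exact: (measurable_simple (fun x => `|x|) (ss n)).
by apply: cvg_norm; exact: sf.
Qed.

Lemma measurable_dual_limit (psi : dual X) : measurable_fun setT (fun z => psi (f z)).
Proof.
apply: (@measurable_fun_cvg _ _ _ _ (fun n z => psi (s n z))) => [n|z _].
  exact: (measurable_simple psi (ss n)).
by apply: continuous_cvg; [exact: dual_continuous|exact: sf].
Qed.

(** Cutting [s n] off where it exceeds twice the limit gives domination by an integrable function
    and keeps convergence: where [f z] is nonzero the cut is eventually void, and where it is zero
    every [t n z] is zero. *)
Let B n : set T := [set z | `|s n z| <= 2 * `|f z|].
Let t n z : X := if z \in B n then s n z else 0.

Let simple_t n : simple_function (t n).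
Proof.
apply: simple_function_restrict (ss n) _; rewrite -[B n]setTI.
apply: measurable_fun_le => //; first exact: (measurable_simple (fun x => `|x|) (ss n)).
exact: measurable_funM.
Qed.

Let t_le n z : `|t n z| <= 2 * `|f z|.
Proof. by rewrite /t; case: ifPn => [|_]; rewrite ?inE// normr0 mulr_ge0. Qed.

Let t_cvg z : t n z @[n --> \oo] --> f z.
Proof.
have [f0|f0] := eqVneq (f z) 0.
  rewrite f0 (_ : (fun n => t n z) = cst 0); first exact: cvg_cst.
  by apply/funext => n; apply/eqP; rewrite -normr_le0 (le_trans (t_le n z))// f0 normr0 mulr0.
apply/cvgrPdist_le => e e0.
have fz : 0 < `|f z| by rewrite normr_gt0.
have near1 : \forall n \near \oo, `|f z - s n z| <= `|f z| by have /cvgrPdist_le/(_ _ fz) := @sf z.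
have near2 : \forall n \near \oo, `|f z - s n z| <= e by have /cvgrPdist_le/(_ _ e0) := @sf z.
near=> n; rewrite /t mem_set; first by near: n.
rewrite /B/= mulr_natl mulr2n -[s n z](subKr (f z)) (le_trans (ler_normB _ _))// lerD2l.
by near: n.
Unshelve. all: by end_near. Qed.

Let dist n z : \bar R := (`|t n z - f z|)%:E.

Let measurable_dist n : measurable_fun setT (dist n).
Proof.
apply/measurable_EFinP.
apply: (@measurable_fun_cvg _ _ _ _ (fun m z => `|t n z - s m z|)) => [m|z _].
  exact: (measurable_simple2 (fun x y => `|x - y|) (simple_t n) (ss m)).
by apply: cvg_norm; apply: cvgB; [exact: cvg_cst|exact: sf].
Qed.

Let integrable_norm : P.-integrable setT (fun z => (`|f z|)%:E).
Proof.
apply/integrableP; split; first exact/measurable_EFinP.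
by under eq_integral do rewrite abse_EFin normr_id.
Qed.

Let dist_cvg : (\int[P]_z dist n z)%E @[n --> \oo] --> (0%R)%:E.
Proof.
have ig : P.-integrable setT (fun z => 3%:E * (`|f z|)%:E)%E by exact: integrableZl.
have dist0 : {ae P, forall z, [set: T] z -> dist n z @[n --> \oo] --> cst (0%R)%:E z}.
  apply: aeW => z _; apply: cvg_EFin; first exact: nearW.
  rewrite -(normr0 X) -(subrr (f z)); apply: cvg_norm.
  by apply: cvgB; [exact: t_cvg|exact: cvg_cst].
have dist_le : {ae P, forall z n, [set: T] z -> (`|dist n z| <= 3%:E * (`|f z|)%:E)%E}.
  apply: aeW => z n _; rewrite /dist gee0_abs ?lee_fin// (le_trans (ler_normB _ _))//.
  by have := t_le n z; lra.
have [_ _] := dominated_convergence measurableT measurable_dist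
  (measurable_cst (0%R)%:E) dist0 ig dist_le.
by rewrite integral_cst// mul0e.
Qed.

Let integrable_dual (psi : dual X) : P.-integrable setT (fun z => (psi (f z))%:E).
Proof.
have ig : P.-integrable setT (fun z => `|psi|%:E * (`|f z|)%:E)%E by exact: integrableZl.
apply: (le_integrable measurableT _ _ ig) => [|z _].
  by apply/measurable_EFinP; exact: measurable_dual_limit.
by rewrite -EFinM !abse_EFin lee_fin (le_trans (dual_le _ _))// ler_norm.
Qed.

Let integrable_dual_t n (psi : dual X) : P.-integrable setT (fun z => (psi (t n z))%:E).
Proof.
have ig : P.-integrable setT (fun z => (`|psi| * 2)%:E * (`|f z|)%:E)%E by exact: integrableZl.
apply: (le_integrable measurableT _ _ ig) => [|z _].
  by apply/measurable_EFinP; exact: (measurable_simple psi (simple_t n)).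
rewrite -EFinM !abse_EFin lee_fin (le_trans (dual_le _ _))//.
by rewrite (le_trans _ (ler_norm _))// -mulrA ler_wpM2l.
Qed.

(** The means of the simple functions [t n], tested with [psi], approach the integral at a rate
    proportional to the norm of [psi]. This uniformity makes them a Cauchy sequence in norm, and
    completeness provides the mean. *)
Lemma bochner_mean :
  exists x, forall psi : dual X, (\int[P]_z (psi (f z))%:E = (psi x)%:E)%E.
Proof.
have /choice[x xP] n := simple_mean P (simple_t n).
have fin (psi : dual X) : (\int[P]_z (psi (f z))%:E)%E \is a fin_num.
  exact: integrable_fin_num.
pose I (psi : dual X) := fine (\int[P]_z (psi (f z))%:E)%E.
have IE (psi : dual X) : (\int[P]_z (psi (f z))%:E = (I psi)%:E)%E by rewrite /I fineK.
have small (e : R) : 0 < e -> exists N, forall n, (N <= n)%N -> forall psi : dual X,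
    `|psi (x n) - I psi| <= `|psi| * e.
  move=> e0; have /fine_cvgP[dfin /cvgrPdist_le/(_ e e0) de] := dist_cvg.
  have [N _ NP] := filterI dfin de.
  exists N => n Nn psi; have [/= nfin ne] := NP n Nn.
  rewrite -lee_fin -abse_EFin EFinB -xP -IE -(integralB_EFin measurableT
    (integrable_dual_t n psi) (integrable_dual psi)).
  rewrite (le_trans (le_abse_integral _ _ _))//.
    by apply/measurable_EFinP; apply: measurable_funB;
      [exact: (measurable_simple psi (simple_t n))|exact: measurable_dual_limit].
  rewrite (@le_trans _ _ (\int[P]_z (`|psi|%:E * dist n z))%E)//.
    apply: ge0_le_integral => //.
    - by apply: measurableT_comp => //; apply/measurable_EFinP; apply: measurable_funB;
        [exact: (measurable_simple psi (simple_t n))|exact: measurable_dual_limit].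
    - by apply: emeasurable_funM => //; exact: measurable_cst.
    - by move=> z _; rewrite -EFinB -dualB; exact: dual_le.
  rewrite ge0_integralZl//; last by move=> z _; rewrite lee_fin.
  rewrite EFinM lee_wpmul2l ?lee_fin// -(fineK nfin) lee_fin.
  by rewrite (le_trans (ler_norm _))// -normrN -sub0r.
have xc : cvgn x.
  apply: cauchy_cvg; apply: cauchy_exP => e e0.
  have [|N NP] := small (e / 3); first by rewrite divr_gt0.
  exists (x N); exists N => // n /= Nn.
  rewrite -ball_normE/= (@le_lt_trans _ _ (2 * (e / 3)))//; last by lra.
  apply: le_norm_dual => psi psi1; rewrite dualB.
  rewrite (le_trans (ler_norm _))// (le_trans (ler_distD (I psi) _ _))//.
  have h k : (N <= k)%N -> `|psi (x k) - I psi| <= e / 3.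
    by move=> Nk; rewrite (le_trans (NP k Nk psi))// ler_piMl// divr_ge0// ltW.
  by rewrite mulr_natl mulr2n lerD ?h// distrC h.
exists (limn x) => psi; rewrite IE; congr (_%:E).
have c1 : psi (x n) @[n --> \oo] --> psi (limn x).
  by apply: continuous_cvg => //; exact: dual_continuous.
have c2 : psi (x n) @[n --> \oo] --> I psi.
  apply/cvgrPdist_le => e e0.
  have [|N NP] := small (e / (`|psi| + 1)); first by rewrite divr_gt0// ltr_wpDl.
  exists N => // n /= Nn; rewrite distrC (le_trans (NP n Nn psi))//.
  by rewrite mulrCA ler_piMr ?(ltW e0)// ler_pdivrMr ?ltr_wpDl// mul1r lerDl.
exact: (@cvg_unique _ (@Rhausdorff R) _ _ _ _ c2 c1).
Qed.

End bochner_mean.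

Section representatives.
Context d (T : measurableType d) (R : realType) (P : probability T R) (X : normedModType R).

(** Setting everything to zero on a measurable null set turns almost everywhere convergence into
    convergence everywhere. *)
Lemma bochner_representative (W : T -> X) : bochner_measurable P W ->
  exists N (s : nat -> T -> X) (f : T -> X), [/\ measurable N, P N = 0%E,
    forall n, simple_function (s n), forall z, s n z @[n --> \oo] --> f z &
    forall z, ~ N z -> W z = f z].
Proof.
move=> [s ss [N [mN N0 NP]]].
exists N, (fun n z => if z \in ~` N then s n z else 0), (fun z => if z \in ~` N then W z else 0).
split => // [n|z|z Nz].
- by apply: simple_function_restrict (ss n) _; exact: measurableC.
- case: ifPn => [|_]; last exact: cvg_cst.
  by rewrite inE => Nz; apply: contrapT => h; apply: Nz; exact: NP.
- by rewrite mem_set.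
Qed.

End representatives.

(** * Necessity of reflexivity *)

Section constant_sequences.
Context {R : realType} {X : normedModType R}.
Local Notation R1 := (measurableTypeR R).
Local Notation sq := (square_lebesgue R).

Lemma point_graph_nonempty : (0 < #|{: unit}|)%N.
Proof. by rewrite card_unit. Qed.

Definition point_graph (x : X) : target_graph X :=
  @TargetGraph R X unit (fun _ _ => x) point_graph_nonempty (fun _ _ => erefl).

Lemma hom_density_point_graph (F : test_graph X) x :
  hom_density F (point_graph x) = \prod_(e | oriented_edge e) @test_decoration R X F e.1 e.2 x.
Proof.
rewrite /hom_density /= sumr_const card_ffun card_unit.
by rewrite exp1n mulr1n expr1n invr1 mul1r.
Qed.

Lemma target_norm_point_graph p x : 0 < p -> target_norm p (point_graph x) = `|x|.
Proof.
move=> p0; rewrite /target_norm /= sumr_const card_unit mulr1n sumr_const card_unit mulr1n.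
by rewrite expr1n invr1 mul1r -powRrM divff ?gt_eqF// powRr1.
Qed.

Lemma edge_graph_sym : symmetric (fun i j : bool => i != j).
Proof. by move=> i j; rewrite eq_sym. Qed.

Lemma edge_graph_irr : irreflexive (fun i j : bool => i != j).
Proof. by move=> i; rewrite eqxx. Qed.

Definition edge_graph (psi : dual X) : test_graph X :=
  @TestGraph R X bool _ (fun _ _ => psi) edge_graph_sym edge_graph_irr (fun _ _ _ => erefl).

(** Which orientation is selected depends on the enumeration of [bool]; both cases are covered. *)
Lemma oriented_edge_graph (psi : dual X) : exists2 e0 : bool * bool,
  enum_rank e0.1 != enum_rank e0.2 &
  forall e, @oriented_edge R X (edge_graph psi) e = (e == e0).
Proof.
have [b bP] : exists b, (enum_rank b < enum_rank (~~ b))%N.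
  have [h|h] := boolP (enum_rank true < enum_rank false)%N; first by exists true.
  exists false; rewrite -leqNgt in h.
  by rewrite ltn_neqAle h andbT val_eqE (inj_eq enum_rank_inj).
exists (b, ~~ b) => /= [|[i j]]; first by rewrite (inj_eq enum_rank_inj); case: (b).
rewrite /oriented_edge/= xpair_eqE; have := ltnW bP; rewrite leqNgt => bP'.
by move: i j; case: b bP bP' => /= bP bP' [] []; rewrite ?eqxx//= ?bP// (negbTE bP').
Qed.

(** The preimage of [N] in the cube is null by [cube_marginal], so [W] may be replaced by its
    measurable representative; the marginal formula then applies to the positive and negative
    parts. *)
Lemma graphon_density_edge (psi : dual X) (W f : R * R -> X) (N : set (R1 * R1)) :
  measurable N -> sq N = 0%E -> (forall z, ~ N z -> W z = f z) ->
  measurable_fun setT (fun z : R1 * R1 => psi (f z)) ->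
  graphon_density (edge_graph psi) W = fine (\int[sq]_z (psi (f z))%:E)%E.
Proof.
move=> mN N0 Wf mf; have [e0 r0 eP] := oriented_edge_graph psi.
pose g (z : R1 * R1) := (psi (f z))%:E.
have mg : measurable_fun setT g by exact/measurable_EFinP.
rewrite /graphon_density /Rintegral; congr fine.
set i := enum_rank e0.1 in r0 *; set j := enum_rank e0.2 in r0 *.
pose pr (x : #|{: bool}|.-tuple R1) : R1 * R1 := (tnth x i, tnth x j).
rewrite (@eq_integral_off_null _ _ _ _ (pr @^-1` N) _ _ _
  (fun x => (psi (f (pr x)))%:E)).
- rewrite integralE [RHS]integralE; congr (_ - _)%E.
    rewrite -(ge0_integral_marginal r0 (measurable_funepos mg) (@funepos_ge0 _ _ g)).
    by apply: eq_integral => x _; rewrite !funeposE.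
  rewrite -(ge0_integral_marginal r0 (measurable_funeneg mg) (@funeneg_ge0 _ _ g)).
  by apply: eq_integral => x _; rewrite !funenegE.
- by rewrite -[_ @^-1` _]setTI; exact: measurable_tnth_pair.
- exact: etrans (cube_marginal r0 mN) N0.
- by move=> x Nx; rewrite (big_pred1 e0) ?Wf.
Qed.

End constant_sequences.

Section necessity.
Context {R : realType} {X : completeNormedModType R}.
Local Notation sq := (square_lebesgue R).

Lemma weak_star_approx (L : dual (dual X)) : separable (dual X) ->
  exists x : nat -> X, (forall n, `|x n| <= `|L| + 1) /\
    forall psi : dual X, psi (x n) @[n --> \oo] --> L psi.
Proof.
move=> /separable_approx[phi phid].
have n0 (n : nat) : 0 < n.+1%:R^-1 :> R by rewrite invr_gt0.
have /choice[x xP] (n : nat) : exists x : X, `|x| <= `|L| + 1 /\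
    forall i, (i < n)%N -> `|phi i x - L (phi i)| <= n.+1%:R^-1.
  by have [x ? ?] := helly L phi n (n0 n); exists x.
exists x; split => [n|psi]; first by have [] := xP n.
apply/cvgrPdist_le => e e0; pose M := `|L| + 1.
have M0 : 0 < M by rewrite ltr_wpDl.
(* [M] bounds both the norm of [L] and the norms of the [x n], so replacing [psi] by [phi k] costs a
   third of [e] on either side; Helly's error takes the last third. *)
have d0 : 0 < e / (3 * M) by rewrite divr_gt0// mulr_gt0.
have e3 : 0 < e / 3 by rewrite divr_gt0.
have [k /ltW hk] := phid psi _ d0.
have [N _ NP] := near_infty_natSinv_lt (PosNum e3).
exists (maxn N k.+1) => // n /=; rewrite geq_max => /andP[Nn kn].
have [xn xk] := xP n.
have dM : M * (e / (3 * M)) = e / 3 by field; rewrite gt_eqF.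
rewrite (_ : L psi - psi (x n) = L (psi - phi k) + (L (phi k) - phi k (x n)) -
  (psi - phi k) (x n)); last first.
  have -> : (psi - phi k) (x n) = psi (x n) - phi k (x n) by [].
  by rewrite [L (psi - _)]dualB; ring.
rewrite (le_trans (ler_normB _ _))// (_ : e = e / 3 + e / 3 + e / 3); last by field.
apply: lerD; first rewrite (le_trans (ler_normD _ _))// lerD//.
- rewrite (le_trans (dual_le _ _))// -dM ler_pM// lerDl//.
- by rewrite distrC (le_trans (xk k kn))// ltW//; exact: (NP n Nn).
- by rewrite (le_trans (dual_le _ _))// -dM mulrC ler_pM.
Qed.

Lemma representation_reflexive : separable (dual X) ->
  graphon_representation_property X -> reflexive_space X.
Proof.
move=> sX rep; apply/seteqP; split => // L _.
have [x [xL xc]] := weak_star_approx L sX.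
have [||W [bW _ fW] WP] := rep (fun n => point_graph (x n)).
- move=> p p1; exists (`|L| + 1) => _ [n _ <-].
  by rewrite target_norm_point_graph// (lt_le_trans _ p1).
- move=> F; apply/cvg_ex; exists (\prod_(e | oriented_edge e) L (@test_decoration R X F e.1 e.2)).
  under eq_fun do rewrite hom_density_point_graph.
  by apply: cvg_prodF => e _; exact: xc.
have [N [s [f [mN N0 ss sf Wf]]]] := bochner_representative bW.
(* Integrability is the moment condition of exponent 1, carried over from [W] to its
   representative. *)
have f_fin : (\int[sq]_z (`|f z|)%:E < +oo)%E.
  rewrite (@eq_integral_off_null _ _ _ sq N mN N0 _ (fun z => (`|W z| `^ 1)%:E)) ?fW// => z Nz.
  by rewrite Wf// powRr1.
have [y yP] := bochner_mean ss sf f_fin.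
exists y => //; apply: dualE => psi.
have := WP (edge_graph psi); rewrite (graphon_density_edge mN N0 Wf (measurable_dual_limit ss sf psi)) yP /=.
under eq_fun do rewrite hom_density_point_graph.
have [e0 _ eP] := oriented_edge_graph psi.
under eq_fun do rewrite (big_pred1 e0)//=.
by move=> h; exact: (cvgF_unique h (xc psi)).
Qed.

End necessity.

Theorem theorem4p1 (R : realType) (X : completeNormedModType R)
    (hX : separable (dual X)) :
  graphon_representation_property X <-> reflexive_space X.
Proof.
by split; [exact: representation_reflexive|exact: reflexive_representation].
Qed.
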